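(* Let $0<\mu\le1$ and $0\ge V\in L^\infty(\mathbb{R}^N)$. Suppose that for some $1\le p,q\le\infty$ and $0<s\le\ell\le N$ satisfying $\frac sq\le\frac\ell p$ there are constants $C,\omega>0$ such that $$\|S_{\mu,V}(t)\|_{\mathcal{L}(M^{p,\ell}(\mathbb{R}^N),M^{q,s}(\mathbb{R}^N))}\le\frac{Ce^{-\omega t}}{t^{\frac1{2\mu}(\frac\ell p-\frac sq)}},\quad t>0.$$ Then $\omega_\infty>0$, and $V$ satisfies the Arendt and Batty condition: $\int_GV\,dx=-\infty$ for all $G\in\mathcal{G}$.
   Context: $\mathcal{G}$ is the class of all open subsets $G$ of $\mathbb{R}^N$ containing arbitrarily large balls, i.e. for every $r>0$ there is $x_0\in\mathbb{R}^N$ with $B(x_0,r)\subset G$. Morrey spaces: for $1\le p<\infty$, $0\le \ell\le N$, $M^{p,\ell}(\mathbb{R}^N)$ is the space of $\phi\in L^p_{loc}(\mathbb{R}^N)$ with $\|\phi\|_{M^{p,\ell}}:=\sup_{x_0\in\mathbb{R}^N,R>0}R^{\frac{\ell-N}{p}}\|\phi\|_{L^p(B(x_0,R))}<\infty$; $M^{\infty,\ell}(\mathbb{R}^N):=L^\infty(\mathbb{R}^N)$. Fractional heat semigroup: $S_\mu(t)u_0(x)=\int_{\mathbb{R}^N}k_\mu(t,x-y)u_0(y)\,dy$, $k_\mu(t,x)=(2\pi)^{-N}\int_{\mathbb{R}^N}e^{ix\cdot\xi-t|\xi|^{2\mu}}\,d\xi$, $t>0$; $S_\mu(0)=I$. Perturbed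 semigroup (for $u_t+(-\Delta)^\mu u=Vu$, $V\in L^\infty(\mathbb{R}^N)$): for $1\le p\le\infty$, $0<\ell\le N$ and $u_0\in M^{p,\ell}(\mathbb{R}^N)$, $u(t)=S_{\mu,V}(t)u_0$ is the unique $u\in C((0,\infty),M^{p,\ell}(\mathbb{R}^N))$, bounded on $(0,T]$ for each $T>0$, with $u(t)=S_\mu(t)u_0+\int_0^tS_\mu(t-s)Vu(s)\,ds$ for $t>0$; $S_{\mu,V}(0)=I$. Exponential type in $L^\infty$: $\omega_\infty=\omega_\infty(V)$ is the supremum of all $\omega\in\mathbb{R}$ such that $\|S_{\mu,V}(t)\|_{\mathcal{L}(L^\infty(\mathbb{R}^N))}\le Me^{-\omega t}$ for all $t\ge0$ and some $M\ge1$. *)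

(* Defs.v *)
From HB Require Import structures.
From mathcomp Require Import all_boot all_order all_algebra.
From mathcomp Require Import all_classical all_reals all_analysis.
From mathcomp Require Import complex.

Set Implicit Arguments.
Unset Strict Implicit.
Unset Printing Implicit Defensive.
Import Order.TTheory GRing.Theory Num.Theory.
Import numFieldNormedType.Exports.
Local Open Scope classical_set_scope.
Local Open Scope ring_scope.

(* R^n is 'rV[R]_n.  Its sigma-algebra is generated by the n coordinates, as
   the library does for tuples; it is the Borel sigma-algebra of the library's
   topology on 'rV[R]_n.  Classes of functions modulo a.e. equality are handled
   through Borel representatives. *)
Section measurable_rV.
Context {R : realType} (n : nat).

Let coor : 'I_n -> 'rV[R]_n -> measurableTypeR R := fun i x => x ord0 i.

Let rV_set0 : g_sigma_preimage coor set0.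
Proof. exact: sigma_algebra0. Qed.

Let rV_setC A : g_sigma_preimage coor A -> g_sigma_preimage coor (~` A).
Proof. exact: sigma_algebraC. Qed.

Let rV_bigcup (F : (set 'rV[R]_n)^nat) :
  (forall i, g_sigma_preimage coor (F i)) ->
  g_sigma_preimage coor (\bigcup_i (F i)).
Proof. exact: sigma_algebra_bigcup. Qed.

HB.instance Definition _ := @isMeasurable.Build default_measure_display
  'rV[R]_n (g_sigma_preimage coor) rV_set0 rV_setC rV_bigcup.

Lemma measurable_coor (i : 'I_n) :
  measurable_fun [set: 'rV[R]_n] (fun x => x ord0 i : measurableTypeR R).
Proof.
move=> _ Y mY; rewrite setTI; apply: sub_sigma_algebra => /=.
rewrite -bigcup_seq/=; exists i => /=; first by rewrite mem_index_enum.
by exists Y => //; rewrite setTI.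
Qed.

Lemma measurable_fun_coorP d (T : measurableType d) (f : T -> 'rV[R]_n) :
  (forall i, measurable_fun [set: T] (fun x => f x ord0 i : measurableTypeR R)) ->
  measurable_fun [set: T] f.
Proof.
move=> mf; pose D : set (set 'rV[R]_n) :=
  \big[setU/set0]_(i < n) preimage_set_system setT (@coor i) measurable.
apply: (@measurability _ _ T 'rV[R]_n setT f D) => //.
move=> _ [A + <-]; rewrite /D -bigcup_seq => -[i/= _ [B mB <-]].
by have := mf i measurableT B mB; rewrite !setTI.
Qed.

End measurable_rV.

Definition row_cons {R : realType} n (xv : measurableTypeR R * 'rV[R]_n) :
  'rV[R]_n.+1 := row_mx (const_mx xv.1 : 'rV[R]_1) xv.2.

Lemma row_cons0 {R : realType} n (xv : measurableTypeR R * 'rV[R]_n) :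
  row_cons xv ord0 ord0 = xv.1.
Proof.
rewrite /row_cons; have -> : ord0 = lshift n (ord0 : 'I_1) :> 'I_(1 + n).
  exact: val_inj.
by rewrite (row_mxEl (const_mx xv.1 : 'rV[R]_1)) mxE.
Qed.

Lemma row_consS {R : realType} n (xv : measurableTypeR R * 'rV[R]_n) i :
  row_cons xv ord0 (lift ord0 i) = xv.2 ord0 i.
Proof.
rewrite /row_cons; have -> : lift ord0 i = rshift 1 i :> 'I_(1 + n).
  exact: val_inj.
by rewrite (row_mxEr (const_mx xv.1 : 'rV[R]_1)).
Qed.

Lemma measurable_row_cons {R : realType} n :
  measurable_fun [set: measurableTypeR R * 'rV[R]_n] (@row_cons R n).
Proof.
apply: measurable_fun_coorP => i; case: (unliftP ord0 i) => [j ->|->].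
  under eq_fun do rewrite row_consS.
  exact: (measurableT_comp (@measurable_coor R n j) measurable_snd).
under eq_fun do rewrite row_cons0.
exact: measurable_fst.
Qed.

Section lebesgue_step.
Context {R : realType} (n : nat).
Variable m : {sigma_finite_measure set 'rV[R]_n -> \bar R}.

Definition lebesgue_step : set 'rV[R]_n.+1 -> \bar R :=
  pushforward (@lebesgue_measure R \x m)%E (@row_cons R n).

Let step0 : lebesgue_step set0 = 0%E.
Proof. by rewrite /lebesgue_step /pushforward preimage_set0 measure0. Qed.

Let step_ge0 A : (0 <= lebesgue_step A)%E.
Proof. by rewrite /lebesgue_step /pushforward; exact: measure_ge0. Qed.

Let step_sigma_additive : semi_sigma_additive lebesgue_step.
Proof.
move=> F mF tF mUF; rewrite /lebesgue_step /pushforward preimage_bigcup.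
have mp A : measurable A -> measurable (@row_cons R n @^-1` A).
  by move=> mA; rewrite -[X in measurable X]setTI; exact: measurable_row_cons.
apply: measure_semi_sigma_additive.
- by move=> k; exact: mp.
- apply/trivIsetP => /= i j _ _ ij; rewrite -preimage_setI.
  by move/trivIsetP : tF => /(_ _ _ _ _ ij) ->//; rewrite preimage_set0.
- by rewrite -preimage_bigcup; exact: mp.
Qed.

HB.instance Definition _ := isMeasure.Build _ _ _
  lebesgue_step step0 step_ge0 step_sigma_additive.

Let step_sigma_finite : sigma_finite setT lebesgue_step.
Proof.
pose uncons (x : 'rV[R]_n.+1) : measurableTypeR R * 'rV[R]_n :=
  (x ord0 ord0, \row_i x ord0 (lift ord0 i)).
have row_consK : cancel (@row_cons R n) uncons.
  move=> [x v]; rewrite /uncons row_cons0; congr pair.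
  by apply/rowP => i; rewrite mxE row_consS.
have muncons : measurable_fun [set: 'rV[R]_n.+1] uncons.
  apply: measurable_fun_pair; first exact: measurable_coor.
  apply: measurable_fun_coorP => i; under eq_fun do rewrite mxE.
  exact: measurable_coor.
have /sigma_finiteP[F [TF ndF Foo]] := sigma_finiteT (@lebesgue_measure R).
have /sigma_finiteP[G [TG ndG Goo]] := sigma_finiteT m.
exists (fun k => uncons @^-1` (F k `*` G k)).
  rewrite -preimage_bigcup (_ : \bigcup_k _ = setT) ?preimage_setT//.
  apply/seteqP; split => // -[x v] _.
  have : setT x by [].
  have : setT v by [].
  rewrite {1}TF {1}TG => -[j _ Gv] [i _ Fx]; exists (maxn i j) => //; split => /=.
  - by move: x Fx; exact/subsetPset/ndF/leq_maxl.
  - by move: v Gv; exact/subsetPset/ndG/leq_maxr.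
move=> k; have [mF Fk] := Foo k; have [mG Gk] := Goo k; split.
  rewrite -[X in measurable X]setTI; apply: muncons => //.
  exact: measurableX.
rewrite /lebesgue_step /pushforward -comp_preimage.
rewrite (_ : uncons \o @row_cons R n = id); last exact/funext.
rewrite preimage_id product_measure1E//.
by rewrite lte_mul_pinfty// ge0_fin_numE.
Qed.

HB.instance Definition _ := Measure_isSigmaFinite.Build _ _ _
  lebesgue_step step_sigma_finite.

End lebesgue_step.

(* n-dimensional Lebesgue measure on Borel sets: iterated product of the
   one-dimensional one (leb_box below characterises it) *)
Fixpoint leb {R : realType} n : {sigma_finite_measure set 'rV[R]_n -> \bar R} :=
  if n is n'.+1 then lebesgue_step (leb n') else \d_(0 : 'rV[R]_0).

Lemma leb_box {R : realType} n (A : 'I_n -> set (measurableTypeR R)) :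
  (forall i, measurable (A i)) ->
  leb n [set x : 'rV[R]_n | forall i, A i (x ord0 i)] =
  (\prod_(i < n) lebesgue_measure (A i))%E.
Proof.
elim: n A => [|n IH] A mA.
  by rewrite big_ord0 /= diracE mem_set// => -[].
rewrite big_ord_recl -(IH (fun i => A (lift ord0 i)))//= /lebesgue_step.
have mB : measurable [set x : 'rV[R]_n | forall i, A (lift ord0 i) (x ord0 i)].
  rewrite (_ : [set x : 'rV[R]_n | _] =
    \big[setI/setT]_(i < n) [set x : 'rV[R]_n | A (lift ord0 i) (x ord0 i)]).
    apply: bigsetI_measurable => i _; rewrite -[X in measurable X]setTI.
    exact: measurable_coor.
  rewrite -bigcap_seq; apply/seteqP; split => [x /= Ax i _|x /= Ax i].
    exact: Ax.
  by apply: Ax; rewrite /= mem_index_enum.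
rewrite -product_measure1E// /pushforward; congr (product_measure1 _ _ _).
apply/seteqP; split => [[x v] /= Axv|[x v] /= [Ax Av] i].
  split => /= [|i]; first by have := Axv ord0; rewrite row_cons0.
  by have := Axv (lift ord0 i); rewrite row_consS.
by case: (unliftP ord0 i) => [j ->|->]; rewrite ?row_consS ?row_cons0.
Qed.

Section euclidean.
Context {R : realType} (N : nat).
Implicit Types x y : 'rV[R]_N.

Definition dotp x y : R := \sum_(i < N) x ord0 i * y ord0 i.

(* the library's norm on 'rV[R]_N is the sup norm *)
Definition enorm x : R := Num.sqrt (dotp x x).

Definition eball x (r : R) : set 'rV[R]_N := [set y | enorm (y - x) < r].

End euclidean.

Definition large_open {R : realType} {N} (G : set 'rV[R]_N) : Prop :=
  open G /\ forall r : R, 0 < r -> exists x0, eball x0 r `<=` G.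

Section morrey.
Context {R : realType} (N : nat).
Implicit Types (p : \bar R) (l : R) (phi : 'rV[R]_N -> R).

(* l / p, with the convention l / +oo = 0 *)
Definition rdive l p : R := if p is r%:E then l / r else 0.

Definition morrey_norm p l phi : \bar R :=
  match p with
  | r%:E => ereal_sup [set z | exists x0 (rho : R), 0 < rho /\
      z = ((rho `^ ((l - N%:R) / r))%:E
           * Lnorm (leb N) r%:E (EFin \o (phi \_ (eball x0 rho))))%E]
  | _ => Lnorm (leb N) p (EFin \o phi)
  end.

(* a finite Morrey norm entails that phi is locally in L^p *)
Definition morrey p l : set ('rV[R]_N -> R) :=
  [set phi | measurable_fun setT phi /\ (morrey_norm p l phi < +oo)%E].

(* norm of an operator from M^(p,l) to M^(q,s); it is +oo if the operator is
   unbounded or does not map M^(p,l) into M^(q,s) *)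
Definition morrey_opnorm p l (q : \bar R) (s : R)
    (T : ('rV[R]_N -> R) -> 'rV[R]_N -> R) : \bar R :=
  ereal_sup [set morrey_norm q s (T phi) | phi in
    [set phi | morrey p l phi /\ (morrey_norm p l phi <= 1)%E]].

End morrey.

Section semigroups.
Context {R : realType} (N : nat).
Implicit Types (mu t l : R) (p : \bar R) (V : 'rV[R]_N -> R)
  (u : R -> 'rV[R]_N -> R).

Definition cexp (z : R[i]) : R[i] :=
  Complex (expR (complex.Re z) * cos (complex.Im z))
          (expR (complex.Re z) * sin (complex.Im z)).

Definition cintegral (f : 'rV[R]_N -> R[i]) : R[i] :=
  Complex (\int[leb N]_x complex.Re (f x)) (\int[leb N]_x complex.Im (f x)).

Definition frac_heat_kernel mu t (x : 'rV[R]_N) : R[i] :=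
  real_complex R ((2 * pi) ^- N) *
  cintegral (fun xi => cexp (Complex (- (t * enorm xi `^ (2 * mu))) (dotp x xi))).

(* the kernel is real: the imaginary part of its integrand is odd in xi *)
Definition frac_heat mu t (u0 : 'rV[R]_N -> R) : 'rV[R]_N -> R :=
  if t == 0 then u0 else
  fun x => \int[leb N]_y (complex.Re (frac_heat_kernel mu t (x - y)) * u0 y).

(* u is a solution of the integral equation in the class of functions in
   C((0,oo), M^(p,l)) which are bounded on each (0,T].  The integral over (0,t)
   is taken pointwise, for a.e. x: this is the integral in M^(p,l) because
   S_mu(t - s) (V u(s)) is a well-defined function of x for s < t, independent
   of the representative of u(s). *)
Definition perturbed_solution mu V p l (u0 : 'rV[R]_N -> R) u : Prop :=
  [/\ forall t, 0 < t -> morrey p l (u t),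
      forall t, 0 < t ->
        morrey_norm p l (u s \- u t) @[s --> t] --> 0%E,
      forall T, 0 < T -> exists K : R, forall t, 0 < t <= T ->
        (morrey_norm p l (u t) <= K%:E)%E &
      forall t, 0 < t -> {ae leb N, forall x,
        let F s := frac_heat mu (t - s) (V \* u s) x in
        (@lebesgue_measure R).-integrable `]0, t[ (EFin \o F) /\
        u t x = frac_heat mu t u0 x
                + \int[@lebesgue_measure R]_(s in `]0, t[) F s} ].

(* S_(mu,V)(t) u0 on M^(p,l): the value at time t of the solution, which is
   unique up to a.e. equality at each time *)
Definition perturbed_semigroup mu V p l t (u0 : 'rV[R]_N -> R) : 'rV[R]_N -> R :=
  if t == 0 then u0 else
  xget (fun _ _ => 0) [set u | perturbed_solution mu V p l u0 u] t.

(* L^oo is M^(oo,l) for every l; l = N is chosen here *)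
Definition exp_type_Linfty mu V : \bar R :=
  ereal_sup [set omega%:E | omega in [set omega : R |
    exists2 M : R, 1 <= M & forall t, 0 <= t ->
      (morrey_opnorm +oo N%:R +oo N%:R (perturbed_semigroup mu V +oo N%:R t)
         <= (M * expR (- (omega * t)))%:E)%E]].

End semigroups.

(* Main.v *)
(** Let [V = - W] a.e. with [0 <= W <= L].  The kernel [K_t] of the fractional heat
    semigroup [S_t] is nonnegative and radially nonincreasing, because
    exp(-t|xi|^(2 mu)) is a limit of positive combinations of Gaussians.  A Picard
    iteration with nonnegative terms yields operators [P_t] with
    P_t + \int_0^t S_(t-s) W P_s ds = S_t and P_(t+s) <= P_t P_s on nonnegative
    functions.  For bounded data, [P_t] is up to a.e. equality the only solution of the
    integral equation in a Morrey space, and it is a solution for integrable data.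

    The decay hypothesis, applied to the indicator function of a ball B(x,R), and the
    smoothing of Morrey functions by [S_1] bound P_(t+1) 1_B(x,R) at [x] by a polynomial
    in R times exp(-omega t); the contribution of the complement of the ball is at most
    the tail of K_(t+1).  With R a small exponential in t, this gives P_T 1 <= 1/2
    everywhere for some T, and the iteration of this inequality gives [omega_oo > 0].

    By Duhamel's formula, \int_0^T S_(T-s) W ds >= 1/2 everywhere.  For large r and for
    the points of B(x0,r), the values of W outside of B(x0,2r) contribute at most 1/4;
    integrating over B(x0,r) gives \int_B(x0,2r) W >= d r^N with d independent of x0,
    hence the divergence of the integral of V on a set containing arbitrarily large
    balls. *)
Require Import Defs.
From HB Require Import structures.
From mathcomp Require Import all_boot all_order all_algebra.
From mathcomp Require Import all_classical all_reals all_analysis.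
From mathcomp Require Import measurable_realfun ess_sup_inf complex ring lra.
Set Implicit Arguments.
Unset Strict Implicit.
Unset Printing Implicit Defensive.
Import Order.TTheory GRing.Theory Num.Theory.
Import numFieldNormedType.Exports.
Local Open Scope classical_set_scope.
Local Open Scope ring_scope.

(** * Lebesgue measure on R^n *)

(** The decay hypothesis concerns one solution picked among all those of the Morrey class, so
    uniqueness is needed to transfer the bound to the explicit [perturb]. The latter is monotone and
    takes values in [0, +oo], where exchanging integrals only requires Tonelli's theorem. Writing
    the potential as (L - W) - L is what makes the Picard terms nonnegative. A solution is given
    only as a family of Morrey functions, continuous in norm for t > 0; joint measurability in time
    and space is not part of the data. Uniqueness is therefore proved for the functions obtained by
    letting the heat semigroup act on it, which are pointwise finite and jointly measurable. In the
    sup norm no existence is claimed for general bounded data: without a solution the chosen value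
    is 0, and with one it is represented through [perturb]. The Morrey norm of the indicator
    function of a ball of radius R is at most of order 1 + R^N, uniformly in the exponents. The
    choice R^N = exp(omega t / 2) spends half of the decay on the size of the ball and keeps the
    other half. *)

Lemma measurable_integral_param d1 d2 (T1 : measurableType d1)
    (T2 : measurableType d2) (R : realType)
    (m2 : {sigma_finite_measure set T2 -> \bar R}) (f : T1 -> T2 -> \bar R) :
  measurable_fun setT (fun z : T1 * T2 => f z.1 z.2) ->
  (forall x y, (0 <= f x y)%E) ->
  measurable_fun setT (fun x => \int[m2]_y f x y)%E.
Proof.
move=> mf f0.
exact: (@measurable_fun_fubini_tonelli_F _ _ _ _ _ m2
  (fun z : T1 * T2 => f z.1 z.2) mf (fun z => f0 z.1 z.2)).
Qed.

Lemma ge0_integral_swap d1 d2 (T1 : measurableType d1)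
    (T2 : measurableType d2) (R : realType)
    (m1 : {sigma_finite_measure set T1 -> \bar R})
    (m2 : {sigma_finite_measure set T2 -> \bar R}) (f : T1 -> T2 -> \bar R) :
  measurable_fun setT (fun z : T1 * T2 => f z.1 z.2) ->
  (forall x y, (0 <= f x y)%E) ->
  (\int[m1]_x \int[m2]_y f x y = \int[m2]_y \int[m1]_x f x y)%E.
Proof.
move=> mf f0.
exact: (@fubini_tonelli _ _ _ _ _ m1 m2
  (fun z : T1 * T2 => f z.1 z.2) mf (fun z => f0 z.1 z.2)).
Qed.

Section leb_tools.
Context {R : realType}.
Notation lam := (@lebesgue_measure R).

Lemma ge0_integral_leb_succ n (f : 'rV[R]_n.+1 -> \bar R) :
  measurable_fun setT f -> (forall x, (0 <= f x)%E) ->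
  (\int[leb n.+1]_x f x = \int[lam]_x \int[leb n]_v f (row_cons (x, v)))%E.
Proof.
move=> mf f0; rewrite /= /lebesgue_step.
rewrite (@ge0_integral_pushforward _ _ _ _ _ _ (@measurable_row_cons R n)
  (lam \x leb n)%E setT f)//.
rewrite preimage_setT fubini_tonelli1//; last by move=> z; exact: f0.
apply: measurableT_comp => //; exact: measurable_row_cons.
Qed.

Lemma integral_leb_succ n (f : 'rV[R]_n.+1 -> R) :
  (leb n.+1).-integrable setT (EFin \o f) ->
  (\int[leb n.+1]_x (f x)%:E = \int[lam]_x \int[leb n]_v (f (row_cons (x, v)))%:E)%E.
Proof.
move=> intf; have mf := measurable_int _ intf.
have intf' : (lam \x leb n)%E.-integrable setT
    ((EFin \o f) \o (@row_cons R n)).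
  have /integrableP[_ h] := intf; apply/integrableP; split.
    exact: (measurableT_comp mf (@measurable_row_cons R n)).
  move: h; rewrite /= /lebesgue_step (@ge0_integral_pushforward _ _ _ _ _ _
    (@measurable_row_cons R n) (lam \x leb n)%E setT)//.
  by do 2 apply: measurableT_comp => //; exact/measurable_EFinP.
rewrite [LHS](_ : _ = \int[(lam \x leb n)%E]_z (f (row_cons z))%:E)%E; last first.
  by rewrite /= /lebesgue_step (@integral_pushforward _ _ _ _ _ _
    (@measurable_row_cons R n) (lam \x leb n)%E setT).
by rewrite -(integral12_prod_meas1 intf').
Qed.

Lemma ge0_integral_prod n (f : 'I_n -> R -> \bar R) :
  (forall i, measurable_fun setT (f i)) -> (forall i x, (0 <= f i x)%E) ->
  (\int[leb n]_x \prod_(i < n) f i (x ord0 i) = \prod_(i < n) \int[lam]_x f i x)%E.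
Proof.
elim: n f => [|n IH] f mf f0.
  rewrite big_ord0 (eq_integral (cst 1%E)); last by move=> x _; rewrite big_ord0.
  by rewrite integral_cst//= mul1e diracT.
have mp k (g : 'I_k -> R -> \bar R) : (forall i, measurable_fun setT (g i)) ->
  measurable_fun setT (fun x : 'rV[R]_k => \prod_(i < k) g i (x ord0 i))%E.
  move=> mg; elim: (index_enum _) => [|a l IHl].
    by under eq_fun do rewrite big_nil; exact: measurable_cst.
  under eq_fun do rewrite big_cons.
  apply: emeasurable_funM => //.
  exact: (measurableT_comp (mg a) (@measurable_coor R k a)).
rewrite ge0_integral_leb_succ; [|exact: mp|by move=> x; rewrite prode_ge0].
rewrite big_ord_recl -IH//.
under eq_integral => x _.
  under eq_integral => v _.
    rewrite big_ord_recl row_cons0/=.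
    under eq_bigr do rewrite row_consS.
    over.
  rewrite ge0_integralZl//; last 2 first.
  - exact: (mp _ (fun i => f (lift ord0 i))).
  - by move=> v _; rewrite prode_ge0.
  over.
rewrite /= ge0_integralZr//; first exact: mf.
by apply: integral_ge0 => x _; rewrite prode_ge0.
Qed.

(** The pushforward of Lebesgue measure under the affine map, multiplied by [|a|], has the right
    value on half-open intervals, and uniqueness of Lebesgue measure does the rest. For negative [a]
    the preimage is closed on the left instead of the right, which does not change its length. *)
Lemma ge0_integral_affine1 (f : R -> \bar R) (a c : R) : a != 0 ->
  measurable_fun setT f -> (forall x, (0 <= f x)%E) ->
  (\int[lam]_x f (a * x + c)%R = (`|a|^-1)%:E * \int[lam]_x f x)%E.
Proof.
move=> a0 mf f0; pose phi : measurableTypeR R -> measurableTypeR R :=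
  fun x => a * x + c.
have mphi : measurable_fun setT phi.
  by apply: measurable_funD => //; exact: mulrl_measurable.
have a'0 : 0 <= `|a| by [].
pose nu0 := mscale (NngNum a'0) (pushforward lam phi).
pose nu := nu0 mphi.
have E A : measurable A -> lam A = nu A.
  move=> mA; apply: lebesgue_measure_unique => // _ [[u v] /= uv <-].
  rewrite /nu /nu0 /mscale /=.
  have [ap|an] : (0 < a) \/ (a < 0).
    by move: a0; rewrite neq_lt => /orP[]; [right|left].
  - rewrite [pushforward _ _ _](_ : _ = lam `]((u - c) / a), ((v - c) / a)]%classic); last first.
      congr (lam _).
      by apply/seteqP; split => x /=; rewrite !in_itv/= /phi ltr_pdivrMr//
        ler_pdivlMr// ltrBlDr lerBrDr mulrC.
    rewrite !lebesgue_measure_itv/= !lte_fin ltr_pM2r ?invr_gt0// ltrD2r.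
    case: ifP => // _; last by rewrite mule0.
    by rewrite -!EFinD -EFinM gtr0_norm//; congr EFin; field; rewrite gt_eqF.
  - rewrite [pushforward _ _ _](_ : _ = lam `[((v - c) / a), ((u - c) / a)[%classic); last first.
      congr (lam _).
      by apply/seteqP; split => x /=; rewrite !in_itv/= /phi ltr_ndivlMr//
        ler_ndivrMr// ltrBlDr lerBrDr mulrC andbC.
    rewrite !lebesgue_measure_itv/= !lte_fin ltr_nM2r ?invr_lt0// ltrD2r.
    case: ifP => // _; last by rewrite mule0.
    by rewrite -!EFinD -EFinM ltr0_norm//; congr EFin; field; rewrite lt_eqF.
rewrite [X in (_ * X)%E](_ : _ = \int[nu]_x f x)%E; last first.
  by apply: eq_measure_integral => A mA _; exact: E.
rewrite ge0_integral_mscale//= ge0_integral_pushforward//.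
by rewrite muleA -EFinM mulVf ?normr_eq0// mul1e preimage_setT.
Qed.

Lemma measurable_fun_rVD d (T : measurableType d) n (f g : T -> 'rV[R]_n) :
  measurable_fun setT f -> measurable_fun setT g ->
  measurable_fun setT (fun x => f x + g x).
Proof.
move=> mf mg; apply: measurable_fun_coorP => i; under eq_fun do rewrite mxE.
apply: measurable_funD; first exact: (measurableT_comp (@measurable_coor R n i) mf).
exact: (measurableT_comp (@measurable_coor R n i) mg).
Qed.

Lemma measurable_fun_rVZ d (T : measurableType d) n (a : R) (f : T -> 'rV[R]_n) :
  measurable_fun setT f -> measurable_fun setT (fun x => a *: f x).
Proof.
move=> mf; apply: measurable_fun_coorP => i; under eq_fun do rewrite mxE.
apply: measurable_funM => //; exact: (measurableT_comp (@measurable_coor R n i) mf).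
Qed.

Lemma measurable_fun_rVB d (T : measurableType d) n (f g : T -> 'rV[R]_n) :
  measurable_fun setT f -> measurable_fun setT g ->
  measurable_fun setT (fun x => f x - g x).
Proof.
move=> mf mg; apply: measurable_fun_rVD => //.
under eq_fun do rewrite -scaleN1r.
exact: measurable_fun_rVZ.
Qed.

Lemma ge0_integral_affine n (f : 'rV[R]_n -> \bar R) (a : R) (c : 'rV[R]_n) :
  a != 0 -> measurable_fun setT f -> (forall x, (0 <= f x)%E) ->
  (\int[leb n]_x f (a *: x + c)%R = (`|a| ^- n)%:E * \int[leb n]_x f x)%E.
Proof.
move=> a0; elim: n f c => [|n IH] f c mf f0.
  rewrite expr0 invr1 mul1e; apply: eq_integral => x _; congr f.
  by apply/rowP => -[].
rewrite !ge0_integral_leb_succ//; last first.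
  apply: measurableT_comp => //; apply: measurable_fun_rVD => //.
  exact: measurable_fun_rVZ.
pose c' : 'rV[R]_n := \row_i c ord0 (lift ord0 i).
have E x (v : 'rV[R]_n) : a *: row_cons (x, v) + c =
    row_cons (a * x + c ord0 ord0, a *: v + c').
  have aE (w : 'rV[R]_n.+1) k :
      (a *: w + c) ord0 k = a * w ord0 k + c ord0 k by rewrite !mxE.
  apply/rowP => i; rewrite aE; case: (unliftP ord0 i) => [j ->|->].
    by rewrite !row_consS/= !mxE.
  by rewrite !row_cons0.
have mfr : measurable_fun setT
    (fun z : measurableTypeR R * 'rV[R]_n => f (row_cons z)).
  by apply: measurableT_comp => //; exact: measurable_row_cons.
have [G GE] : exists G : measurableTypeR R -> \bar R,
  forall x, G x = (\int[leb n]_v f (row_cons (x, v)))%E by eexists.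
have mG : measurable_fun setT G.
  rewrite (_ : G = fun x => \int[leb n]_v f (row_cons (x, v)))%E; last exact/funext.
  apply: (@measurable_integral_param _ _ _ _ _ _ (fun x v => f (row_cons (x, v)))).
    by under eq_fun => z do rewrite -surjective_pairing.
  by move=> x v; exact: f0.
have G0 x : (0 <= G x)%E by rewrite GE; apply: integral_ge0 => v _; exact: f0.
transitivity (\int[lam]_x ((`|a| ^- n)%:E * G (a * x + c ord0 ord0)%R))%E.
  apply: eq_integral => x _; under eq_integral do rewrite E.
  rewrite (IH (fun v => f (row_cons (a * x + c ord0 ord0, v)))) ?GE//.
  by apply: (measurableT_comp mfr); exact: measurable_pair1.
rewrite ge0_integralZl; [|exact: measurableT| |by move=> x _; exact: G0|
  by rewrite lee_fin invr_ge0 exprn_ge0].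
  rewrite (@ge0_integral_affine1 G)// muleA -EFinM exprS invfM [in RHS]mulrC.
  by congr (_ * _)%E; apply: eq_integral => x _; rewrite GE.
apply: (measurableT_comp mG).
by apply: measurable_funD => //; exact: mulrl_measurable.
Qed.

End leb_tools.

(** * Euclidean norm and volume of balls *)

Section euclid.
Context {R : realType} {N : nat}.
Notation lam := (@lebesgue_measure R).
Implicit Types x y z : 'rV[R]_N.

Lemma dotpC x y : dotp x y = dotp y x.
Proof. by apply: eq_bigr => i _; rewrite mulrC. Qed.

Lemma dotpDl x y z : dotp (x + y) z = dotp x z + dotp y z.
Proof. by rewrite /dotp -big_split; apply: eq_bigr => i _; rewrite mxE mulrDl. Qed.

Lemma dotpZl a x y : dotp (a *: x) y = a * dotp x y.
Proof. by rewrite /dotp mulr_sumr; apply: eq_bigr => i _; rewrite mxE mulrA. Qed.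

Lemma dotpZr a x y : dotp x (a *: y) = a * dotp x y.
Proof. by rewrite dotpC dotpZl dotpC. Qed.

Lemma dotpDr x y z : dotp x (y + z) = dotp x y + dotp x z.
Proof. by rewrite dotpC dotpDl !(dotpC x). Qed.

Lemma dotpNl x y : dotp (- x) y = - dotp x y.
Proof. by rewrite -scaleN1r dotpZl mulN1r. Qed.

Lemma dotpNr x y : dotp x (- y) = - dotp x y.
Proof. by rewrite dotpC dotpNl dotpC. Qed.

Lemma dotpBl x y z : dotp (x - y) z = dotp x z - dotp y z.
Proof. by rewrite dotpDl dotpNl. Qed.

Lemma dotp0l x : dotp 0 x = 0.
Proof. by rewrite -(scale0r x) dotpZl mul0r. Qed.

Lemma dotp_ge0 x : 0 <= dotp x x.
Proof. by apply: sumr_ge0 => i _; rewrite -expr2 sqr_ge0. Qed.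

Lemma enorm_ge0 x : 0 <= enorm x.
Proof. exact: sqrtr_ge0. Qed.

Lemma sqr_enorm x : enorm x ^+ 2 = dotp x x.
Proof. by rewrite sqr_sqrtr ?dotp_ge0. Qed.

Lemma enorm_eq0 x : enorm x = 0 -> x = 0.
Proof.
move=> x0; have : dotp x x = 0 by rewrite -sqr_enorm x0 expr0n.
move=> /eqP; rewrite psumr_eq0; last by move=> i _; rewrite -expr2 sqr_ge0.
move=> /allP h; apply/rowP => i; rewrite mxE.
have := h i (mem_index_enum _); rewrite implyTb mulf_eq0 => /orP[]/eqP //.
Qed.

(** Cauchy-Schwarz, from the nonnegative square of [enorm y *: x - enorm x *: y]. *)
Lemma dotp_le_enorm x y : dotp x y <= enorm x * enorm y.
Proof.
have [/enorm_eq0 ->|x0] := eqVneq (enorm x) 0.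
  by rewrite dotp0l mulr_ge0// enorm_ge0.
have [/enorm_eq0 ->|y0] := eqVneq (enorm y) 0.
  by rewrite dotpC dotp0l mulr_ge0// enorm_ge0.
have := dotp_ge0 (enorm y *: x - enorm x *: y).
rewrite dotpBl !dotpDr !dotpNr !dotpZl !dotpZr (dotpC y x) -!sqr_enorm.
have : 0 < enorm x * enorm y by rewrite mulr_gt0// lt_def ?x0 ?y0 enorm_ge0.
set a := enorm x; set b := enorm y; set d := dotp x y => ab h.
rewrite -(ler_pM2l ab); nra.
Qed.

Lemma enormD x y : enorm (x + y) <= enorm x + enorm y.
Proof.
rewrite -(@ler_pXn2r _ 2)// ?nnegrE ?addr_ge0 ?enorm_ge0// sqrrD !sqr_enorm.
rewrite dotpDl !dotpDr (dotpC y x); have := dotp_le_enorm x y; lra.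
Qed.

Lemma enormZ a x : enorm (a *: x) = `|a| * enorm x.
Proof.
by rewrite /enorm dotpZl dotpZr mulrA sqrtrM -?expr2 ?sqr_ge0// sqrtr_sqr.
Qed.

Lemma enormN x : enorm (- x) = enorm x.
Proof. by rewrite -scaleN1r enormZ normrN1 mul1r. Qed.

Lemma enorm_distC x y : enorm (x - y) = enorm (y - x).
Proof. by rewrite -opprB enormN. Qed.

Lemma le_coor_enorm x i : `|x ord0 i| <= enorm x.
Proof.
rewrite -sqrtr_sqr ler_wsqrtr// /dotp (bigD1 i)//= -expr2 lerDl.
by apply: sumr_ge0 => j _; rewrite -expr2 sqr_ge0.
Qed.

Lemma enorm_le_sum x : enorm x <= \sum_(i < N) `|x ord0 i|.
Proof.
rewrite -(@ler_pXn2r _ 2)// ?nnegrE ?enorm_ge0 ?sumr_ge0// sqr_enorm /dotp.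
rewrite expr2 big_distrl; apply: ler_sum => i _ /=.
rewrite (le_trans (ler_norm _))// normrM ler_wpM2l//.
by rewrite (bigD1 i)//= lerDl sumr_ge0.
Qed.

Lemma measurable_fun_dotp d (T : measurableType d) (f g : T -> 'rV[R]_N) :
  measurable_fun setT f -> measurable_fun setT g ->
  measurable_fun [set: T] (fun w => dotp (f w) (g w)).
Proof.
move=> mf mg; rewrite /dotp; elim: (index_enum _) => [|a l IHl].
  by under eq_fun do rewrite big_nil; exact: measurable_cst.
under eq_fun do rewrite big_cons.
apply: measurable_funD => //; apply: measurable_funM.
  exact: (measurableT_comp (@measurable_coor R N a) mf).
exact: (measurableT_comp (@measurable_coor R N a) mg).
Qed.

Lemma measurable_sqrtr : measurable_fun [set: R] (@Num.sqrt R).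
Proof. by apply: continuous_measurable_fun; exact: sqrt_continuous. Qed.

Lemma measurable_fun_enorm d (T : measurableType d) (f : T -> 'rV[R]_N) :
  measurable_fun setT f -> measurable_fun [set: T] (fun w => enorm (f w)).
Proof.
move=> mf; apply: (measurableT_comp measurable_sqrtr).
exact: measurable_fun_dotp.
Qed.

Lemma measurable_eball x (r : R) : measurable (eball x r).
Proof.
have mn : measurable_fun setT (fun y => enorm (y - x)).
  by apply: measurable_fun_enorm; exact: measurable_fun_rVB.
rewrite [X in measurable X](_ : _ = [set: 'rV[R]_N] `&`
    (fun y => enorm (y - x)) @^-1` `]-oo, r[%classic).
  exact: mn.
by rewrite setTI; apply/seteqP; split => y; rewrite /eball/= in_itv.
Qed.

Lemma leb_eball_scale x (r : R) : 0 < r ->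
  leb N (eball x r) = (((r : R) ^+ N)%:E * leb N (eball 0 1))%E.
Proof.
move=> r0; rewrite -(setIT (eball x r)) -(setIT (eball 0 1)).
rewrite -[leb N (_ `&` _)]integral_indic//; last exact: measurable_eball.
rewrite -[leb N (_ `&` _)]integral_indic//; last exact: measurable_eball.
have := @ge0_integral_affine R N (EFin \o \1_(eball x r)) r x.
rewrite gt_eqF// => /(_ isT); rewrite gtr0_norm// => E.
rewrite [X in (_ * X)%E](_ : _ =
   \int[leb N]_z (EFin \o \1_(eball x r)) (r *: z + x)%R)%E; last first.
  apply: eq_integral => z _ /=; congr EFin; rewrite !indicE; congr (nat_of_bool _)%:R.
  apply/idP/idP; rewrite !inE /eball/= ?subr0 addrK enormZ gtr0_norm//.
    by rewrite gtr_pMr.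
  by rewrite gtr_pMr.
rewrite E; first by rewrite muleA -EFinM mulfV ?mul1e// expf_neq0// gt_eqF.
  by apply/measurable_EFinP/measurable_indicP; exact: measurable_eball.
by move=> z; rewrite lee_fin.
Qed.

Lemma leb_eball_lty x r : (leb N (eball x r) < +oo)%E.
Proof.
pose A (i : 'I_N) : set (measurableTypeR R) :=
  `[(x ord0 i - r), (x ord0 i + r)]%classic.
have mA i : measurable (A i) by exact: measurable_itv.
have mB : measurable [set y : 'rV[R]_N | forall i, A i (y ord0 i)].
  rewrite (_ : [set y : 'rV[R]_N | _] =
    \big[setI/setT]_(i < N) [set y : 'rV[R]_N | A i (y ord0 i)]).
    apply: bigsetI_measurable => i _; rewrite -[X in measurable X]setTI.
    exact: measurable_coor.
  rewrite -bigcap_seq; apply/seteqP; split => [y /= Ay i _|y /= Ay i].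
    exact: Ay.
  by apply: Ay; rewrite /= mem_index_enum.
apply: (@le_lt_trans _ _ (leb N [set y : 'rV[R]_N | forall i, A i (y ord0 i)])).
  apply: le_measure; rewrite ?inE//; first exact: measurable_eball.
  move=> y yx i; rewrite /A/= in_itv/=.
  have := le_trans (le_coor_enorm (y - x) i) (ltW yx); rewrite !mxE.
  by rewrite ler_norml => /andP[h1 h2]; apply/andP; split; lra.
rewrite leb_box// ltey_eq; apply/orP; left; elim/big_ind : _ => [//|a b|i _].
  exact: fin_numM.
by rewrite /A lebesgue_measure_itv/=; case: ifP.
Qed.

Lemma leb_eball_gt0 x (r : R) : 0 < r -> (0 < leb N (eball x r))%E.
Proof.
(* With half-side r / (N + 1) the N coordinates of a point of the cube add up to less than r, so
   that the cube lies in the ball. *)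
move=> r0; pose e := r / N.+1%:R; have e0 : 0 < e by rewrite divr_gt0.
pose A (i : 'I_N) : set (measurableTypeR R) :=
  `](x ord0 i - e), (x ord0 i + e)[%classic.
have mA i : measurable (A i) by exact: measurable_itv.
have mB : measurable [set y : 'rV[R]_N | forall i, A i (y ord0 i)].
  rewrite (_ : [set y : 'rV[R]_N | _] =
    \big[setI/setT]_(i < N) [set y : 'rV[R]_N | A i (y ord0 i)]).
    apply: bigsetI_measurable => i _; rewrite -[X in measurable X]setTI.
    exact: measurable_coor.
  rewrite -bigcap_seq; apply/seteqP; split => [y /= Ay i _|y /= Ay i].
    exact: Ay.
  by apply: Ay; rewrite /= mem_index_enum.
apply: (@lt_le_trans _ _ (leb N [set y : 'rV[R]_N | forall i, A i (y ord0 i)])).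
  rewrite leb_box//; elim/big_ind : _ => [|a b|i _].
  - by rewrite lte01.
  - exact: mule_gt0.
  - rewrite /A lebesgue_measure_itv/= lte_fin ltrBlDr -addrA ltrDl addr_gt0//.
    by rewrite -EFinD lte_fin; lra.
apply: le_measure; rewrite ?inE//; first exact: measurable_eball.
move=> y yx; rewrite /eball/=; apply: (le_lt_trans (enorm_le_sum _)).
apply: (@le_lt_trans _ _ (\sum_(i < N) e)).
  apply: ler_sum => i _; rewrite !mxE; apply/ltW.
  have := yx i; rewrite /A/= in_itv/= => /andP[h1 h2].
  by rewrite ltr_norml; apply/andP; split; lra.
rewrite sumr_const card_ord -mulr_natr /e mulrAC -mulrA gtr_pMr//.
by rewrite ltr_pdivrMr// mul1r ltr_nat.
Qed.

Lemma leb_eball : exists2 vol : R, 0 < vol &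
  forall x r, 0 < r -> leb N (eball x r) = (r ^+ N * vol)%:E.
Proof.
exists (fine (leb N (eball 0 1))) => [|x r r0].
  by rewrite fine_gt0// leb_eball_lty andbT; exact: leb_eball_gt0.
rewrite leb_eball_scale// EFinM fineK// ge0_fin_numE//.
exact: leb_eball_lty.
Qed.

End euclid.

(** * Fourier transforms of Gaussians *)

Lemma dominated_cvg_real d (T : measurableType d) (R : realType)
    (m : {measure set T -> \bar R}) (f_ : nat -> T -> R) (f g : T -> R) :
  (forall n, measurable_fun setT (f_ n)) ->
  (forall x, f_ n x @[n --> \oo] --> f x) ->
  m.-integrable setT (EFin \o g) ->
  (forall n x, `|f_ n x| <= g x) ->
  [/\ measurable_fun setT f, m.-integrable setT (EFin \o f) &
    (\int[m]_x (f_ n x)%:E @[n --> \oo] --> \int[m]_x (f x)%:E)%E].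
Proof.
move=> mf_ cf ig fg.
have mf : measurable_fun setT f.
  by apply: (@measurable_fun_cvg _ _ _ _ f_) => // x _; exact: cf.
have [] := @dominated_convergence _ T R m setT measurableT
  (fun n => EFin \o f_ n) (EFin \o f) (EFin \o g).
- by move=> n; exact/measurable_EFinP.
- exact/measurable_EFinP.
- by apply: aeW => x _ /=; apply: cvg_EFin; [exact: nearW|exact: cf].
- exact: ig.
- by apply: aeW => x n _ /=; rewrite lee_fin.
by move=> h1 _ h3; split.
Qed.

Section gauss1.
Context {R : realType}.
Notation lam := (@lebesgue_measure R).
Implicit Types (b c x : R).

Lemma measurable_cos : measurable_fun [set: R] (@cos R).
Proof. by apply: continuous_measurable_fun; exact: continuous_cos. Qed.

Lemma measurable_sin : measurable_fun [set: R] (@sin R).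
Proof. by apply: continuous_measurable_fun; exact: continuous_sin. Qed.

Lemma measurable_gauss c : measurable_fun [set: R] (fun x => expR (- (c * x ^+ 2))).
Proof.
apply: (measurableT_comp (@measurable_expR R)).
by apply: measurable_funN; apply: measurable_funM => //.
Qed.

Lemma integral_gauss c : 0 < c ->
  (\int[lam]_x (expR (- (c * x ^+ 2)))%:E = (Num.sqrt (pi / c))%:E)%E.
Proof.
move=> c0; have sc0 : 0 < Num.sqrt c by rewrite sqrtr_gt0.
have := @ge0_integral_affine1 R (EFin \o gauss_fun) (Num.sqrt c) 0.
rewrite gt_eqF// => /(_ isT) E.
transitivity (\int[lam]_x (EFin \o gauss_fun) (Num.sqrt c * x + 0)%R)%E.
  by apply: eq_integral => x _; rewrite /= /gauss_fun addr0 exprMn sqr_sqrtr ?ltW.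
rewrite E; last 2 first.
- by apply/measurable_EFinP; exact: measurable_gauss_fun.
- by move=> x; rewrite lee_fin gauss_fun_ge0.
rewrite [X in (_ * X)%E]integralT_gauss -EFinM gtr0_norm//.
by rewrite sqrtrM ?pi_ge0// sqrtrV ?ltW// mulrC.
Qed.

Lemma integrable_gauss c : 0 < c ->
  lam.-integrable setT (EFin \o (fun x => expR (- (c * x ^+ 2)))).
Proof.
move=> c0; apply/integrableP; split.
  by apply/measurable_EFinP; exact: measurable_gauss.
rewrite [X in (X < _)%E](_ : _ = \int[lam]_x (expR (- (c * x ^+ 2)))%:E)%E.
  by rewrite integral_gauss// ltry.
by apply: eq_integral => x _ /=; rewrite ger0_norm ?expR_ge0.
Qed.

Lemma norm_cos_le1 x : `|cos x| <= 1.
Proof. by rewrite ler_norml cos_geN1 cos_le1. Qed.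

Lemma norm_sin_le1 x : `|sin x| <= 1.
Proof. by rewrite ler_norml sin_geN1 sin_le1. Qed.

(** Integration by parts on the line without boundary terms: the fundamental theorem of calculus on
    [-n, n], then dominated convergence. *)
Lemma integral_is_derive_eq0 (F f : R -> R) :
  (forall x, is_derive x 1 F (f x)) -> continuous f ->
  lam.-integrable setT (EFin \o f) ->
  F n%:R @[n --> \oo] --> 0 -> F (- n%:R) @[n --> \oo] --> 0 ->
  (\int[lam]_x (f x)%:E = 0)%E.
Proof.
move=> dF cf intf F1 F2.
have mf := measurable_int _ intf.
have H1 : (\int[lam]_x ((f \_ `[(- n.+1%:R), n.+1%:R]) x)%:E @[n --> \oo]
    --> \int[lam]_x (f x)%:E)%E.
  have [] := @dominated_cvg_real _ _ R lam
    (fun n => f \_ `[(- n.+1%:R), n.+1%:R]) f (fun x => `|f x|) => //.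
  - move=> n; apply/(measurable_restrictT f) => //.
    by apply: measurable_funTS; exact/measurable_EFinP.
  - move=> x; apply: cvg_near_cst; exists (Num.truncn `|x|) => // n /= xn.
    rewrite patchE mem_set//= in_itv/= -ler_norml.
    apply: (le_trans (ltW (truncnS_gt _))); rewrite ler_nat ltnS.
    exact: xn.
  - exact: integrable_norm.
  - by move=> n x; rewrite patchE; case: ifP; rewrite ?normr0.
have H2 : (\int[lam]_x ((f \_ `[(- n.+1%:R), n.+1%:R]) x)%:E @[n --> \oo] --> 0%:E)%E.
  rewrite (_ : (fun n => _) = (fun n => (F n.+1%:R - F (- n.+1%:R))%:E)); last first.
    apply/funext => n.
    rewrite (_ : (fun x => _) = (EFin \o f) \_ `[(- n.+1%:R), n.+1%:R]); last first.
      by apply/funext => x; rewrite !patchE; case: ifP.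
    rewrite -integral_mkcond; rewrite (@continuous_FTC2 _ f F)//.
    + by rewrite -subr_gt0 opprK addr_gt0.
    + by apply: continuous_subspaceT => x; exact: cf.
    + split => [x _||]; first by have [] := dF x.
        apply: cvg_at_right_filter; apply: differentiable_continuous.
        by apply/derivable1_diffP; have [] := dF (- n.+1%:R).
      apply: cvg_at_left_filter; apply: differentiable_continuous.
      by apply/derivable1_diffP; have [] := dF (n.+1%:R).
    + by move=> x _; rewrite derive1E; have [] := dF x.
  apply: cvg_EFin; first exact: nearW.
  rewrite -(subr0 0); apply: cvgB.
    by move: F1; rewrite -(cvg_shiftS (fun n => F n%:R)).
  by move: F2; rewrite -(cvg_shiftS (fun n => F (- n%:R))).
exact: (cvg_unique _ H1 H2).
Qed.

Lemma is_derive_mulf (f g : R -> R) x df dg : is_derive x 1 f df ->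
  is_derive x 1 g dg -> is_derive x 1 (fun y => f y * g y) (df * g x + f x * dg).
Proof.
move=> h1 h2; have := is_deriveM h1 h2; rewrite addrC => h.
by apply: (is_derive_eq h); rewrite /GRing.scale /= (mulrC df).
Qed.

Lemma is_derive_compf (f g : R -> R) x df dg : is_derive (g x) 1 f df ->
  is_derive x 1 g dg -> is_derive x 1 (fun y => f (g y)) (df * dg).
Proof. by move=> h1 h2; exact: (is_derive1_comp h1 h2). Qed.

Lemma is_derive_linf k x : is_derive x 1 (fun y : R => k * y) k.
Proof.
have h := is_derive_mulf (is_derive_cst k x 1) (is_derive_id x 1).
by apply: (is_derive_eq h); rewrite mul0r add0r mulr1.
Qed.

Lemma is_derive_sqrf k x : is_derive x 1 (fun y : R => k * y ^+ 2) (k * (2 * x)).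
Proof.
have h := is_derive_mulf (is_derive_linf k x) (is_derive_id x 1).
rewrite (_ : (fun y => _) = (fun y => k * y * y)); last first.
  by apply/funext => y; rewrite expr2 mulrA.
by apply: (is_derive_eq h); rewrite mulr1; ring.
Qed.

Lemma is_derive_oppf (f : R -> R) x df : is_derive x 1 f df ->
  is_derive x 1 (fun y => - f y) (- df).
Proof. exact: is_deriveN. Qed.

Lemma is_derive_gauss c x :
  is_derive x 1 (fun y : R => expR (- (c * y ^+ 2)))
    (- (2 * c * x) * expR (- (c * x ^+ 2))).
Proof.
have h := is_derive_compf (is_derive_expR _) (is_derive_oppf (is_derive_sqrf c x)).
by apply: (is_derive_eq h); ring.
Qed.

Lemma is_derive_continuous (f df : R -> R) :
  (forall x, is_derive x 1 f (df x)) -> continuous f.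
Proof.
move=> h x; apply: differentiable_continuous; apply/derivable1_diffP.
by have [] := h x.
Qed.

Lemma cvg_gauss c (u : nat -> R) : 0 < c -> (forall n, n%:R <= `|u n|) ->
  expR (- (c * u n ^+ 2)) @[n --> \oo] --> 0.
Proof.
move=> c0 un; have c1 : (c^-1 / n%:R @[n --> \oo] --> (0 : R)).
  rewrite -(mulr0 c^-1); apply: cvgM; first exact: cvg_cst.
  apply/gtr0_cvgV0; first by exists 1%N => // n /= n0; rewrite ltr0n.
  exact: cvgr_idn.
apply: (squeeze_cvgr _ (cvg_cst 0) c1).
exists 1%N => // n /= n0; rewrite expR_ge0/= expRN.
have n0' : (0 : R) < n%:R by rewrite ltr0n.
rewrite -invfM lef_pV2 ?posrE ?mulr_gt0 ?expR_gt0//.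
apply: (le_trans _ (expR_ge1Dx _)).
apply: (@le_trans _ _ (c * u n ^+ 2)); last lra.
rewrite ler_pM2l// -[u n ^+ 2]ger0_norm ?sqr_ge0// normrX.
apply: (le_trans (un n)); rewrite expr2 ler_peMr//.
by apply: (le_trans _ (un n)); rewrite ler1n.
Qed.

Lemma cvg_bounded_gauss c (u h : nat -> R) : 0 < c ->
  (forall n, n%:R <= `|u n|) -> (forall n, `|h n| <= 1) ->
  h n * expR (- (c * u n ^+ 2)) @[n --> \oo] --> 0.
Proof.
move=> c0 un h1; apply: norm_cvg0.
apply: (squeeze_cvgr _ (cvg_cst 0) (cvg_gauss c0 un)).
apply: nearW => n; rewrite normr_ge0/= normrM (ger0_norm (expR_ge0 _)).
by rewrite ler_piMl// expR_ge0.
Qed.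

(** Half of the exponent absorbs the factor |x|, since |x| <= (1 + 2/c)(1 + c x^2/2) and 1 + y <=
    exp(y). The right-hand side is the dominating function for differentiating [gauss_ft] under the
    integral. *)
Lemma norm_mul_gauss_le c x : 0 < c ->
  `|x| * expR (- (c * x ^+ 2)) <= (1 + 2 / c) * expR (- (c / 2 * x ^+ 2)).
Proof.
move=> c0; rewrite [X in expR (- X)](_ : _ = c / 2 * x ^+ 2 + c / 2 * x ^+ 2); last by field.
rewrite opprD expRD mulrA ler_wpM2r ?expR_ge0// expRN ler_pdivrMr ?expR_gt0//.
have h := expR_ge1Dx (c / 2 * x ^+ 2).
have x2 : x ^+ 2 = `|x| ^+ 2 by rewrite real_normK// num_real.
apply: (@le_trans _ _ ((1 + 2 / c) * (1 + c / 2 * x ^+ 2))); last first.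
  by rewrite ler_wpM2l// addr_ge0// divr_ge0// ltW.
rewrite (_ : _ * _ = 1 + 2 / c + c / 2 * x ^+ 2 + x ^+ 2); last first.
  by field; rewrite gt_eqF.
rewrite x2; have : 0 <= c / 2 * `|x| ^+ 2 by rewrite mulr_ge0 ?sqr_ge0// divr_ge0// ltW.
have : 0 <= 2 / c by rewrite divr_ge0// ltW.
nra.
Qed.

Definition gauss_ft c b : R := \int[lam]_x (cos (b * x) * expR (- (c * x ^+ 2))).

Lemma integrable_bounded_gauss c (h : R -> R) : 0 < c ->
  measurable_fun setT h -> (forall x, `|h x| <= 1) ->
  lam.-integrable setT (EFin \o (fun x => h x * expR (- (c * x ^+ 2)))).
Proof.
move=> c0 mh h1; apply: (le_integrable _ _ _ (integrable_gauss c0)) => //.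
  by apply/measurable_EFinP; apply: measurable_funM => //; exact: measurable_gauss.
move=> x _ /=; rewrite lee_fin normrM ler_piMl//.
Qed.

Lemma measurable_cosM b : measurable_fun [set: R] (fun x => cos (b * x)).
Proof. by apply: (measurableT_comp measurable_cos); exact: mulrl_measurable. Qed.

Lemma measurable_sinM b : measurable_fun [set: R] (fun x => sin (b * x)).
Proof. by apply: (measurableT_comp measurable_sin); exact: mulrl_measurable. Qed.

Lemma integrable_mul_gauss c (h : R -> R) : 0 < c ->
  measurable_fun setT h -> (forall x, `|h x| <= 1) ->
  lam.-integrable setT (EFin \o (fun x => x * h x * expR (- (c * x ^+ 2)))).
Proof.
move=> c0 mh h1; have c20 : 0 < c / 2 by rewrite divr_gt0.
apply: (le_integrable _ _ _ (integrableZl measurableT (1 + 2 / c) (integrable_gauss c20))) => //.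
  apply/measurable_EFinP; apply: measurable_funM; last exact: measurable_gauss.
  exact: measurable_funM.
move=> x _ /=; rewrite lee_fin.
have c1 : 0 <= 1 + 2 / c by rewrite addr_ge0// divr_ge0// ltW.
rewrite !normrM !(ger0_norm (expR_ge0 _)) (ger0_norm c1).
apply: le_trans (norm_mul_gauss_le x c0); rewrite ler_wpM2r ?expR_ge0//.
by rewrite ler_piMr.
Qed.

(** The classical differential equation satisfied by the transform of a Gaussian: differentiation
    under the integral brings down a factor x, and x exp(-c x^2) is a multiple of the derivative of
    the Gaussian. *)
Lemma is_derive_gauss_ft c b : 0 < c ->
  is_derive b 1 (gauss_ft c) (- (b / (2 * c)) * gauss_ft c b).
Proof.
move=> c0; pose f := fun b x => cos (b * x) * expR (- (c * x ^+ 2)).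
have df b' x : is_derive b' 1 (f ^~ x) (- (x * sin (b' * x) * expR (- (c * x ^+ 2)))).
  have h := is_derive_mulf (is_derive_compf (is_derive_cos _) (is_derive_linf x b'))
    (is_derive_cst (expR (- (c * x ^+ 2))) b' 1).
  rewrite (_ : f ^~ x = (fun y => cos (x * y) * expR (- (c * x ^+ 2)))); last first.
    by apply/funext => y; rewrite /f (mulrC x).
  by apply: (is_derive_eq h); rewrite /= mulr0 addr0 (mulrC b'); ring.
have d1f : partial1of2 f = fun b' x => - (x * sin (b' * x) * expR (- (c * x ^+ 2))).
  by apply/funext => b'; apply/funext => x; rewrite partial1of2E; have [] := df b' x.
have intf b' : lam.-integrable setT (EFin \o f b').
  apply: (integrable_bounded_gauss c0) => [|x]; first exact: measurable_cosM.
  exact: norm_cos_le1.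
have intd b' : lam.-integrable setT
    (EFin \o (fun x => x * sin (b' * x) * expR (- (c * x ^+ 2)))).
  apply: (integrable_mul_gauss c0) => [|x]; first exact: measurable_sinM.
  exact: norm_sin_le1.
have c20 : 0 < c / 2 by rewrite divr_gt0.
pose g := fun x => (1 + 2 / c) * expR (- (c / 2 * x ^+ 2)).
have g0 x : 0 <= g x.
  by rewrite mulr_ge0 ?expR_ge0 ?addr_ge0 ?divr_ge0 ?ltW.
have intg : lam.-integrable setT (EFin \o g).
  exact: (integrableZl measurableT (1 + 2 / c) (integrable_gauss c20)).
have Ib : `](b - 1), (b + 1)[%classic b by rewrite /= in_itv/=; apply/andP; split; lra.
have fg x y : `](b - 1), (b + 1)[%classic x -> setT y -> `|partial1of2 f x y| <= g y.
  move=> _ _; rewrite d1f normrN !normrM (ger0_norm (expR_ge0 _)).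
  apply: le_trans (norm_mul_gauss_le y c0); rewrite ler_wpM2r ?expR_ge0//.
  by rewrite ler_piMr// norm_sin_le1.
have dff x y : `](b - 1), (b + 1)[%classic x -> setT y -> derivable (f^~ y) x 1.
  by move=> _ _; have [] := df x y.
have D1 := derivable_under_integral measurableT Ib (fun x _ => intf x) dff g0 intg fg.
have D2 := differentiation_under_integral measurableT Ib (fun x _ => intf x) dff g0 intg fg.
apply: DeriveDef; first exact: D1.
rewrite -derive1E [LHS]D2 d1f.
(* The derivative of sin(b x) exp(-c x^2) has integral 0, which expresses the integral of x sin(b x)
   exp(-c x^2) through the transform itself. *)
have dF x : is_derive x 1 (fun y => sin (b * y) * expR (- (c * y ^+ 2)))
    (b * (cos (b * x) * expR (- (c * x ^+ 2))) -
     2 * c * (x * sin (b * x) * expR (- (c * x ^+ 2)))).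
  have h := is_derive_mulf (is_derive_compf (is_derive_sin _) (is_derive_linf b x))
    (is_derive_gauss c x).
  by apply: (is_derive_eq h); ring.
have E0 : (\int[lam]_x (b * (cos (b * x) * expR (- (c * x ^+ 2))) -
     2 * c * (x * sin (b * x) * expR (- (c * x ^+ 2))))%:E = 0)%E.
  apply: (integral_is_derive_eq0 dF).
  - have cs : continuous (fun x : R => sin (b * x)).
      apply: (is_derive_continuous (df := fun x => cos (b * x) * b)) => x.
      exact: is_derive_compf (is_derive_sin _) (is_derive_linf b x).
    have cc : continuous (fun x : R => cos (b * x)).
      apply: (is_derive_continuous (df := fun x => - sin (b * x) * b)) => x.
      exact: is_derive_compf (is_derive_cos _) (is_derive_linf b x).
    have cg := is_derive_continuous (is_derive_gauss c).
    move=> x; apply: cvgB.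
      by apply: cvgM; [exact: cvg_cst|apply: cvgM; [exact: cc|exact: cg]].
    apply: cvgM; first exact: cvg_cst.
    by apply: cvgM; [apply: cvgM; [exact: cvg_id|exact: cs]|exact: cg].
  - exact: (integrableB measurableT (integrableZl measurableT b (intf b))
      (integrableZl measurableT (2 * c) (intd b))).
  - apply: (@cvg_bounded_gauss c (fun n => n%:R) (fun n => sin (b * n%:R))) => //.
      by move=> n; rewrite ger0_norm.
    by move=> n; exact: norm_sin_le1.
  - apply: (@cvg_bounded_gauss c (fun n => - n%:R) (fun n => sin (b * - n%:R))) => //.
      by move=> n; rewrite normrN ger0_norm.
    by move=> n; exact: norm_sin_le1.
have {}E0 : b * gauss_ft c b - 2 * c *
    \int[lam]_x (x * sin (b * x) * expR (- (c * x ^+ 2))) = 0.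
  have H1 := RintegralZl b measurableT (intf b).
  have H2 := RintegralZl (2 * c) measurableT (intd b).
  have H3 := RintegralB measurableT (integrableZl measurableT b (intf b))
    (integrableZl measurableT (2 * c) (intd b)).
  rewrite /gauss_ft -H2 -H1 -H3.
  by rewrite /Rintegral E0.
rewrite (_ : (fun y => _) = (fun x => (-1) * (x * sin (b * x) * expR (- (c * x ^+ 2))))); last first.
  by apply/funext => x; rewrite mulN1r.
rewrite RintegralZl//.
set I := Rintegral _ _ _ in E0 *; move: E0 => /eqP; rewrite subr_eq0 => /eqP E0.
rewrite mulN1r mulNr; congr (- _).
rewrite -[LHS](mulKf (x := 2 * c)) ?mulf_neq0 ?gt_eqF// -E0.
by rewrite mulrA [_^-1 * b]mulrC.
Qed.

(** The transform times exp(b^2 / (4 c)) has derivative 0 in b; at b = 0 it is the Gaussian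
    integral. *)
Lemma gauss_ftE c b : 0 < c ->
  gauss_ft c b = Num.sqrt (pi / c) * expR (- (b ^+ 2 / (4 * c))).
Proof.
move=> c0; pose h b := gauss_ft c b * expR (- ((- (4 * c)^-1) * b ^+ 2)).
have dh x : is_derive x 1 h 0.
  have h1 := is_derive_mulf (is_derive_gauss_ft x c0) (is_derive_gauss (- (4 * c)^-1) x).
  by apply: (is_derive_eq h1); field; rewrite gt_eqF.
have E := is_derive_0_is_cst b 0 dh.
have h0 : h 0 = Num.sqrt (pi / c).
  rewrite /h expr0n/= mulr0 oppr0 expR0 mulr1 /gauss_ft.
  rewrite (_ : (fun x => _) = (fun x => expR (- (c * x ^+ 2)))); last first.
    by apply/funext => x; rewrite mul0r cos0 mul1r.
  by rewrite /Rintegral integral_gauss.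
rewrite -h0 -E /h mulNr opprK -mulrA -expRD (_ : _ + _ = 0) ?expR0 ?mulr1//.
by field; rewrite gt_eqF.
Qed.

End gauss1.

Section gaussN.
Context {R : realType}.
Notation lam := (@lebesgue_measure R).

Lemma integral_reflect n (f : 'rV[R]_n -> \bar R) : measurable_fun setT f ->
  (\int[leb n]_x f (- x)%R = \int[leb n]_x f x)%E.
Proof.
move=> mf; rewrite integralE [RHS]integralE.
have E (g : 'rV[R]_n -> \bar R) : measurable_fun setT g -> (forall x, (0 <= g x)%E) ->
    (\int[leb n]_x g (- x)%R = \int[leb n]_x g x)%E.
  move=> mg g0; have := @ge0_integral_affine R n g (-1) 0.
  rewrite oppr_eq0 oner_eq0 => /(_ isT mg g0).
  rewrite normrN1 expr1n invr1 mul1e => <-.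
  by apply: eq_integral => x _; rewrite scaleN1r addr0.
congr (_ - _)%E.
  rewrite -[RHS]E//; last exact: measurable_funepos.
  by apply: eq_integral => x _; rewrite !funeposE.
rewrite -[RHS]E//; last exact: measurable_funeneg.
by apply: eq_integral => x _; rewrite !funenegE.
Qed.

Definition gaussN n (c : R) (z : 'rV[R]_n) := expR (- (c * dotp z z)).

Lemma gaussN_ge0 n c (z : 'rV[R]_n) : 0 <= gaussN c z.
Proof. exact: expR_ge0. Qed.

Lemma measurable_dotpr n (xi : 'rV[R]_n) : measurable_fun setT (fun z => dotp z xi).
Proof. by apply: measurable_fun_dotp => //; exact: measurable_cst. Qed.

Lemma measurable_gaussN n c : measurable_fun [set: 'rV[R]_n] (gaussN c).
Proof.
apply: (measurableT_comp (@measurable_expR R)).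
apply: measurable_funN; apply: measurable_funM => //.
exact: measurable_fun_dotp.
Qed.

Lemma integral_gaussN n c : 0 < c ->
  (\int[leb n]_z (gaussN c z)%:E = (Num.sqrt (pi / c) ^+ n)%:E)%E.
Proof.
move=> c0; transitivity (\int[leb n]_z \prod_(i < n) (expR (- (c * z ord0 i ^+ 2)))%:E)%E.
  apply: eq_integral => z _; rewrite prodEFin; congr EFin.
  rewrite -expR_sum /gaussN; congr expR.
  by rewrite sumrN /dotp mulr_sumr; congr (- _); apply: eq_bigr => i _; rewrite expr2.
rewrite (@ge0_integral_prod R n (fun _ x => (expR (- (c * x ^+ 2)))%:E)).
- under eq_bigr do rewrite integral_gauss//.
  by rewrite prodEFin prodr_const card_ord.
- by move=> i; apply/measurable_EFinP; exact: measurable_gauss.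
- by move=> i x; rewrite lee_fin expR_ge0.
Qed.

Lemma integrable_gaussN n c : 0 < c ->
  (leb n).-integrable setT (EFin \o (@gaussN n c)).
Proof.
move=> c0; apply/integrableP; split.
  by apply/measurable_EFinP; exact: measurable_gaussN.
rewrite [X in (X < _)%E](_ : _ = \int[leb n]_x (gaussN c x)%:E)%E.
  by rewrite integral_gaussN// ltry.
by apply: eq_integral => x _ /=; rewrite ger0_norm ?expR_ge0.
Qed.

Lemma integrable_bounded d (T : measurableType d) (m : {measure set T -> \bar R})
    (h g : T -> R) :
  m.-integrable setT (EFin \o g) -> (forall x, 0 <= g x) ->
  measurable_fun setT h -> (forall x, `|h x| <= 1) ->
  m.-integrable setT (EFin \o (fun x => h x * g x)).
Proof.
move=> ig g0 mh h1; apply: (le_integrable _ _ _ ig) => //.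
  apply/measurable_EFinP; apply: measurable_funM => //.
  by apply/measurable_EFinP; exact: (measurable_int _ ig).
by move=> x _ /=; rewrite lee_fin normrM ler_piMl.
Qed.

Lemma measurable_cos_dotp n (xi : 'rV[R]_n) :
  measurable_fun setT (fun z => cos (dotp z xi)).
Proof. by apply: (measurableT_comp measurable_cos); exact: measurable_dotpr. Qed.

Lemma measurable_sin_dotp n (xi : 'rV[R]_n) :
  measurable_fun setT (fun z => sin (dotp z xi)).
Proof. by apply: (measurableT_comp measurable_sin); exact: measurable_dotpr. Qed.

Lemma integral_odd n (f : 'rV[R]_n -> R) :
  (leb n).-integrable setT (EFin \o f) -> (forall x, f (- x) = - f x) ->
  (\int[leb n]_x (f x)%:E = 0)%E.
Proof.
move=> intf fN; have mf := measurable_int _ intf.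
have := integral_reflect mf; rewrite (eq_integral (fun x => - (f x)%:E)%E); last first.
  by move=> x _ /=; rewrite fN.
rewrite integralN/=; last first.
  by apply: integrable_add_def.
have : (\int[leb n]_x (f x)%:E)%E \is a fin_num by exact: integrable_fin_num.
case: (\int[leb n]_x (f x)%:E)%E => // r _ /= [] /eqP.
by rewrite eqNr => /eqP ->.
Qed.

Lemma integral_sin_gaussN n c (xi : 'rV[R]_n) : 0 < c ->
  (\int[leb n]_z (sin (dotp z xi) * gaussN c z)%:E = 0)%E.
Proof.
move=> c0; apply: (@integral_odd n (fun z => sin (dotp z xi) * gaussN c z)).
  apply: integrable_bounded (integrable_gaussN n c0) _ (measurable_sin_dotp xi) _ => z.
    exact: gaussN_ge0.
  exact: norm_sin_le1.
by move=> x; rewrite /gaussN dotpNl sinN dotpNl dotpNr opprK mulNr.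
Qed.

Lemma dotp_row_cons n (x : R) (v : 'rV[R]_n) (w : 'rV[R]_n.+1) :
  dotp (row_cons (x, v)) w =
  x * w ord0 ord0 + dotp v (\row_i w ord0 (lift ord0 i)).
Proof.
rewrite /dotp big_ord_recl row_cons0; congr (_ + _).
by apply: eq_bigr => i _; rewrite row_consS mxE.
Qed.

(** Induction on the dimension. The cosine of a sum splits into two products; the one with sines
    contributes nothing, because its factor in the last n variables is odd. *)
Lemma integral_cos_gaussN n (c : R) (xi : 'rV[R]_n) : 0 < c ->
  (\int[leb n]_z (cos (dotp z xi) * gaussN c z)%:E =
   (Num.sqrt (pi / c) ^+ n * expR (- (dotp xi xi / (4 * c))))%:E)%E.
Proof.
move=> c0; elim: n xi => [|n IH] xi.
  rewrite (eq_integral (cst 1%E)).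
    by rewrite integral_cst//= mul1e diracT /dotp big_ord0 mul0r oppr0 expR0 expr0 mulr1.
  by move=> z _; rewrite /gaussN /dotp !big_ord0 mulr0 oppr0 cos0 expR0 mulr1.
pose xi' : 'rV[R]_n := \row_i xi ord0 (lift ord0 i).
have icN k (w : 'rV[R]_k) : (leb k).-integrable setT
    (EFin \o (fun z => cos (dotp z w) * gaussN c z)).
  apply: integrable_bounded (integrable_gaussN k c0) _ (measurable_cos_dotp w) _ => z.
    exact: gaussN_ge0.
  exact: norm_cos_le1.
have isN k (w : 'rV[R]_k) : (leb k).-integrable setT
    (EFin \o (fun z => sin (dotp z w) * gaussN c z)).
  apply: integrable_bounded (integrable_gaussN k c0) _ (measurable_sin_dotp w) _ => z.
    exact: gaussN_ge0.
  exact: norm_sin_le1.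
rewrite integral_leb_succ//.
pose C := Num.sqrt (pi / c) ^+ n * expR (- (dotp xi' xi' / (4 * c))).
transitivity (\int[lam]_x
    (C%:E * (cos (xi ord0 ord0 * x) * expR (- (c * x ^+ 2)))%:E))%E.
  apply: eq_integral => x _.
  pose e := expR (- (c * x ^+ 2)).
  transitivity (\int[leb n]_v
      (((e * cos (xi ord0 ord0 * x))%:E * (cos (dotp v xi') * gaussN c v)%:E) -
      ((e * sin (xi ord0 ord0 * x))%:E * (sin (dotp v xi') * gaussN c v)%:E)))%E.
    apply: eq_integral => v _; rewrite -!EFinM -EFinD; congr EFin.
    rewrite dotp_row_cons cosD /gaussN dotp_row_cons row_cons0.
    rewrite (_ : (\row_i row_cons (x, v) ord0 (lift ord0 i)) = v); last by apply/rowP => i; rewrite mxE row_consS.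
    rewrite -[(x, v).1]/x mulrDr opprD expRD -expr2 -/e (mulrC x) -/xi'.
    by ring.
  rewrite integralB//; [|exact: (integrableZl measurableT _ (icN n xi'))|
                         exact: (integrableZl measurableT _ (isN n xi'))].
  rewrite (integralZl measurableT (icN n xi')) (integralZl measurableT (isN n xi')).
  rewrite [X in (_ - _ * X)%E]integral_sin_gaussN// mule0 sube0.
  by rewrite [X in (_ * X)%E]IH -EFinM; congr EFin; rewrite -/C -/e; ring.
rewrite (integralZl measurableT (integrable_bounded_gauss c0 _ _)); last 2 first.
- exact: measurable_cosM.
- by move=> x; exact: norm_cos_le1.
have F := gauss_ftE (xi ord0 ord0) c0.
have fin : (\int[lam]_x (cos (xi ord0 ord0 * x) * expR (- (c * x ^+ 2)))%:E)%E \is a fin_num.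
  apply: integrable_fin_num => //; apply: (integrable_bounded_gauss c0).
    exact: measurable_cosM.
  by move=> x; exact: norm_cos_le1.
rewrite -[X in (_ * X)%E]fineK// -/(Rintegral _ _ _) -/(gauss_ft _ _) F -EFinM.
rewrite (_ : dotp xi xi = xi ord0 ord0 ^+ 2 + dotp xi' xi'); last first.
  rewrite /dotp big_ord_recl expr2; congr (_ + _).
  by apply: eq_bigr => i _; rewrite !mxE.
congr EFin; rewrite /C [_ ^+ n.+1]exprS (mulrDl (_ ^+ 2)) opprD expRD mulrCA -!mulrA.
by congr (_ * (_ * _)); rewrite mulrC.
Qed.

End gaussN.

(** * The binomial series of 1 - (1 - x)^mu *)

Section binomial_series.
Context {R : realType}.
Variable mu : R.
Hypotheses (mu0 : 0 < mu) (mu1 : mu <= 1).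

(** [bcoef k] is the coefficient of x^(k+1) in 1 - (1 - x)^mu. All of them are nonnegative because 0
    < mu <= 1, and this sign is the source of the positivity of the kernel. *)
Fixpoint bcoef (k : nat) : R :=
  if k is k'.+1 then bcoef k' * (k'.+1%:R - mu) / k'.+2%:R else mu.

Lemma bcoef_ge0 k : 0 <= bcoef k.
Proof.
elim: k => [|k IH] /=; first exact: ltW.
rewrite divr_ge0// mulr_ge0// subr_ge0 (le_trans mu1)//.
by rewrite ler1n.
Qed.

Lemma bcoef_rec k : k.+2%:R * bcoef k.+1 = (k.+1%:R - mu) * bcoef k.
Proof. by rewrite /= mulrC divfK// mulrC. Qed.

Lemma bcoef_le k : k.+1%:R * bcoef k <= 1.
Proof.
elim: k => [|k IH]; first by rewrite mul1r.
rewrite bcoef_rec; apply: le_trans IH; rewrite ler_wpM2r ?bcoef_ge0//.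
by rewrite lerBlDr lerDl ltW.
Qed.

Definition bser (K : nat) (x : R) := \sum_(i < K) bcoef i * x ^+ i.+1.
Definition dbser (K : nat) (x : R) := \sum_(i < K) bcoef i * (i.+1%:R * x ^+ i).

Lemma bser_ge0 K x : 0 <= x -> 0 <= bser K x.
Proof.
by move=> x0; apply: sumr_ge0 => i _; rewrite mulr_ge0 ?bcoef_ge0 ?exprn_ge0.
Qed.

Lemma is_derive_bser K (x : R) : is_derive x 1 (bser K) (dbser K x).
Proof.
rewrite (_ : bser K = \sum_(i < K) (fun x => bcoef i * x ^+ i.+1)); last first.
  by apply/funext => y; rewrite fct_sumE.
rewrite /dbser; apply: is_derive_sum => i.
have h := is_derive_mulf (is_derive_cst (bcoef i) x 1) (is_deriveX i.+1 (is_derive_id x 1)).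
rewrite (_ : (fun x0 => _) = (fun y => cst (bcoef i) y * (id ^+ i.+1) y)); last first.
  by apply/funext => y; rewrite exprfctE.
apply: (is_derive_eq h).
by rewrite mul0r add0r /GRing.scale /= mulr1 -mulr_natl.
Qed.

(** The function g = 1 - (1 - x)^mu satisfies mu (1 - g) = (1 - x) g'; the right-hand side below is
    the defect of its partial sum. *)
Lemma bser_identity K x :
  mu * (1 - bser K x) - (1 - x) * dbser K x = K.+1%:R * bcoef K * x ^+ K.
Proof.
elim: K => [|K IH]; first by rewrite /bser /dbser !big_ord0 /=; ring.
rewrite /bser /dbser !big_ord_recr /= -/(bser K x) -/(dbser K x).
rewrite -/(bcoef K.+1) bcoef_rec.
have -> : mu * (1 - (bser K x + bcoef K * x ^+ K.+1)) -
  (1 - x) * (dbser K x + bcoef K * (K.+1%:R * x ^+ K)) =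
  (mu * (1 - bser K x) - (1 - x) * dbser K x) - mu * (bcoef K * x ^+ K.+1)
  - (1 - x) * (bcoef K * (K.+1%:R * x ^+ K)) by ring.
by rewrite IH exprS; ring.
Qed.

(** Mean value theorem on [0, x] for [D], the quotient of 1 - [bser K] by (1 - y)^mu: it equals 1 at
    0, and by [bser_identity] its derivative is the nonnegative defect times (1 - y)^(-mu - 1). The
    bound (K + 1) [bcoef K] <= 1 leaves only x^K. *)
Lemma bser_bounds K (x : R) : 0 <= x < 1 ->
  0 <= 1 - bser K x - (1 - x) `^ mu <= x ^+ K / (1 - x) ^+ 2.
Proof.
move=> /andP[x0 x1].
have [->|xn0] := eqVneq x 0.
  rewrite /bser big1 => [|i _]; last by rewrite expr0n/= mulr0.
  by rewrite subr0 powR1 subrr lexx/= expr1n divr1 exprn_ge0.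
have xp : 0 < x by rewrite lt_def xn0.
pose D (y : R) : R := (1 - bser K y) * (1 - y) `^ (- mu).
pose dD (y : R) : R := K.+1%:R * bcoef K * y ^+ K * (1 - y) `^ (- mu - 1).
have dDP (y : R) : y < 1 -> is_derive y 1 D (dD y).
  move=> y1; have y1' : 0 < 1 - y by rewrite subr_gt0.
  have h1 := is_deriveB (is_derive_cst (1 : R) y 1) (is_derive_bser K y).
  have h2 := is_deriveB (is_derive_cst (1 : R) y 1) (is_derive_id y 1).
  have h := is_derive_mulf h1 
    (is_derive_compf (g := fun z : R => 1 - z) (is_derive1_powR (- mu) y1') h2).
  apply: (is_derive_eq h); rewrite /dD -bser_identity /=.
  have -> : (1 - y) `^ (- mu) = (1 - y) * (1 - y) `^ (- mu - 1).
    rewrite -[X in X * _](@powRr1 R) ?ltW// -powRD; last first.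
      by rewrite (gt_eqF y1') implybT.
    by congr powR; ring.
  rewrite -[(cst 1 - bser K) y]/(1 - bser K y).
  by ring.
have cD : {within `[0, x], continuous D}.
  apply: derivable_within_continuous => y; rewrite in_itv/= => /andP[_ yx].
  by have [] := dDP y (le_lt_trans yx x1).
have [c] : exists2 c, c \in `]0, x[ & D x - D 0 = dD c * (x - 0).
  apply: MVT => // y; rewrite in_itv/= => /andP[_ yx].
  exact: dDP (lt_trans yx x1).
rewrite in_itv/= => /andP[c0 cx].
have x1' : 0 < 1 - x by rewrite subr_gt0.
have c1' : 0 < 1 - c by rewrite subr_gt0 (lt_trans cx).
have -> : D 0 = 1.
  rewrite /D /bser big1 => [|i _]; last by rewrite expr0n/= mulr0.
  by rewrite subr0 powR1 mulr1.
rewrite subr0 => /eqP; rewrite subr_eq => /eqP Dx.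
have P1 : (1 - x) `^ (- mu) * (1 - x) `^ mu = 1.
  by rewrite powRN mulVf// gt_eqF// powR_gt0.
have -> : 1 - bser K x - (1 - x) `^ mu = (1 - x) `^ mu * (dD c * x).
  have -> : 1 - bser K x = D x * (1 - x) `^ mu by rewrite /D -mulrA P1 mulr1.
  by rewrite Dx; ring.
have dDc0 : 0 <= dD c.
  by rewrite !mulr_ge0 ?bcoef_ge0 ?exprn_ge0 ?powR_ge0// ltW.
have H0 : 0 <= dD c * x by rewrite mulr_ge0.
have H1 : (1 - x) `^ mu <= 1.
  rewrite -[leRHS](powRr0 (1 - x)); apply: ger_powR; last exact: ltW.
  by rewrite x1'/= lerBlDr lerDl.
rewrite mulr_ge0 ?powR_ge0//=.
apply: (@le_trans _ _ (dD c * x)); first by rewrite ler_piMl.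
apply: (@le_trans _ _ (dD c)); first by rewrite ler_piMr// ltW.
rewrite /dD; apply: ler_pM.
- by rewrite !mulr_ge0 ?bcoef_ge0 ?exprn_ge0// ltW.
- exact: powR_ge0.
- apply: (@le_trans _ _ (1 * c ^+ K)); last by rewrite mul1r lerXn2r ?nnegrE// ltW.
  by rewrite ler_wpM2r ?exprn_ge0 ?bcoef_le// ltW.
(* Since mu <= 1, the exponent -mu - 1 is at least -2, and the base is at most 1. *)
apply: (@le_trans _ _ ((1 - c) `^ (- 2%:R))).
  have m2 : - 2%:R <= - mu - 1 :> R by have := mu1; lra.
  by apply: ger_powR m2; rewrite c1'/= lerBlDr lerDl ltW.
rewrite (powR_invn _ (ltW c1')) lef_pV2 ?posrE ?exprn_gt0//.
by rewrite lerXn2r ?nnegrE ?(ltW x1') ?(ltW c1')// lerB// ltW.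
Qed.

Lemma bser_le1 K (x : R) : 0 <= x < 1 -> bser K x <= 1.
Proof.
move=> x01; have /andP[+ _] := bser_bounds K x01.
by have := powR_ge0 (1 - x) mu; lra.
Qed.

Lemma bser_cvg (x : R) : 0 <= x < 1 -> bser K x @[K --> \oo] --> 1 - (1 - x) `^ mu.
Proof.
move=> x01; have /andP[x0 x1] := x01.
have H : x ^+ K / (1 - x) ^+ 2 @[K --> \oo] --> (0 : R).
  rewrite -(mul0r ((1 - x) ^+ 2)^-1); apply: cvgM; last exact: cvg_cst.
  by apply: cvg_expr; rewrite ger0_norm.
have H1 : 1 - bser K x - (1 - x) `^ mu @[K --> \oo] --> (0 : R).
  by apply: (squeeze_cvgr _ (cvg_cst 0) H); apply: nearW => K; exact: bser_bounds.
rewrite -[X in _ --> X]subr0 (_ : (fun K => bser K x) =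
  (fun K => (1 - (1 - x) `^ mu) - (1 - bser K x - (1 - x) `^ mu))); last first.
  by apply/funext => K; ring.
by apply: cvgB => //; exact: cvg_cst.
Qed.

Lemma powR_cvg (u : nat -> R) (a : R) : 0 <= a -> (forall n, 0 <= u n) ->
  u n @[n --> \oo] --> a -> u n `^ mu @[n --> \oo] --> a `^ mu.
Proof.
rewrite le_eqVlt => /orP[/eqP <-|a0] un ua.
  rewrite powR0 ?gt_eqF//.
  (* The shift by 1/(n + 1) makes the sequence positive, so that it approaches 0 from the right. *)
  have ua' : u n + n.+1%:R^-1 @[n --> \oo] --> (0 : R).
    by rewrite -(addr0 0); apply: cvgD => //; exact: cvg_harmonic.
  have up : (u n + n.+1%:R^-1) `^ mu @[n --> \oo] --> (0 : R).
    apply: (@cvg_comp _ _ _ (fun n => u n + n.+1%:R^-1) (fun b => b `^ mu) _ (0^'+));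
      last exact: powR_cvg0.
    move=> P [e e0 eP]; move/cvgrPdist_lt : ua' => /(_ e e0) [k _ kP].
    by exists k => // n /kP/= h; apply: eP => //=; rewrite ltr_wpDl// invr_gt0.
  apply: (squeeze_cvgr _ (cvg_cst 0) up); apply: nearW => n; rewrite powR_ge0/=.
  by rewrite ge0_ler_powR ?nnegrE ?addr_ge0 ?invr_ge0 ?lerDl ?invr_ge0// ltW.
have c : {for a, continuous (fun b => b `^ mu)}.
  apply: differentiable_continuous; apply/derivable1_diffP.
  by have [] := is_derive1_powR mu a0.
exact: (cvg_comp _ _ ua c).
Qed.

End binomial_series.

(** * Radially nonincreasing cosine transforms *)

Section radially_decreasing.
Context {R : realType} {N : nat}.
Notation lam := (@lebesgue_measure R).
Implicit Types (m k : 'rV[R]_N -> R).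

Definition rdec k := (forall x, 0 <= k x) /\
  (forall x y, dotp x x <= dotp y y -> k y <= k x).

Lemma rdec_lim (k_ : nat -> 'rV[R]_N -> R) k :
  (forall n, rdec (k_ n)) -> (forall x, k_ n x @[n --> \oo] --> k x) -> rdec k.
Proof.
move=> hk ck; split => [x|x y xy].
  by apply: (cvgr_to_ge (ck x)); apply: nearW => n; have [] := hk n.
apply: (ler_cvg_to (ck y) (ck x)); apply: nearW => n.
by have [_] := hk n; exact.
Qed.

(** The unnormalised cosine transform. It is the full Fourier transform for even functions, and all
    the symbols and kernels to which it is applied are even. *)
Definition ft m (x : 'rV[R]_N) : R := \int[leb N]_z (cos (dotp z x) * m z).

(** Both defining properties of [rdec] are closed under pointwise limits, and dominated convergence
    of the symbols gives pointwise convergence of the transforms. Every limit in the proof of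
    positivity of the kernel goes through this lemma. *)
Lemma rdec_ft_lim (m_ : nat -> 'rV[R]_N -> R) m g :
  (leb N).-integrable setT (EFin \o g) ->
  (forall n, measurable_fun setT (m_ n)) ->
  (forall n x, `|m_ n x| <= g x) ->
  (forall x, m_ n x @[n --> \oo] --> m x) ->
  (forall n, rdec (ft (m_ n))) -> rdec (ft m).
Proof.
move=> ig mm_ mg cm; move/rdec_lim; apply => x.
have [] := @dominated_cvg_real _ _ R (leb N)
  (fun n z => cos (dotp z x) * m_ n z) (fun z => cos (dotp z x) * m z) g.
- by move=> n; apply: measurable_funM => //; exact: measurable_cos_dotp.
- by move=> z; apply: cvgM => //; exact: cvg_cst.
- exact: ig.
- move=> n z; rewrite normrM; apply: le_trans (mg n z).
  by rewrite ler_piMl// norm_cos_le1.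
move=> _ i c; rewrite /ft /Rintegral; apply: fine_cvg.
by rewrite fineK//; exact: integrable_fin_num.
Qed.

Lemma ft_gaussN (c : R) (x : 'rV[R]_N) : 0 < c ->
  ft (gaussN c) x = Num.sqrt (pi / c) ^+ N * expR (- (dotp x x / (4 * c))).
Proof. by move=> c0; rewrite /ft /Rintegral integral_cos_gaussN. Qed.

Lemma integrable_cos_gaussN (c : R) (x : 'rV[R]_N) : 0 < c ->
  (leb N).-integrable setT (EFin \o (fun z => cos (dotp z x) * gaussN c z)).
Proof.
move=> c0; apply: integrable_bounded (integrable_gaussN N c0) _ (measurable_cos_dotp x) _ => z.
  exact: gaussN_ge0.
exact: norm_cos_le1.
Qed.

Lemma ft_gauss_sum n (c d : nat -> R) (x : 'rV[R]_N) : (forall i, 0 < d i) ->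
  ft (fun z => \sum_(i < n) c i * gaussN (d i) z) x =
  \sum_(i < n) c i * ft (gaussN (d i)) x.
Proof.
move=> d0; have ii i : (leb N).-integrable setT
    (EFin \o (fun z => c i * (cos (dotp z x) * gaussN (d i) z))).
  exact: (integrableZl measurableT (c i) (integrable_cos_gaussN x (d0 i))).
elim: n => [|n IH].
  rewrite big_ord0 /ft (_ : (fun z => _) = cst 0); last first.
    by apply/funext => z; rewrite big_ord0 mulr0.
  by rewrite Rintegral_cst// mul0r.
rewrite big_ord_recr -IH /ft /=.
rewrite -(RintegralZl (c n) measurableT (integrable_cos_gaussN x (d0 n))) -RintegralD//.
- by apply: eq_Rintegral => z _; rewrite big_ord_recr/= mulrDr; congr (_ + _); ring.
- rewrite (_ : (fun z => _) = fun z => \sum_(i < n)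
      c i * (cos (dotp z x) * gaussN (d i) z)); last first.
    by apply/funext => z; rewrite mulr_sumr; apply: eq_bigr => i _; ring.
  pose F (i : nat) z := (c i * (cos (dotp z x) * gaussN (d i) z))%:E.
  rewrite (_ : _ \o _ = fun z => (\sum_(i < n) F i z)%E); last first.
    by apply/funext => z /=; rewrite sumEFin.
  by apply: (integrable_sum measurableT) => i _; exact: ii.
Qed.

Lemma rdec_ft_gauss_sum n (c d : nat -> R) : (forall i, 0 <= c i) ->
  (forall i, 0 < d i) -> rdec (ft (fun z => \sum_(i < n) c i * gaussN (d i) z)).
Proof.
move=> c0 d0; split => [x|x y xy]; rewrite !ft_gauss_sum//.
  by apply: sumr_ge0 => i _; rewrite mulr_ge0// ft_gaussN// mulr_ge0 ?expR_ge0//.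
apply: ler_sum => i _; rewrite ler_wpM2l// !ft_gaussN// ler_wpM2l//.
by rewrite ler_expR lerN2 ler_wpM2r// invr_ge0 mulr_ge0// ltW.
Qed.

End radially_decreasing.

(** * Positivity and monotonicity of the kernel *)

Section nonneg_polynomials.
Context {R : realType}.

Definition nnpoly (p : {poly R}) := forall i, 0 <= p`_i.

Lemma nnpolyM p q : nnpoly p -> nnpoly q -> nnpoly (p * q).
Proof. by move=> hp hq i; rewrite coefM sumr_ge0// => j _; rewrite mulr_ge0. Qed.

Lemma nnpolyZ (a : R) p : 0 <= a -> nnpoly p -> nnpoly (a *: p).
Proof. by move=> a0 hp i; rewrite coefZ mulr_ge0. Qed.

Lemma nnpoly_sum n (f : 'I_n -> {poly R}) :
  (forall i, nnpoly (f i)) -> nnpoly (\sum_(i < n) f i).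
Proof. by move=> hf i; rewrite coef_sum sumr_ge0// => j _; exact: hf. Qed.

Lemma nnpolyXn n : nnpoly 'X^n.
Proof. by move=> i; rewrite coefXn; case: eqP. Qed.

Lemma nnpolyX p n : nnpoly p -> nnpoly (p ^+ n).
Proof.
move=> hp; elim: n => [|n IH]; last by rewrite exprS; exact: nnpolyM.
by rewrite expr0 -(expr0 'X); exact: nnpolyXn.
Qed.

End nonneg_polynomials.

Section kernel_positivity.
Context {R : realType} {N : nat}.
Variable mu : R.
Hypotheses (mu0 : 0 < mu) (mu1 : mu <= 1).
Implicit Types (z xi : 'rV[R]_N).

Definition symb (t : R) xi : R := expR (- (t * enorm xi `^ (2 * mu))).

Lemma enorm_powR xi : enorm xi `^ (2 * mu) = dotp xi xi `^ mu.
Proof. by rewrite powRrM powR_mulrn ?enorm_ge0// sqr_enorm. Qed.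

Lemma symb_ge0 t xi : 0 <= symb t xi. Proof. exact: expR_ge0. Qed.

Lemma symb_le1 t xi : 0 <= t -> symb t xi <= 1.
Proof. by move=> t0; rewrite expR_le1 oppr_le0 mulr_ge0// powR_ge0. Qed.

Lemma measurable_symb t : measurable_fun setT (symb t).
Proof.
apply: (measurableT_comp (@measurable_expR R)); apply: measurable_funN.
apply: measurable_funM => //.
apply: (measurableT_comp (@measurable_powR R (2 * mu))).
exact: measurable_fun_enorm.
Qed.

(* [dotp z z = |z|^2] enters through [x = exp(-e(|z|^2 + e))], which stays away from 1. *)
Let xz (e : R) z := expR (- (e * (dotp z z + e))).

Let xz01 e z : 0 < e -> 0 <= xz e z < 1.
Proof.
move=> e0; rewrite expR_ge0/= expR_lt1 oppr_lt0 mulr_gt0//.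
by rewrite ltr_wpDl// dotp_ge0.
Qed.

(** The i-th power of [xz e z] is a positive multiple of the Gaussian with parameter i e. The factor
    [gaussN dl] makes the term of degree 0 integrable as well, and it dominates the approximations
    that follow. *)
Lemma rdec_ft_nnpoly (dl e : R) p : 0 < dl -> 0 < e -> nnpoly p ->
  rdec (ft (fun z => gaussN dl z * p.[xz e z])).
Proof.
move=> dl0 e0 hp.
rewrite (_ : (fun z => _) = (fun z => \sum_(i < size p)
   (p`_i * expR (- (e * e)) ^+ i) * gaussN (dl + i%:R * e) z)); last first.
  apply/funext => z; rewrite horner_coef mulr_sumr; apply: eq_bigr => i _.
  rewrite /gaussN /xz -!expRM_natl -mulrA -expRD mulrCA -expRD.
  by congr (_ * expR _); ring.
apply: (@rdec_ft_gauss_sum R N _ (fun i => p`_i * expR (- (e * e)) ^+ i)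
  (fun i => dl + i%:R * e)).
  by move=> i; rewrite mulr_ge0// exprn_ge0// expR_ge0.
by move=> i; rewrite ltr_pwDl// mulr_ge0// ltW.
Qed.

(** With x = [xz e z], the function exp(-c (1 - x)^mu) is exp(-c) exp(c (1 - (1 - x)^mu)). Cutting
    the binomial series after K terms and the exponential series after n terms leaves a polynomial
    in x with nonnegative coefficients. *)
Lemma rdec_ft_approx1 (dl e c : R) (n K : nat) : 0 < dl -> 0 < e -> 0 <= c ->
  rdec (ft (fun z => gaussN dl z *
    (expR (- c) * series (exp_coeff (c * bser mu K (xz e z))) n))).
Proof.
move=> dl0 e0 c0.
pose P := \sum_(i < K) bcoef mu i *: 'X^(i.+1) : {poly R}.
pose p := expR (- c) *: \sum_(k < n) (c ^+ k / k`!%:R) *: P ^+ k.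
have hP : nnpoly P.
  apply: nnpoly_sum => i; apply: nnpolyZ; last exact: nnpolyXn.
  exact: bcoef_ge0.
have hp : nnpoly p.
  apply: nnpolyZ; first exact: expR_ge0.
  apply: nnpoly_sum => i; apply: nnpolyZ; last exact: nnpolyX.
  by rewrite divr_ge0// exprn_ge0.
rewrite (_ : (fun z => _) = (fun z => gaussN dl z * p.[xz e z])).
  exact: rdec_ft_nnpoly.
apply/funext => z; congr (_ * _); rewrite hornerZ; congr (_ * _).
rewrite horner_sum /series/= big_mkord; apply: eq_bigr => k _.
rewrite /exp_coeff hornerZ horner_exp /= exprMn mulrAC; congr (_ * _ ^+ _).
by rewrite horner_sum; apply: eq_bigr => i _; rewrite hornerZ hornerXn.
Qed.

Let dom_gauss (dl : R) (g : nat -> 'rV[R]_N -> R) :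
  (forall n z, 0 <= g n z <= 1) ->
  forall n z, `|gaussN dl z * g n z| <= gaussN dl z.
Proof.
move=> g01 n z; have /andP[h0 h1] := g01 n z.
by rewrite ger0_norm ?mulr_ge0 ?gaussN_ge0// ler_piMr// gaussN_ge0.
Qed.

Lemma measurable_xz e : measurable_fun setT (xz e).
Proof.
apply: (measurableT_comp (@measurable_expR R)); apply: measurable_funN.
apply: measurable_funM => //; apply: measurable_funD => //.
exact: measurable_fun_dotp.
Qed.

Lemma series_exp_bound (x c : R) n : 0 <= x <= c ->
  0 <= expR (- c) * series (exp_coeff x) n <= 1.
Proof.
move=> /andP[x0 xc].
have s0 : 0 <= series (exp_coeff x) n.
  by rewrite /series/= sumr_ge0// => i _; rewrite exp_coeff_ge0.
rewrite mulr_ge0 ?expR_ge0//= expRN mulrC ler_pdivrMr ?expR_gt0// mul1r.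
apply: (@le_trans _ _ (expR x)); last by rewrite ler_expR.
apply: nondecreasing_cvgn_le; last exact: is_cvg_series_exp_coeff.
by apply: nondecreasing_series => i _ _; rewrite exp_coeff_ge0.
Qed.

Lemma rdec_ft_approx2 (dl e c : R) (n : nat) : 0 < dl -> 0 < e -> 0 <= c ->
  rdec (ft (fun z => gaussN dl z *
    (expR (- c) * series (exp_coeff (c * (1 - (1 - xz e z) `^ mu))) n))).
Proof.
move=> dl0 e0 c0.
have b0 K z : 0 <= bser mu K (xz e z).
  by apply: bser_ge0 => //; have /andP[] := xz01 z e0.
have b1 K z : bser mu K (xz e z) <= 1 by apply: bser_le1 => //; exact: xz01.
have mser (f : 'rV[R]_N -> R) : measurable_fun setT f ->
    measurable_fun setT (fun z => series (exp_coeff (f z)) n).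
  move=> mf; rewrite /series /=; elim: (index_iota _ _) => [|a l IHl].
    by under eq_fun do rewrite big_nil; exact: measurable_cst.
  under eq_fun do rewrite big_cons.
  apply: measurable_funD => //; rewrite /exp_coeff/=.
  by apply: measurable_funM => //; exact: measurable_funX.
apply: (@rdec_ft_lim R N (fun K z => gaussN dl z *
    (expR (- c) * series (exp_coeff (c * bser mu K (xz e z))) n)) _ (gaussN dl)).
- exact: integrable_gaussN.
- move=> K; apply: measurable_funM; first exact: measurable_gaussN.
  apply: measurable_funM => //; apply: mser; apply: measurable_funM => //.
  rewrite /bser; elim: (index_enum _) => [|a l IHl].
    by under eq_fun do rewrite big_nil; exact: measurable_cst.
  under eq_fun do rewrite big_cons.
  apply: measurable_funD => //; apply: measurable_funM => //.
  by apply: measurable_funX; exact: measurable_xz.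
- apply: (@dom_gauss dl (fun K z => expR (- c) * series (exp_coeff (c * bser mu K (xz e z))) n)) => K z.
  by apply: series_exp_bound; rewrite mulr_ge0//= ler_piMr.
- move=> z; apply: cvgM; first exact: cvg_cst.
  apply: cvgM; first exact: cvg_cst.
  rewrite /series/=; elim: (index_iota _ _) => [|a l IHl].
    under eq_fun do rewrite big_nil; rewrite big_nil; exact: cvg_cst.
  under eq_fun do rewrite big_cons; rewrite big_cons.
  apply: cvgD => //; apply: cvgM; last exact: cvg_cst.
  apply: (@cvg_comp _ _ _ _ (fun y => y ^+ a) _ _ _ _ (@exprn_continuous R a _)).
  by apply: cvgM; [exact: cvg_cst|apply: bser_cvg => //; exact: xz01].
- move=> K; exact: rdec_ft_approx1.
Qed.

Let measurable_powxz e : measurable_fun setT (fun z => (1 - xz e z) `^ mu).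
Proof.
apply: (measurableT_comp (@measurable_powR R mu)).
by apply: measurable_funB => //; exact: measurable_xz.
Qed.

Let pow01 e z : 0 < e -> 0 <= (1 - xz e z) `^ mu <= 1.
Proof.
move=> e0; have /andP[x0 x1] := xz01 z e0; rewrite powR_ge0/=.
rewrite -[leRHS](powRr0 (1 - xz e z)); apply: ger_powR; last exact: ltW.
by rewrite subr_gt0 x1/= lerBlDr lerDl.
Qed.

Lemma rdec_ft_approx3 (dl e c : R) : 0 < dl -> 0 < e -> 0 <= c ->
  rdec (ft (fun z => gaussN dl z * expR (- (c * (1 - xz e z) `^ mu)))).
Proof.
move=> dl0 e0 c0.
have h z : 0 <= c * (1 - (1 - xz e z) `^ mu) <= c.
  have /andP[p0 p1] := pow01 z e0.
  by rewrite mulr_ge0 ?subr_ge0//= ler_piMr// lerBlDr lerDl.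
have mser (f : 'rV[R]_N -> R) n : measurable_fun setT f ->
    measurable_fun setT (fun z => series (exp_coeff (f z)) n).
  move=> mf; rewrite /series /=; elim: (index_iota _ _) => [|a l IHl].
    by under eq_fun do rewrite big_nil; exact: measurable_cst.
  under eq_fun do rewrite big_cons.
  apply: measurable_funD => //; rewrite /exp_coeff/=.
  by apply: measurable_funM => //; exact: measurable_funX.
apply: (@rdec_ft_lim R N (fun n z => gaussN dl z *
    (expR (- c) * series (exp_coeff (c * (1 - (1 - xz e z) `^ mu))) n)) _ (gaussN dl)).
- exact: integrable_gaussN.
- move=> n; apply: measurable_funM; first exact: measurable_gaussN.
  apply: measurable_funM => //; apply: mser; apply: measurable_funM => //.
  by apply: measurable_funB => //; exact: measurable_powxz.
- apply: (@dom_gauss dl (fun n z => expR (- c) *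
    series (exp_coeff (c * (1 - (1 - xz e z) `^ mu))) n)) => n z.
  exact: series_exp_bound.
- move=> z; apply: cvgM; first exact: cvg_cst.
  rewrite (_ : expR (- (c * (1 - xz e z) `^ mu)) =
    expR (- c) * expR (c * (1 - (1 - xz e z) `^ mu))); last first.
    by rewrite -expRD; congr expR; ring.
  apply: cvgM; first exact: cvg_cst.
  exact: is_cvg_series_exp_coeff.
- move=> n; exact: rdec_ft_approx2.
Qed.

(** For y = e (x + e), the bounds 1 - y <= exp(-y) <= 1/(1 + y) squeeze 1 - exp(-y) between y/(1 +
    y) and y; division by e gives x in the limit. *)
Lemma cvg_onem_xz (x : R) : 0 <= x ->
  (1 - expR (- (n.+1%:R^-1 * (x + n.+1%:R^-1)))) / n.+1%:R^-1 @[n --> \oo] --> x.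
Proof.
move=> x0; have eps0 : (fun n => n.+1%:R^-1 : R) @ \oo --> (0 : R).
  exact: cvg_harmonic.
have up : (fun n => x + n.+1%:R^-1 : R) @ \oo --> x.
  by rewrite -[X in _ --> X]addr0; apply: cvgD => //; exact: cvg_cst.
have lo : (fun n => (x + n.+1%:R^-1) / (1 + n.+1%:R^-1 * (x + n.+1%:R^-1)) : R) @ \oo --> x.
  rewrite -[X in _ --> X]divr1; apply: cvgM => //; apply: cvgV; first exact: oner_neq0.
  rewrite -[X in _ --> X]addr0; apply: cvgD; first exact: cvg_cst.
  by rewrite -(mul0r x); exact: cvgM.
apply: (squeeze_cvgr _ lo up); apply: nearW => n.
set e := n.+1%:R^-1; have e0 : 0 < e by rewrite invr_gt0.
have y0 : 0 <= e * (x + e) by rewrite mulr_ge0 ?addr_ge0 ?(ltW e0).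
have y1 : 0 < 1 + e * (x + e) by lra.
apply/andP; split; last first.
  by rewrite ler_pdivrMr// (mulrC (x + e) e); have := expR_ge1Dx (- (e * (x + e))); lra.
rewrite ler_pdivlMr// mulrAC (mulrC _ e) ler_pdivrMr//.
have h : expR (- (e * (x + e))) * (1 + e * (x + e)) <= 1.
  by rewrite expRN mulrC ler_pdivrMr ?expR_gt0// mul1r expR_ge1Dx.
lra.
Qed.

Lemma rdec_ft_approx4 (t dl : R) : 0 < t -> 0 < dl ->
  rdec (ft (fun z => gaussN dl z * symb t z)).
Proof.
move=> t0 dl0.
pose e n : R := n.+1%:R^-1; have e0 n : 0 < e n by rewrite invr_gt0.
(* With this c, the exponent c (1 - x)^mu becomes t ((1 - x)/e)^mu, and (1 - x)/e tends to |z|^2. *)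
pose c n : R := t * (e n) `^ (- mu).
have c0 n : 0 <= c n by rewrite mulr_ge0 ?powR_ge0// ltW.
apply: (@rdec_ft_lim R N (fun n z => gaussN dl z *
    expR (- (c n * (1 - xz (e n) z) `^ mu))) _ (gaussN dl)).
- exact: integrable_gaussN.
- move=> n; apply: measurable_funM; first exact: measurable_gaussN.
  apply: (measurableT_comp (@measurable_expR R)); apply: measurable_funN.
  by apply: measurable_funM => //; exact: measurable_powxz.
- apply: (@dom_gauss dl (fun n z => expR (- (c n * (1 - xz (e n) z) `^ mu)))) => n z.
  by rewrite expR_ge0/= expR_le1 oppr_le0 mulr_ge0// powR_ge0.
- move=> z; apply: cvgM; first exact: cvg_cst.
  apply: (@cvg_comp _ _ _ _ expR); last exact: continuous_expR.
  apply: cvgN; rewrite enorm_powR.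
  rewrite (_ : (fun n => _) =
    (fun n => t * ((1 - expR (- (e n * (dotp z z + e n)))) / e n) `^ mu)); last first.
    apply/funext => n; rewrite /c -mulrA; congr (_ * _).
    have /andP[x0 x1] := xz01 z (e0 n).
    rewrite powRM ?invr_ge0 ?(ltW (e0 n)) ?subr_ge0 ?(ltW x1)//.
    by rewrite mulrC; congr (_ * _); rewrite -powR_inv1 ?(ltW (e0 n))// -powRrM mulN1r.
  apply: cvgM; first exact: cvg_cst.
  apply: powR_cvg => //; first exact: dotp_ge0.
    move=> n; have /andP[x0 x1] := xz01 z (e0 n).
    by rewrite divr_ge0 ?(ltW (e0 n))// subr_ge0 ltW.
  by apply: cvg_onem_xz; exact: dotp_ge0.
- move=> n; exact: rdec_ft_approx3.
Qed.

(** The Gaussian factor is removed by letting its parameter tend to 0; the symbol itself, being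
    integrable, is now the dominating function. *)
Lemma rdec_ft_symb (t : R) : 0 < t ->
  (leb N).-integrable setT (EFin \o symb t) -> rdec (ft (symb t)).
Proof.
move=> t0 it.
apply: (@rdec_ft_lim R N (fun n z => gaussN n.+1%:R^-1 z * symb t z) _ (symb t)) => //.
- move=> n; apply: measurable_funM; first exact: measurable_gaussN.
  exact: measurable_symb.
- move=> n z; rewrite normrM (ger0_norm (symb_ge0 _ _)) (ger0_norm (gaussN_ge0 _ _)).
  apply: ler_piMl; first exact: symb_ge0.
  by rewrite expR_le1 oppr_le0; apply: mulr_ge0; [rewrite invr_ge0|exact: dotp_ge0].
- move=> z; have h : gaussN n.+1%:R^-1 z @[n --> \oo] --> (1 : R).
    rewrite [X in _ --> X](_ : _ = expR (- (0 * dotp z z))); last first.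
      by rewrite mul0r oppr0 expR0.
    apply: (@cvg_comp _ _ _ _ expR); last exact: continuous_expR.
    by apply: cvgN; apply: cvgM; [exact: cvg_harmonic|exact: cvg_cst].
  rewrite -[X in _ --> X]mul1r; apply: cvgM => //; exact: cvg_cst.
- by move=> n; apply: rdec_ft_approx4 => //; rewrite invr_gt0.
Qed.

Lemma integrable_oneDsqrV :
  (\int[@lebesgue_measure R]_x ((oneDsqr x)^-1)%:E < +oo)%E.
Proof.
have c := @continuous_oneDsqrV R.
rewrite ge0_symfun_integralT//.
- rewrite -set_itvcy integral0y_oneDsqr.
  by rewrite -EFinM ltry.
- by move=> x; rewrite /= /oneDsqr sqrrN.
Qed.

Lemma power_le_exp (t : R) : 0 < t -> exists2 C : R, 0 <= C &
  forall y : R, 0 <= y -> (1 + y) ^+ N <= C * expR (t * y `^ mu).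
Proof.
(* The order k satisfies mu k >= N, so that for y > 1 the k-th term of the exponential series alone
   dominates y^N. *)
move=> t0; pose k := (Num.truncn (N%:R / mu)).+1.
have kN : N%:R <= mu * k%:R.
  by rewrite -ler_pdivrMl// mulrC ltW// truncnS_gt.
exists (2 ^+ N * (1 + k`!%:R / t ^+ k)) => [|y y0].
  by rewrite mulr_ge0// addr_ge0// divr_ge0// exprn_ge0// ltW.
have e1 : 1 <= expR (t * y `^ mu) by rewrite -expR0 ler_expR mulr_ge0 ?powR_ge0 ?(ltW t0).
have q0 : 0 <= k`!%:R / t ^+ k by rewrite divr_ge0// exprn_ge0// ltW.
have [y1|y1] := leP y 1.
  apply: (@le_trans _ _ (2 ^+ N)); first by rewrite lerXn2r ?nnegrE; lra.
  rewrite -mulrA; apply: ler_peMr; first exact: exprn_ge0.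
  by rewrite mulrDl mul1r (le_trans e1)// lerDl mulr_ge0// expR_ge0.
apply: (@le_trans _ _ ((2 * y) ^+ N)); first by rewrite lerXn2r ?nnegrE; lra.
rewrite exprMn -mulrA ler_wpM2l ?exprn_ge0//.
apply: (@le_trans _ _ ((k`!%:R / t ^+ k) * expR (t * y `^ mu))); last first.
  by rewrite ler_wpM2r ?expR_ge0// lerDr.
have h := @expR_ge1Dxn R (t * y `^ mu) (Num.truncn (N%:R / mu)).
have h1 : (t * y `^ mu) ^+ k / k`!%:R <= expR (t * y `^ mu).
  have := h (mulr_ge0 (ltW t0) (powR_ge0 _ _)).
  by apply: le_trans; rewrite lerDr.
apply: (@le_trans _ _ ((y `^ mu) ^+ k)).
  rewrite -powR_mulrn ?powR_ge0// -powRrM -powR_mulrn ?(ltW (lt_trans _ y1))//.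
  by apply: ler_powR => //; exact: ltW.
rewrite -(ler_pM2l (_ : 0 < t ^+ k / k`!%:R)); last first.
  by rewrite divr_gt0 ?exprn_gt0// ltr0n fact_gt0.
rewrite [leRHS]mulrA (_ : t ^+ k / k`!%:R * (k`!%:R / t ^+ k) = 1); last first.
  by field; rewrite gt_eqF ?exprn_gt0//= pnatr_eq0 -lt0n fact_gt0.
by rewrite mul1r mulrAC -exprMn.
Qed.

(* [prod_i (1 + xi_i^2) <= (1 + |xi|^2)^N] and [exp] beats every power. *)
Lemma integrable_symb t : 0 < t -> (leb N).-integrable setT (EFin \o symb t).
Proof.
move=> t0; have [C C0 hC] := power_le_exp t0.
apply/integrableP; split; first by apply/measurable_EFinP; exact: measurable_symb.
have mo : measurable_fun setT (fun x : R => ((oneDsqr x)^-1)%:E).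
  apply/measurable_EFinP; apply: continuous_measurable_fun.
  exact: continuous_oneDsqrV.
have o0 (x : R) : 0 <= (oneDsqr x)^-1.
  by rewrite invr_ge0 (le_trans ler01)// oneDsqr_ge1.
have mp : measurable_fun setT
    (fun x : 'rV[R]_N => \prod_(i < N) ((oneDsqr (x ord0 i))^-1)%:E)%E.
  elim: (index_enum _) => [|a l IHl].
    by under eq_fun do rewrite big_nil; exact: measurable_cst.
  under eq_fun do rewrite big_cons.
  apply: emeasurable_funM => //.
  exact: (measurableT_comp mo (@measurable_coor R N a)).
apply: (@le_lt_trans _ _ (\int[leb N]_x
  (C%:E * \prod_(i < N) ((oneDsqr (x ord0 i))^-1)%:E))%E).
  apply: ge0_le_integral => //.
  - apply: measurableT_comp => //; apply/measurable_EFinP; exact: measurable_symb.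
  - apply: emeasurable_funM; [exact: measurable_cst|exact: mp].
  - move=> x _ /=; rewrite ger0_norm ?symb_ge0// prodEFin -EFinM lee_fin.
    rewrite /symb expRN enorm_powR prodfV ler_pdivlMr; last first.
      by apply: prodr_gt0 => i _; rewrite (lt_le_trans ltr01)// oneDsqr_ge1.
    rewrite mulrC ler_pdivrMr ?expR_gt0//.
    apply: le_trans (hC _ (dotp_ge0 x)).
    have -> (c : R) : c ^+ N = \prod_(i < N) c by rewrite prodr_const card_ord.
    apply: ler_prod => i _.
    rewrite (le_trans ler01 (oneDsqr_ge1 _))/= /oneDsqr lerD2l.
    rewrite -(real_normK (num_real _)) -sqr_enorm lerXn2r ?nnegrE ?enorm_ge0//.
    exact: le_coor_enorm.
rewrite ge0_integralZl//.
  rewrite (@ge0_integral_prod R N (fun _ x => ((oneDsqr x)^-1)%:E))//.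
  rewrite ltey_eq fin_numM//.
  elim/big_ind : _ => // [a b|i _]; first exact: fin_numM.
  rewrite ge0_fin_numE ?integrable_oneDsqrV//.
  by apply: integral_ge0 => x _; rewrite lee_fin.
by move=> x _; rewrite prode_ge0// => i _; rewrite lee_fin.
Qed.

End kernel_positivity.

(** * Fubini's theorem for bounded kernels *)

Section fubini_tools.
Context {R : realType}.

Lemma measurable_sec1 d1 d2 d3 (T1 : measurableType d1) (T2 : measurableType d2)
    (U : measurableType d3) (h : T1 -> T2 -> U) (x : T1) :
  measurable_fun setT (fun z : T1 * T2 => h z.1 z.2) -> measurable_fun setT (h x).
Proof. by move=> mh; exact: (measurableT_comp mh (measurable_pair1 x)). Qed.

Lemma measurable_sec2 d1 d2 d3 (T1 : measurableType d1) (T2 : measurableType d2)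
    (U : measurableType d3) (h : T1 -> T2 -> U) (y : T2) :
  measurable_fun setT (fun z : T1 * T2 => h z.1 z.2) ->
  measurable_fun setT (fun x => h x y).
Proof. by move=> mh; exact: (measurableT_comp mh (measurable_pair2 y)). Qed.

Lemma integrable_prod2 d1 d2 (T1 : measurableType d1) (T2 : measurableType d2)
    (m1 : {sigma_finite_measure set T1 -> \bar R})
    (m2 : {sigma_finite_measure set T2 -> \bar R})
    (f1 : T1 -> R) (f2 : T2 -> R) (h : T1 * T2 -> R) :
  m1.-integrable setT (EFin \o f1) -> m2.-integrable setT (EFin \o f2) ->
  measurable_fun setT h -> (forall x y, `|h (x, y)| <= `|f1 x * f2 y|) ->
  (m1 \x m2)%E.-integrable setT (EFin \o h).
Proof.
move=> i1 i2 mh hle; have /integrableP[mf1 l1] := i1; have /integrableP[mf2 l2] := i2.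
apply/integrable12ltyP; first exact/measurable_EFinP.
have a1 x : (0 <= `|(f1 x)%:E|)%E by [].
apply: (@le_lt_trans _ _ (\int[m1]_x (`|(f1 x)%:E| * \int[m2]_y `|(f2 y)%:E|))%E).
  apply: ge0_le_integral => //.
  - by move=> x _; exact: integral_ge0.
  - apply: (@measurable_integral_param _ _ _ _ _ _ (fun x y => `|(h (x, y))%:E|)%E) => //.
    under eq_fun => z do rewrite -surjective_pairing.
    by apply: measurableT_comp => //; exact/measurable_EFinP.
  - apply: emeasurable_funM; last exact: measurable_cst.
    exact: measurableT_comp.
  - move=> x _; rewrite -ge0_integralZl//; last exact: measurableT_comp.
    apply: ge0_le_integral => //.
    + apply: measurableT_comp => //; apply/measurable_EFinP.
      by apply: (measurableT_comp mh); exact: measurable_pair1.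
    + by apply: emeasurable_funM; [exact: measurable_cst|exact: measurableT_comp].
    + by move=> y _ /=; rewrite -EFinM lee_fin -normrM.
rewrite ge0_integralZr//; last 2 first.
- exact: measurableT_comp.
- exact: integral_ge0.
by rewrite lte_mul_pinfty// ?integral_ge0// ge0_fin_numE// integral_ge0.
Qed.

Lemma Rintegral_swap d1 d2 (T1 : measurableType d1) (T2 : measurableType d2)
    (m1 : {sigma_finite_measure set T1 -> \bar R})
    (m2 : {sigma_finite_measure set T2 -> \bar R})
    (f1 : T1 -> R) (f2 : T2 -> R) (h : T1 -> T2 -> R) :
  m1.-integrable setT (EFin \o f1) -> m2.-integrable setT (EFin \o f2) ->
  measurable_fun setT (fun z : T1 * T2 => h z.1 z.2) ->
  (forall x y, `|h x y| <= 1) ->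
  \int[m1]_x (f1 x * \int[m2]_y (h x y * f2 y)) =
  \int[m2]_y (f2 y * \int[m1]_x (h x y * f1 x)).
Proof.
move=> i1 i2 mh h1.
have mf1 : measurable_fun setT f1 by apply/measurable_EFinP; exact: (measurable_int _ i1).
have mf2 : measurable_fun setT f2 by apply/measurable_EFinP; exact: (measurable_int _ i2).
have mg : measurable_fun setT (fun z : T1 * T2 => f1 z.1 * (h z.1 z.2 * f2 z.2)).
  apply: measurable_funM; first exact: (measurableT_comp mf1 measurable_fst).
  by apply: measurable_funM => //; exact: (measurableT_comp mf2 measurable_snd).
have ig : (m1 \x m2)%E.-integrable setT
    (EFin \o (fun z : T1 * T2 => f1 z.1 * (h z.1 z.2 * f2 z.2))).
  apply: (integrable_prod2 i1 i2 mg) => x y /=.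
  by rewrite !normrM ler_wpM2l// ler_piMl.
have ih2 x : m2.-integrable setT (EFin \o (fun y => h x y * f2 y)).
  apply: (le_integrable _ _ _ i2) => //.
    apply/measurable_EFinP; apply: measurable_funM => //.
    exact: (measurable_sec1 x mh).
  by move=> y _ /=; rewrite lee_fin normrM ler_piMl.
have ih1 y : m1.-integrable setT (EFin \o (fun x => h x y * f1 x)).
  apply: (le_integrable _ _ _ i1) => //.
    apply/measurable_EFinP; apply: measurable_funM => //.
    exact: (measurable_sec2 y mh).
  by move=> x _ /=; rewrite lee_fin normrM ler_piMl.
rewrite /Rintegral; congr fine.
transitivity (\int[m1]_x \int[m2]_y (f1 x * (h x y * f2 y))%:E)%E.
  apply: eq_integral => x _; rewrite EFinM (fineK (integrable_fin_num measurableT (ih2 x))).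
  by rewrite -(integralZl measurableT (ih2 x)).
rewrite (Fubini ig); apply: eq_integral => y _.
rewrite EFinM (fineK (integrable_fin_num measurableT (ih1 y))).
rewrite -(integralZl measurableT (ih1 y)); apply: eq_integral => x _ /=.
by rewrite -EFinM; congr EFin; ring.
Qed.

End fubini_tools.

(** * The fractional heat kernel as a real function *)

Section fourier.
Context {R : realType} {N : nat}.
Variable mu : R.
Hypotheses (mu0 : 0 < mu) (mu1 : mu <= 1).
Implicit Types (x y z xi : 'rV[R]_N).

Local Notation symb := (@symb R N mu).
Local Notation isymb := (@integrable_symb R N mu mu0).

(** The extension by 0 to t <= 0 turns a convolution over all times into a Duhamel integral over (0,
    t). *)
Definition heatk (t : R) x : R := if 0 < t then (2 * pi) ^- N * ft (symb t) x else 0.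

Let C0 : 0 <= (2 * pi : R) ^- N.
Proof. by rewrite invr_ge0 exprn_ge0// mulr_ge0// pi_ge0. Qed.

Lemma frac_heat_kernelE t x : 0 < t -> complex.Re (frac_heat_kernel mu t x) = heatk t x.
Proof.
move=> t0; rewrite /frac_heat_kernel /cintegral /heatk t0 /=.
rewrite mul0r subr0; congr (_ * _).
by apply: eq_Rintegral => xi _; rewrite mulrC dotpC.
Qed.

Lemma heatk_ge0 t x : 0 <= heatk t x.
Proof.
rewrite /heatk; case: ifP => // t0; apply: mulr_ge0 => //.
by have [h _] := rdec_ft_symb mu0 mu1 t0 (isymb t0); exact: h.
Qed.

Lemma heatk_rdec t x y : enorm x <= enorm y -> heatk t y <= heatk t x.
Proof.
move=> xy; rewrite /heatk; case: ifP => // t0; apply: ler_wpM2l => //.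
have [_ h] := rdec_ft_symb mu0 mu1 t0 (isymb t0); apply: h.
by rewrite -!sqr_enorm lerXn2r// nnegrE enorm_ge0.
Qed.

Lemma heatkN t x : heatk t (- x) = heatk t x.
Proof. by apply/eqP; rewrite eq_le !heatk_rdec// enormN. Qed.

Lemma integrable_cos_symb t x : 0 < t ->
  (leb N).-integrable setT (EFin \o (fun xi => cos (dotp xi x) * symb t xi)).
Proof.
move=> t0; apply: integrable_bounded (isymb t0) _ (measurable_cos_dotp x) _ => z.
  exact: symb_ge0.
exact: norm_cos_le1.
Qed.

Lemma measurable_fun_symb d (T : measurableType d) (f : T -> R) (g : T -> 'rV[R]_N) :
  measurable_fun setT f -> measurable_fun setT g ->
  measurable_fun setT (fun a => symb (f a) (g a)).
Proof.
move=> mf mg; apply: (measurableT_comp (@measurable_expR R)).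
apply: measurable_funN; apply: measurable_funM => //.
apply: (measurableT_comp (@measurable_powR R (2 * mu))).
exact: measurable_fun_enorm.
Qed.

(** Writing cos as (1 + cos) - 1 gives a difference of two integrals of nonnegative functions, and
    each of them depends measurably on (t, x) by Tonelli's theorem. *)
Lemma measurable_heatk :
  measurable_fun setT (fun z : measurableTypeR R * 'rV[R]_N => heatk z.1 z.2).
Proof.
pose A (z : measurableTypeR R * 'rV[R]_N) :=
  (\int[leb N]_xi ((1 + cos (dotp xi z.2)) * symb z.1 xi)%:E)%E.
pose B (z : measurableTypeR R * 'rV[R]_N) := (\int[leb N]_xi (symb z.1 xi)%:E)%E.
have mA : measurable_fun setT A.
  apply: (@measurable_integral_param _ _ _ _ _ _
    (fun (z : measurableTypeR R * 'rV[R]_N) xi =>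
      ((1 + cos (dotp xi z.2)) * symb z.1 xi)%:E)).
    apply/measurable_EFinP; apply: measurable_funM.
      apply: measurable_funD => //; apply: (measurableT_comp measurable_cos).
      apply: measurable_fun_dotp => //.
      exact: (measurableT_comp measurable_snd measurable_fst).
    apply: measurable_fun_symb => //.
    exact: (measurableT_comp measurable_fst measurable_fst).
  by move=> z xi; rewrite lee_fin mulr_ge0 ?symb_ge0.
have mB : measurable_fun setT B.
  apply: (@measurable_integral_param _ _ _ _ _ _
    (fun (z : measurableTypeR R * 'rV[R]_N) xi => (symb z.1 xi)%:E)).
    apply/measurable_EFinP; apply: measurable_fun_symb => //.
    exact: (measurableT_comp measurable_fst measurable_fst).
  by move=> z xi; rewrite lee_fin symb_ge0.
rewrite (_ : (fun w => _) = (fun w : measurableTypeR R * 'rV[R]_N =>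
    if 0 < w.1 then (2 * pi) ^- N * (fine (A w) - fine (B w)) else 0)); last first.
  apply/funext => -[t x]; rewrite /heatk /=; case: ifP => // t0; congr (_ * _).
  rewrite /A /B /= (_ : (fun xi => _) = (fun xi => ((cos (dotp xi x) * symb t xi)%:E
    + (symb t xi)%:E)%E)); last first.
    by apply/funext => xi; rewrite -EFinD; congr EFin; ring.
  rewrite integralD//; [|exact: (integrable_cos_symb x t0)|exact: (isymb t0)].
  rewrite fineD.
  - by rewrite /ft /Rintegral; ring.
  - by apply: integrable_fin_num => //; exact: (integrable_cos_symb x t0).
  - by apply: integrable_fin_num => //; exact: (isymb t0).
apply: measurable_fun_ifT => //.
  exact: measurable_fun_ltr.
apply: measurable_funM => //; apply: measurable_funB.
  exact: (measurableT_comp (@fine_measurable R setT measurableT) mA).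
exact: (measurableT_comp (@fine_measurable R setT measurableT) mB).
Qed.

End fourier.

(** * Fourier inversion by Gaussian means *)

Section fourier_inversion.
Context {R : realType} {N : nat}.
Variable mu : R.
Hypotheses (mu0 : 0 < mu) (mu1 : mu <= 1).
Implicit Types (x y z xi : 'rV[R]_N).

Definition gauss_int (m : 'rV[R]_N -> R) (s : R) xi : \bar R :=
  (\int[leb N]_z (m (s *: z + xi)%R * gaussN 1 z)%:E)%E.

(** The mean of [m] with respect to the Gaussian probability density of width [s] centred at [xi];
    it tends to m(xi) as s tends to 0 when [m] is continuous and bounded. *)
Definition gauss_avg (m : 'rV[R]_N -> R) (s : R) xi : R :=
  Num.sqrt pi ^- N * fine (gauss_int m s xi).

Let sqrtpi0 : 0 < Num.sqrt (pi : R) ^+ N.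
Proof. by rewrite exprn_gt0// sqrtr_gt0 pi_gt0. Qed.

Lemma symbN t xi : symb mu t (- xi) = symb mu t xi.
Proof. by rewrite /symb enormN. Qed.

Let integrable_avg (t s : R) xi : 0 < t ->
  (leb N).-integrable setT (EFin \o (fun z => symb mu t (s *: z + xi) * gaussN 1 z)).
Proof.
move=> t0; apply: integrable_bounded (integrable_gaussN N ltr01) _ _ _.
- by move=> z; exact: gaussN_ge0.
- apply: measurable_fun_symb; first exact: measurable_cst.
  by apply: measurable_fun_rVD => //; exact: measurable_fun_rVZ.
- by move=> z; rewrite ger0_norm ?symb_ge0// symb_le1// ltW.
Qed.

Let mshift (s : R) xi : measurable_fun setT (fun z => s *: z + xi).
Proof. by apply: measurable_fun_rVD => //; exact: measurable_fun_rVZ. Qed.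

Lemma gauss_avg_symbN t s xi : gauss_avg (symb mu t) s (- xi) = gauss_avg (symb mu t) s xi.
Proof.
suff E : gauss_int (symb mu t) s (- xi) = gauss_int (symb mu t) s xi.
  by rewrite /gauss_avg E.
rewrite /gauss_int; apply: etrans (integral_reflect _).
  apply: eq_integral => z _.
  rewrite scalerN (_ : - (s *: z) + xi = - (s *: z - xi)) ?opprB 1?addrC//.
  by rewrite addrC -opprB symbN /gaussN dotpNl dotpNr opprK.
apply/measurable_EFinP; apply: measurable_funM; last exact: measurable_gaussN.
apply: measurable_fun_symb; [exact: measurable_cst|exact: mshift].
Qed.

(** The transform of exp(-s^2 |z|^2 / 4) is (2 pi)^N times the Gaussian probability density of width
    s, so that the substitution z -> s z + xi produces the mean. *)
Lemma integral_symb_gauss (t s : R) xi : 0 < t -> 0 < s ->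
  \int[leb N]_z (symb mu t z * ft (gaussN (s ^+ 2 / 4)) (z - xi)) =
  (2 * pi) ^+ N * gauss_avg (symb mu t) s xi.
Proof.
move=> t0 s0; have c0 : 0 < s ^+ 2 / 4 by rewrite divr_gt0// exprn_gt0.
pose q : R := Num.sqrt (pi / (s ^+ 2 / 4)) ^+ N.
pose f z := (symb mu t z * (q * expR (- (dotp (z - xi) (z - xi) / s ^+ 2))))%:E.
have mf : measurable_fun setT f.
  apply/measurable_EFinP; apply: measurable_funM; first exact: measurable_symb.
  apply: measurable_funM => //; apply: (measurableT_comp (@measurable_expR R)).
  apply: measurable_funN; apply: measurable_funM => //.
  by apply: measurable_fun_dotp; apply: measurable_fun_rVB => //.
have f0 z : (0 <= f z)%E.
  rewrite lee_fin; apply: mulr_ge0; first exact: symb_ge0.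
  by apply: mulr_ge0; [rewrite exprn_ge0// sqrtr_ge0|exact: expR_ge0].
have := @ge0_integral_affine R N f s xi; rewrite gt_eqF// => /(_ isT mf f0).
rewrite gtr0_norm// => E.
have E2 : (\int[leb N]_x f x = (s ^+ N)%:E * \int[leb N]_x f (s *: x + xi)%R)%E.
  by rewrite E muleA -EFinM mulfV ?mul1e// expf_neq0// gt_eqF.
rewrite /Rintegral (_ : (\int[leb N]_z _)%E = \int[leb N]_x f x)%E; last first.
  apply: eq_integral => z _; rewrite ft_gaussN// /f.
  by rewrite (_ : 4 * (s ^+ 2 / 4) = s ^+ 2); last by field.
rewrite E2 (_ : (\int[leb N]_x _)%E =
    \int[leb N]_z (q * (symb mu t (s *: z + xi) * gaussN 1 z))%:E)%E; last first.
  apply: eq_integral => z _; rewrite /f addrK.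
  have -> : dotp (s *: z) (s *: z) / s ^+ 2 = dotp z z.
    by rewrite dotpZl dotpZr; field; rewrite gt_eqF.
  by congr EFin; rewrite /gaussN mul1r mulrCA.
have i1 := integrable_avg s xi t0.
have fin := integrable_fin_num measurableT i1.
have -> : (\int[leb N]_z (q * (symb mu t (s *: z + xi) * gaussN 1 z))%:E =
    q%:E * \int[leb N]_z (symb mu t (s *: z + xi) * gaussN 1 z)%:E)%E.
  exact: (integralZl measurableT i1).
rewrite -(fineK fin) -!EFinM /gauss_avg /gauss_int /= !mulrA; congr (_ * _).
have p0 : 0 < Num.sqrt (pi : R) by rewrite sqrtr_gt0 pi_gt0.
rewrite /q -exprMn -exprVn -exprMn; congr (_ ^+ _).
rewrite sqrtrM ?pi_ge0// sqrtrV ?(ltW c0)// sqrtrM ?sqr_ge0// sqrtr_sqr gtr0_norm//.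
rewrite (_ : (4 : R)^-1 = 2^-1 ^+ 2); last by field.
rewrite sqrtr_sqr ger0_norm// -[X in _ = _ * X * _]sqr_sqrtr ?pi_ge0//.
by field; rewrite !gt_eqF.
Qed.

Lemma measurable_heatk1 t : measurable_fun setT (@heatk R N mu t).
Proof. exact: (measurable_sec1 t (@measurable_heatk R N mu mu0)). Qed.

Lemma measurable_ft_symb (t : R) : 0 < t ->
  measurable_fun setT (ft (symb mu t) : 'rV[R]_N -> R).
Proof.
move=> t0.
have p0 : (2 * pi : R) ^+ N != 0 by rewrite expf_neq0// mulf_neq0// gt_eqF// pi_gt0.
rewrite (_ : (ft _ : 'rV[R]_N -> R) = fun z => (2 * pi) ^+ N * heatk mu t z); last first.
  by apply/funext => z; rewrite /heatk t0 mulrA mulfV ?mul1r.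
by apply: measurable_funM => //; exact: measurable_heatk1.
Qed.

(** Inserting the definition of the kernel and exchanging the integrals leaves the transform of z ->
    cos(z.xi) times a Gaussian. The product of the two cosines is half the sum of the cosines at x -
    xi and x + xi; the means at xi and -xi coincide because the symbol is even. *)
Lemma integral_heatk_gauss (t s : R) xi : 0 < t -> 0 < s ->
  \int[leb N]_z (cos (dotp z xi) * gaussN (s ^+ 2 / 4) z * heatk mu t z) =
  gauss_avg (symb mu t) s xi.
Proof.
move=> t0 s0; have c0 : 0 < s ^+ 2 / 4 by rewrite divr_gt0// exprn_gt0.
set c := s ^+ 2 / 4 in c0 *.
have ig := integrable_cos_gaussN xi c0.
have im := @integrable_symb R N mu mu0 t t0.
have mh : measurable_fun setT (fun w : 'rV[R]_N * 'rV[R]_N => cos (dotp w.2 w.1)).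
  by apply: (measurableT_comp measurable_cos); exact: measurable_fun_dotp.
have h1 (z x : 'rV[R]_N) : `|cos (dotp x z)| <= 1 by exact: norm_cos_le1.
have SW := Rintegral_swap ig im mh h1.
have isw : (leb N).-integrable setT (EFin \o
    (fun z => cos (dotp z xi) * gaussN c z * \int[leb N]_x (cos (dotp x z) * symb mu t x))).
  apply: (le_integrable _ _ _ (integrableZl measurableT
    (\int[leb N]_x symb mu t x) (integrable_gaussN N c0))) => //.
    apply/measurable_EFinP; apply: measurable_funM.
      by apply: measurable_funM; [exact: measurable_cos_dotp|exact: measurable_gaussN].
    exact: measurable_ft_symb.
  move=> z _ /=; rewrite lee_fin.
  rewrite !normrM (ger0_norm (gaussN_ge0 _ _)) -mulrA.
  apply: (@le_trans _ _ (gaussN c z * `|\int[leb N]_x (cos (dotp x z) * symb mu t x)|)).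
    by rewrite ler_piMl ?norm_cos_le1// mulr_ge0// gaussN_ge0.
  rewrite mulrC ler_wpM2r ?gaussN_ge0//.
  apply: (le_trans (le_normr_Rintegral measurableT (integrable_cos_symb mu0 z t0))).
  apply: (@le_trans _ _ (\int[leb N]_x symb mu t x)); last exact: ler_norm.
  apply: le_Rintegral => //.
    by apply: integrable_norm => //; exact: (integrable_cos_symb mu0 z t0).
  move=> x _; rewrite normrM (ger0_norm (symb_ge0 _ _ _)).
  by rewrite ler_piMl ?norm_cos_le1// symb_ge0.
have p0 : (2 * pi : R) ^+ N != 0 by rewrite expf_neq0// mulf_neq0// gt_eqF// pi_gt0.
transitivity ((2 * pi) ^- N * \int[leb N]_z (cos (dotp z xi) * gaussN c z *
    \int[leb N]_x (cos (dotp x z) * symb mu t x))).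
  rewrite -(RintegralZl _ measurableT isw); apply: eq_Rintegral => z _.
  by rewrite /heatk t0 mulrCA.
rewrite SW.
have igg (w : 'rV[R]_N) := integrable_cos_gaussN w c0.
have inner (x : 'rV[R]_N) : \int[leb N]_z (cos (dotp x z) * (cos (dotp z xi) * gaussN c z)) =
    2^-1 * (ft (gaussN c) (x - xi) + ft (gaussN c) (x - (- xi))).
  rewrite -(RintegralD measurableT (igg _) (igg _)).
  have iD := integrableD measurableT (igg (x - xi)) (igg (x - (- xi))).
  rewrite -(RintegralZl _ measurableT iD); apply: eq_Rintegral => z _.
  by rewrite !dotpDr !dotpNr !opprK cosB cosD (dotpC x); field.
have isg (w : 'rV[R]_N) : (leb N).-integrable setT
    (EFin \o (fun x => symb mu t x * ft (gaussN c) (x - w))).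
  apply: (le_integrable _ _ _ (integrableZl measurableT (Num.sqrt (pi / c) ^+ N) im)) => //.
    apply/measurable_EFinP; apply: measurable_funM; first exact: measurable_symb.
    under eq_fun do rewrite ft_gaussN//.
    apply: measurable_funM => //; apply: (measurableT_comp (@measurable_expR R)).
    apply: measurable_funN; apply: measurable_funM => //.
    by apply: measurable_fun_dotp; apply: measurable_fun_rVB.
  move=> x _ /=; rewrite lee_fin ft_gaussN// !normrM (ger0_norm (expR_ge0 _)) mulrC.
  rewrite ler_wpM2r// ler_piMr// expR_le1 oppr_le0 divr_ge0 ?dotp_ge0//.
  by rewrite mulr_ge0// ltW.
transitivity ((2 * pi) ^- N * (2^-1 *
   (\int[leb N]_x (symb mu t x * ft (gaussN c) (x - xi)) +
    \int[leb N]_x (symb mu t x * ft (gaussN c) (x - (- xi)))))).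
  congr (_ * _); rewrite -(RintegralD measurableT (isg _) (isg _)).
  have iD := integrableD measurableT (isg xi) (isg (- xi)).
  rewrite -(RintegralZl _ measurableT iD); apply: eq_Rintegral => x _.
  by rewrite inner; ring.
rewrite !integral_symb_gauss// gauss_avg_symbN.
by field.
Qed.

End fourier_inversion.

(** * Mass, semigroup law, continuity and tail of the kernel *)

Section heat_kernel.
Context {R : realType} {N : nat}.
Variable mu : R.
Hypotheses (mu0 : 0 < mu) (mu1 : mu <= 1).
Implicit Types (x y z xi : 'rV[R]_N).

Let sqrtpi0 : 0 < Num.sqrt (pi : R) ^+ N.
Proof. by rewrite exprn_gt0// sqrtr_gt0 pi_gt0. Qed.

Let fine_gauss1 : fine (\int[leb N]_z (gaussN 1 z)%:E)%E = Num.sqrt (pi : R) ^+ N.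
Proof. by rewrite integral_gaussN// divr1. Qed.

Lemma symb_cvg (t : R) (u : nat -> 'rV[R]_N) xi :
  dotp (u n) (u n) @[n --> \oo] --> dotp xi xi ->
  symb mu t (u n) @[n --> \oo] --> symb mu t xi.
Proof.
move=> ud; rewrite /symb enorm_powR; under eq_fun do rewrite enorm_powR.
apply: (@cvg_comp _ _ _ _ expR); last exact: continuous_expR.
apply: cvgN; apply: cvgM; first exact: cvg_cst.
by apply: powR_cvg => //; [exact: dotp_ge0|move=> n; exact: dotp_ge0].
Qed.

Lemma gauss_avg_cvg (t : R) (s : nat -> R) xi : 0 < t -> s n @[n --> \oo] --> 0 ->
  gauss_avg (symb mu t) (s n) xi @[n --> \oo] --> symb mu t xi.
Proof.
move=> t0 s0.
have [] := @dominated_cvg_real _ _ R (leb N)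
  (fun n z => symb mu t (s n *: z + xi) * gaussN 1 z)
  (fun z => symb mu t xi * gaussN 1 z) (gaussN 1).
- move=> n; apply: measurable_funM; last exact: measurable_gaussN.
  apply: measurable_fun_symb; first exact: measurable_cst.
  by apply: measurable_fun_rVD => //; exact: measurable_fun_rVZ.
- move=> z; apply: cvgM; last exact: cvg_cst.
  apply: symb_cvg.
  rewrite (_ : (fun n => _) = (fun n => s n * (s n * dotp z z + 2 * dotp z xi) + dotp xi xi)).
    rewrite -[X in _ --> X]add0r; apply: cvgD; last exact: cvg_cst.
    rewrite -[X in _ --> X](mul0r (0 * dotp z z + 2 * dotp z xi)); apply: cvgM => //.
    by apply: cvgD; [apply: cvgM => //; exact: cvg_cst|exact: cvg_cst].
  apply/funext => n; rewrite dotpDl !dotpDr !dotpZl !dotpZr (dotpC xi z); ring.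
- exact: integrable_gaussN.
- move=> n z; rewrite normrM (ger0_norm (symb_ge0 _ _ _)) (ger0_norm (gaussN_ge0 _ _)).
  by apply: ler_piMl; [exact: gaussN_ge0|apply: symb_le1; exact: ltW].
move=> _ ii cc.
have E : (\int[leb N]_z (symb mu t xi * gaussN 1 z)%:E =
    (symb mu t xi * Num.sqrt pi ^+ N)%:E)%E.
  transitivity ((symb mu t xi)%:E * \int[leb N]_z (gaussN 1 z)%:E)%E.
    exact: (integralZl measurableT (integrable_gaussN N ltr01)).
  by rewrite integral_gaussN// divr1.
have cc' : (\int[leb N]_z (symb mu t (s n *: z + xi) * gaussN 1 z)%:E @[n --> \oo]
    --> (symb mu t xi * Num.sqrt pi ^+ N)%:E)%E by rewrite -E; exact: cc.
rewrite [X in _ --> X](_ : _ = Num.sqrt pi ^- N * (symb mu t xi * Num.sqrt pi ^+ N)); last first.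
  by rewrite mulrCA mulVf ?mulr1// gt_eqF.
by apply: cvgM; [exact: cvg_cst|exact: (fine_cvg cc')].
Qed.

Lemma gaussN_cvg1 z : gaussN ((2 / n.+1%:R) ^+ 2 / 4 : R) z @[n --> \oo] --> (1 : R).
Proof.
rewrite [X in _ --> X](_ : _ = expR (- ((2 * 0) ^+ 2 / 4 * dotp z z))); last first.
  by rewrite mulr0 expr0n/= !mul0r oppr0 expR0.
apply: (@cvg_comp _ _ _ _ expR); last exact: continuous_expR.
apply: cvgN; apply: cvgM; last exact: cvg_cst.
apply: cvgM; last exact: cvg_cst.
have h : 2 / n.+1%:R @[n --> \oo] --> (2 * 0 : R).
  by apply: cvgM; [exact: cvg_cst|exact: cvg_harmonic].
exact: (cvgM h h).
Qed.

Let s_gt0 n : 0 < 2 / n.+1%:R :> R. Proof. by rewrite divr_gt0. Qed.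

Let s_cvg : 2 / n.+1%:R @[n --> \oo] --> (0 : R).
Proof. by rewrite -(mulr0 2); apply: cvgM; [exact: cvg_cst|exact: cvg_harmonic]. Qed.

Lemma integrable_gaussN_heatk (t s : R) : 0 < t -> 0 < s ->
  (leb N).-integrable setT (EFin \o (fun z => gaussN (s ^+ 2 / 4) z * heatk mu t z)).
Proof.
move=> t0 s0; have c0 : 0 < s ^+ 2 / 4 by rewrite divr_gt0// exprn_gt0.
apply: (le_integrable _ _ _ (integrableZl measurableT
  (heatk mu t (0 : 'rV[R]_N)) (integrable_gaussN N c0))) => //.
  apply/measurable_EFinP; apply: measurable_funM; first exact: measurable_gaussN.
  exact: measurable_heatk1.
move=> z _ /=; rewrite lee_fin !normrM mulrC; apply: ler_wpM2r => //.
rewrite !ger0_norm ?heatk_ge0//; apply: heatk_rdec => //.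
by rewrite /enorm dotp0l sqrtr0 sqrtr_ge0.
Qed.

Lemma integral_heatk_gauss_avg0 (t s : R) : 0 < t -> 0 < s ->
  (\int[leb N]_z (gaussN (s ^+ 2 / 4) z * heatk mu t z)%:E =
   (gauss_avg (symb mu t) s (0 : 'rV[R]_N))%:E)%E.
Proof.
move=> t0 s0; rewrite -(integral_heatk_gauss mu0 _ t0 s0) /Rintegral fineK.
  by apply: eq_integral => z _; rewrite dotpC dotp0l cos0 mul1r.
apply: integrable_fin_num => //.
apply: eq_integrable (integrable_gaussN_heatk t0 s0) => //.
by move=> z _ /=; rewrite dotpC dotp0l cos0 mul1r.
Qed.

(** Integrability of the kernel is not yet known, so the Gaussian cutoffs are removed by monotone
    convergence, which applies because the kernel is nonnegative. The truncated masses are Gaussian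
    means of the symbol at 0 and tend to its value 1 there. *)
Lemma integral_heatk (t : R) : 0 < t -> (\int[leb N]_z (heatk mu t z)%:E = 1)%E.
Proof.
move=> t0.
have H1 : (\int[leb N]_z (gaussN ((2 / n.+1%:R) ^+ 2 / 4) z * heatk mu t z)%:E
    @[n --> \oo] --> \int[leb N]_z (heatk mu t z)%:E)%E.
  rewrite (_ : (\int[leb N]_z (heatk mu t z)%:E)%E = (\int[leb N]_z
     limn (fun n => (gaussN ((2 / n.+1%:R) ^+ 2 / 4) z * heatk mu t z)%:E))%E); last first.
    apply: eq_integral => z _; apply/esym/cvg_lim => //.
    apply: cvg_EFin; first exact: nearW.
    rewrite -[X in _ --> X]mul1r; apply: cvgM; last exact: cvg_cst.
    exact: gaussN_cvg1.
  apply: cvg_monotone_convergence => //.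
  - move=> n; apply/measurable_EFinP; apply: measurable_funM; first exact: measurable_gaussN.
    exact: measurable_heatk1.
  - by move=> n z _; rewrite lee_fin; apply: mulr_ge0; [exact: gaussN_ge0|exact: heatk_ge0].
  - move=> z _ a b ab; rewrite lee_fin; apply: ler_wpM2r; first exact: heatk_ge0.
    rewrite ler_expR lerN2; apply: ler_wpM2r; first exact: dotp_ge0.
    rewrite ler_pM2r// lerXn2r ?nnegrE ?(ltW (s_gt0 _))//.
    by rewrite ler_pM2l// lef_pV2 ?posrE// ler_nat.
have H2 : (\int[leb N]_z (gaussN ((2 / n.+1%:R) ^+ 2 / 4) z * heatk mu t z)%:E
    @[n --> \oo] --> 1)%E.
  under eq_fun do rewrite integral_heatk_gauss_avg0//.
  apply: cvg_EFin; first exact: nearW.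
  have := @gauss_avg_cvg t _ (0 : 'rV[R]_N) t0 s_cvg.
  rewrite (_ : symb mu t (0 : 'rV[R]_N) = 1)//.
  by rewrite /symb enorm_powR dotp0l powR0 ?gt_eqF// mulr0 oppr0 expR0.
exact: (cvg_unique _ H1 H2).
Qed.

Lemma integrable_heatk (t : R) : 0 < t ->
  (leb N).-integrable setT (EFin \o (heatk mu t : 'rV[R]_N -> R)).
Proof.
move=> t0; apply/integrableP; split.
  by apply/measurable_EFinP; exact: measurable_heatk1.
rewrite [X in (X < _)%E](_ : _ = \int[leb N]_z (heatk mu t z)%:E)%E.
  by rewrite integral_heatk// ltry.
by apply: eq_integral => x _ /=; rewrite ger0_norm// heatk_ge0.
Qed.

Lemma ft_heatk (t : R) xi : 0 < t -> ft (heatk mu t) xi = symb mu t xi.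
Proof.
move=> t0.
have [] := @dominated_cvg_real _ _ R (leb N)
  (fun n z => cos (dotp z xi) * gaussN ((2 / n.+1%:R) ^+ 2 / 4) z * heatk mu t z)
  (fun z => cos (dotp z xi) * heatk mu t z) (heatk mu t).
- move=> n; apply: measurable_funM; last exact: measurable_heatk1.
  by apply: measurable_funM; [exact: measurable_cos_dotp|exact: measurable_gaussN].
- move=> z; apply: cvgM; last exact: cvg_cst.
  rewrite -[X in _ --> X]mulr1; apply: cvgM; first exact: cvg_cst.
  exact: gaussN_cvg1.
- exact: integrable_heatk.
- move=> n z; rewrite !normrM (ger0_norm (heatk_ge0 _ _ _ _))//.
  apply: ler_piMl; first exact: heatk_ge0.
  rewrite mulr_ile1// ?norm_cos_le1// ger0_norm ?gaussN_ge0//.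
  by rewrite expR_le1 oppr_le0; apply: mulr_ge0; [rewrite divr_ge0// sqr_ge0|exact: dotp_ge0].
move=> _ ii cc.
have H1 : \int[leb N]_z (cos (dotp z xi) * gaussN ((2 / n.+1%:R) ^+ 2 / 4) z *
    heatk mu t z) @[n --> \oo] --> ft (heatk mu t) xi.
  rewrite /ft /Rintegral; apply: fine_cvg.
  by rewrite fineK//; exact: (integrable_fin_num measurableT ii).
have H2 : \int[leb N]_z (cos (dotp z xi) * gaussN ((2 / n.+1%:R) ^+ 2 / 4) z *
    heatk mu t z) @[n --> \oo] --> symb mu t xi.
  under eq_fun do rewrite integral_heatk_gauss//.
  exact: gauss_avg_cvg.
exact: (cvg_unique _ H1 H2).
Qed.

Lemma integrable_bounded_heatk (t : R) (h : 'rV[R]_N -> R) : 0 < t ->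
  measurable_fun setT h -> (forall z, `|h z| <= 1) ->
  (leb N).-integrable setT (EFin \o (fun z => h z * heatk mu t z)).
Proof.
move=> t0 mh h1; apply: integrable_bounded (integrable_heatk t0) _ mh h1 => z.
exact: heatk_ge0.
Qed.

Lemma integral_sin_heatk (t : R) xi : 0 < t ->
  \int[leb N]_z (sin (dotp z xi) * heatk mu t z) = 0.
Proof.
move=> t0; rewrite /Rintegral (@integral_odd R N (fun z => sin (dotp z xi) * heatk mu t z))//.
  apply: integrable_bounded_heatk => //; first exact: measurable_sin_dotp.
  by move=> z; exact: norm_sin_le1.
by move=> z; rewrite dotpNl sinN heatkN// mulNr.
Qed.

Lemma symbD (t s : R) xi : symb mu (t + s) xi = symb mu t xi * symb mu s xi.
Proof. by rewrite /symb -expRD; congr expR; ring. Qed.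

Lemma integral_cos_heatk (t : R) x xi : 0 < t ->
  \int[leb N]_z (cos (dotp xi (x - z)) * heatk mu t z) = cos (dotp xi x) * symb mu t xi.
Proof.
move=> t0.
have ic : (leb N).-integrable setT (EFin \o (fun z => cos (dotp z xi) * heatk mu t z)).
  apply: integrable_bounded_heatk => //; first exact: measurable_cos_dotp.
  by move=> z; exact: norm_cos_le1.
have is' : (leb N).-integrable setT (EFin \o (fun z => sin (dotp z xi) * heatk mu t z)).
  apply: integrable_bounded_heatk => //; first exact: measurable_sin_dotp.
  by move=> z; exact: norm_sin_le1.
have icZ := integrableZl measurableT (cos (dotp xi x)) ic.
have isZ := integrableZl measurableT (sin (dotp xi x)) is'.
transitivity (\int[leb N]_z (cos (dotp xi x) * (cos (dotp z xi) * heatk mu t z) +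
    sin (dotp xi x) * (sin (dotp z xi) * heatk mu t z))).
  apply: eq_Rintegral => z _; rewrite dotpDr dotpNr cosB (dotpC xi z).
  by rewrite mulrDl -!mulrA.
rewrite (RintegralD measurableT icZ isZ) (RintegralZl _ measurableT ic).
rewrite (RintegralZl _ measurableT is') integral_sin_heatk// mulr0 addr0.
by congr (_ * _); exact: ft_heatk.
Qed.

(** The factor at time t is expanded as a Fourier integral; integrating the other factor against the
    cosine gives [symb mu s] by inversion, and the product of the symbols is the symbol at time t +
    s. *)
Lemma heatk_conv (t s : R) x : 0 < t -> 0 < s ->
  (\int[leb N]_y (heatk mu t (x - y) * heatk mu s y)%:E = (heatk mu (t + s) x)%:E)%E.
Proof.
move=> t0 s0.
have bd y : `|heatk mu t (x - y)| <= heatk mu t (0 : 'rV[R]_N).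
  rewrite ger0_norm ?heatk_ge0//; apply: heatk_rdec => //.
  by rewrite /enorm dotp0l sqrtr0 sqrtr_ge0.
have mt : measurable_fun setT (fun y => heatk mu t (x - y)).
  apply: (measurableT_comp (measurable_heatk1 mu0 t)).
  exact: measurable_fun_rVB.
have ii : (leb N).-integrable setT (EFin \o (fun y => heatk mu t (x - y) * heatk mu s y)).
  apply: (le_integrable _ _ _ (integrableZl measurableT
    (heatk mu t (0 : 'rV[R]_N)) (integrable_heatk s0))) => //.
    apply/measurable_EFinP; apply: measurable_funM => //; exact: measurable_heatk1.
  move=> y _ /=; rewrite lee_fin !normrM; apply: ler_wpM2r => //.
  exact: (le_trans (bd y) (ler_norm _)).
rewrite -(fineK (integrable_fin_num measurableT ii)); congr EFin.
rewrite -/(Rintegral _ _ _).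
have im := @integrable_symb R N mu mu0 t t0.
have mh : measurable_fun setT (fun w : 'rV[R]_N * 'rV[R]_N => cos (dotp w.2 (x - w.1))).
  apply: (measurableT_comp measurable_cos); apply: measurable_fun_dotp => //.
  exact: measurable_fun_rVB.
have h1 (y xi : 'rV[R]_N) : `|cos (dotp xi (x - y))| <= 1 by exact: norm_cos_le1.
have SW := Rintegral_swap (integrable_heatk s0) im mh h1.
have isw : (leb N).-integrable setT (EFin \o
    (fun y => heatk mu s y * \int[leb N]_xi (cos (dotp xi (x - y)) * symb mu t xi))).
  have p0 : (2 * pi : R) ^+ N != 0 by rewrite expf_neq0// mulf_neq0// gt_eqF// pi_gt0.
  apply: eq_integrable (integrableZl measurableT ((2 * pi : R) ^+ N) ii) => //.
  move=> y _ /=; rewrite -EFinM; congr EFin; rewrite {1}/heatk t0 /ft !mulrA.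
  by rewrite mulfV// mul1r mulrC.
transitivity ((2 * pi) ^- N * \int[leb N]_y
    (heatk mu s y * \int[leb N]_xi (cos (dotp xi (x - y)) * symb mu t xi))).
  rewrite -(RintegralZl _ measurableT isw); apply: eq_Rintegral => y _.
  by rewrite {1}/heatk t0 /ft mulrCA mulrC.
rewrite SW /heatk addr_gt0//; congr (_ * _); apply: eq_Rintegral => xi _.
rewrite -/(heatk mu s) integral_cos_heatk// symbD; ring.
Qed.

Lemma heatk_cvg (t : R) (u : nat -> R) x : 0 < t -> u n @[n --> \oo] --> t ->
  heatk mu (u n) x @[n --> \oo] --> heatk mu t x.
Proof.
move=> t0 ut; have t2 : 0 < t / 2 by rewrite divr_gt0.
(* Keeping the times above t/2 makes [symb mu (t / 2)] a common dominating function; the sequence is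
   unchanged for large n. *)
pose v n := Num.max (u n) (t / 2).
have v0 n : 0 < v n by rewrite /v lt_max t2 orbT.
have uv : \forall n \near \oo, u n = v n.
  have : \forall n \near \oo, t / 2 < u n by apply: (cvgr_gt _ ut); lra.
  by apply: filterS => n h; rewrite /v max_l// ltW.
have vt : v n @[n --> \oo] --> t.
  by apply: cvg_trans ut; apply: near_eq_cvg; apply: filterS uv => n ->.
suff H : heatk mu (v n) x @[n --> \oo] --> heatk mu t x.
  apply: cvg_trans H; apply: near_eq_cvg.
  by apply: filterS uv => n ->.
have [] := @dominated_cvg_real _ _ R (leb N)
  (fun n z => cos (dotp z x) * symb mu (v n) z)
  (fun z => cos (dotp z x) * symb mu t z) (symb mu (t / 2)).
- move=> n; apply: measurable_funM; last exact: measurable_symb.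
  exact: measurable_cos_dotp.
- move=> z; apply: cvgM; first exact: cvg_cst.
  apply: (@cvg_comp _ _ _ _ expR); last exact: continuous_expR.
  by apply: cvgN; apply: cvgM => //; exact: cvg_cst.
- exact: integrable_symb.
- move=> n z; rewrite normrM (ger0_norm (symb_ge0 _ _ _)).
  apply: (@le_trans _ _ (symb mu (v n) z)).
    by apply: ler_piMl; [exact: symb_ge0|exact: norm_cos_le1].
  rewrite ler_expR lerN2; apply: ler_wpM2r; first exact: powR_ge0.
  by rewrite /v le_max lexx orbT.
move=> _ ii cc; rewrite /heatk t0.
rewrite (_ : (fun n => _) = (fun n => (2 * pi) ^- N * ft (symb mu (v n)) x)); last first.
  by apply/funext => n; rewrite v0.
apply: cvgM; first exact: cvg_cst.
rewrite /ft /Rintegral; apply: fine_cvg.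
by rewrite fineK//; exact: (integrable_fin_num measurableT ii).
Unshelve. all: by end_near. Qed.

Lemma integrable_pow_gauss :
  (leb N).-integrable setT (EFin \o (fun z => enorm z `^ (2 * mu) * gaussN 1 z)).
Proof.
have c0 : 0 < 1 / 2 :> R by rewrite divr_gt0.
apply: (le_integrable _ _ _ (integrableZl measurableT 3 (integrable_gaussN N c0))) => //.
  apply/measurable_EFinP; apply: measurable_funM; last exact: measurable_gaussN.
  apply: (measurableT_comp (@measurable_powR R (2 * mu))).
  exact: measurable_fun_enorm.
move=> z _ /=; rewrite lee_fin ger0_norm; last first.
  by apply: mulr_ge0; [exact: powR_ge0|exact: gaussN_ge0].
rewrite ger0_norm; last by apply: mulr_ge0; [|exact: gaussN_ge0].
rewrite enorm_powR /gaussN mul1r.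
have d0 := dotp_ge0 z; set d := dotp z z in d0 *.
have -> : - d = - (1 / 2 * d) + - (1 / 2 * d) by field.
rewrite expRD mulrA; apply: ler_wpM2r; first exact: expR_ge0.
rewrite expRN ler_pdivrMr ?expR_gt0//.
have h := expR_ge1Dx (1 / 2 * d).
apply: (@le_trans _ _ (1 + d)); last lra.
have [d1|d1] := leP d 1.
  apply: (@le_trans _ _ 1); last lra.
  have e1 : 1 `^ mu = 1 :> R by rewrite powR1.
  by rewrite -[leRHS]e1; apply: ge0_ler_powR => //; rewrite ?nnegrE// ltW.
apply: (@le_trans _ _ d); last lra.
by apply: ler1_powR => //; exact: ltW.
Qed.

(** The tail is read off from the symbol near the origin: outside of the ball a suitable Gaussian is
    at most 1/2, so the tail is at most twice the integral of (1 - Gaussian) times the kernel. This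
    integral is a Gaussian mean of 1 - symbol, and 1 - exp(-y) <= y bounds it by a moment of order 2
    mu. *)
Lemma heatk_tail : exists2 M : R, 0 <= M & forall t r : R, 0 < t -> 0 < r ->
  (\int[leb N]_(z in ~` eball 0 r) (heatk mu t z)%:E <= (M * t * r^-1 `^ (2 * mu))%:E)%E.
Proof.
pose M1 := \int[leb N]_z (enorm z `^ (2 * mu) * gaussN 1 z).
pose q : R := Num.sqrt pi ^+ N.
exists (2 * q^-1 * 2 `^ (2 * mu) * M1).
  apply: mulr_ge0; last first.
    by apply: Rintegral_ge0 => z _; apply: mulr_ge0; [exact: powR_ge0|exact: gaussN_ge0].
  by apply: mulr_ge0; [rewrite mulr_ge0// invr_ge0 ltW|exact: powR_ge0].
(* With s = 2/r the Gaussian exp(-s^2 |z|^2 / 4) is exp(-|z|^2 / r^2), hence at most 1/e for |z| >=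
   r. *)
move=> t r t0 r0; pose s := 2 / r; have s0 : 0 < s by rewrite divr_gt0.
have mB : measurable (~` eball (0 : 'rV[R]_N) r).
  by apply: measurableC; exact: measurable_eball.
have ih := integrable_heatk t0; have ig := integrable_gaussN_heatk t0 s0.
have iB := integrableB measurableT ih ig.
apply: (@le_trans _ _ (2 * (1 - gauss_avg (symb mu t) s (0 : 'rV[R]_N)))%:E).
  apply: (@le_trans _ _ (\int[leb N]_z (2%:E *
      ((heatk mu t z)%:E - (gaussN (s ^+ 2 / 4) z * heatk mu t z)%:E)))%E); last first.
    rewrite (integralZl measurableT iB) (integralB measurableT ih ig).
    rewrite [X in (_ * (X - _))%E](integral_heatk t0).
    by rewrite [X in (_ * (_ - X))%E](integral_heatk_gauss_avg0 t0 s0) -EFinB -EFinM.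
  have gle z : gaussN (s ^+ 2 / 4) z <= 1.
    by rewrite expR_le1 oppr_le0; apply: mulr_ge0; [rewrite divr_ge0// sqr_ge0|exact: dotp_ge0].
  rewrite integral_mkcond; apply: ge0_le_integral => //.
  - move=> z _; rewrite patchE; case: ifP => // _; rewrite lee_fin; exact: heatk_ge0.
  - apply/(measurable_restrictT _ mB); apply/measurable_funTS.
    by apply/measurable_EFinP; exact: measurable_heatk1.
  - exact: (measurable_int _ (integrableZl measurableT 2 iB)).
  - move=> z _; rewrite patchE -EFinB -EFinM; case: ifPn => [|_]; last first.
      rewrite lee_fin; apply: mulr_ge0 => //.
      rewrite -[X in X - _]mul1r -mulrBl; apply: mulr_ge0; last exact: heatk_ge0.
      by rewrite subr_ge0.
    rewrite inE /eball/= subr0 => /negP; rewrite -leNgt => rz.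
    rewrite lee_fin -[X in X - _]mul1r -mulrBl mulrA; apply: ler_peMl; first exact: heatk_ge0.
    suff : gaussN (s ^+ 2 / 4) z <= 2^-1 by lra.
    apply: (@le_trans _ _ (expR (- 1))).
      rewrite ler_expR lerN2 /s -sqr_enorm.
      rewrite (_ : (2 / r) ^+ 2 / 4 * enorm z ^+ 2 = (enorm z / r) ^+ 2); last first.
        by field; rewrite gt_eqF.
      by rewrite expr_ge1// ?divr_ge0 ?enorm_ge0 ?(ltW r0)// ler_pdivlMr// mul1r.
    rewrite expRN lef_pV2 ?posrE ?expR_gt0//.
    by have := expR_ge1Dx (1 : R); lra.
rewrite lee_fin -!mulrA; apply: ler_wpM2l => //.
have q0 : 0 < q by exact: sqrtpi0.
rewrite ler_pdivlMl//.
have ma z : symb mu t (s *: z + 0) = symb mu t (s *: z) by rewrite addr0.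
have is0 : (leb N).-integrable setT (EFin \o (fun z => symb mu t (s *: z) * gaussN 1 z)).
  apply: integrable_bounded (integrable_gaussN N ltr01) _ _ _.
  - by move=> z; exact: gaussN_ge0.
  - apply: measurable_fun_symb; first exact: measurable_cst.
    exact: measurable_fun_rVZ.
  - move=> z; rewrite ger0_norm ?symb_ge0//; apply: symb_le1; exact: ltW.
have -> : gauss_avg (symb mu t) s (0 : 'rV[R]_N) =
    q^-1 * \int[leb N]_z (symb mu t (s *: z) * gaussN 1 z).
  suff E : gauss_int (symb mu t) s (0 : 'rV[R]_N) =
      (\int[leb N]_z (symb mu t (s *: z) * gaussN 1 z)%:E)%E by rewrite /gauss_avg E.
  by apply: eq_integral => z _; rewrite addr0.
rewrite mulrBr mulr1 (mulrA q) mulfV ?gt_eqF// mul1r.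
have ig1 := integrable_gaussN N (@ltr01 R).
rewrite /q -fine_gauss1 -/(Rintegral _ _ _) -(RintegralB measurableT ig1 is0).
have ip := integrable_pow_gauss.
have -> : 2 `^ (2 * mu) * (M1 * (t * r^-1 `^ (2 * mu))) =
    (t * s `^ (2 * mu)) * M1.
  by rewrite /s powRM ?invr_ge0 ?(ltW r0)//; ring.
rewrite /M1 -(RintegralZl _ measurableT ip); apply: le_Rintegral => //.
- exact: (integrableB measurableT ig1 is0).
- exact: (integrableZl measurableT _ ip).
move=> z _; rewrite -[X in X - _]mul1r -mulrBl mulrA; apply: ler_wpM2r; first exact: gaussN_ge0.
have h := expR_ge1Dx (- (t * enorm (s *: z) `^ (2 * mu))).
move: h; rewrite -/(symb mu t (s *: z)) enormZ gtr0_norm// powRM ?enorm_ge0 ?(ltW s0)//.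
by rewrite mulrA; lra.
Qed.

End heat_kernel.

(** * Convolution in space and time *)

Lemma sigma_finite_product_measure1 d1 d2 (T1 : measurableType d1)
    (T2 : measurableType d2) (R : realType)
    (m1 : {sigma_finite_measure set T1 -> \bar R})
    (m2 : {sigma_finite_measure set T2 -> \bar R}) :
  sigma_finite setT (m1 \x m2)%E.
Proof.
have /sigma_finiteP[F [TF ndF Foo]] := sigma_finiteT m1.
have /sigma_finiteP[G [TG ndG Goo]] := sigma_finiteT m2.
exists (fun n => F n `*` G n).
  rewrite -setXTT TF TG predeqE => -[x y]; split.
    move=> [/= [n _ Fnx] [k _ Gky]]; exists (maxn n k) => //; split => /=.
    - by move: x Fnx; exact/subsetPset/ndF/leq_maxl.
    - by move: y Gky; exact/subsetPset/ndG/leq_maxr.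
  by move=> [n _ []/= ? ?]; split; exists n.
move=> k; have [mF Fk] := Foo k; have [mG Gk] := Goo k; split.
  exact: measurableX.
by rewrite product_measure1E// lte_mul_pinfty// ge0_fin_numE.
Qed.

Definition stleb (R : realType) N :
  set (measurableTypeR R * 'rV[R]_N)%type -> \bar R :=
  (@lebesgue_measure R \x leb N)%E.

HB.instance Definition _ R N :=
  Measure.copy (@stleb R N) (@lebesgue_measure R \x leb N)%E.

HB.instance Definition _ R N := Measure_isSigmaFinite.Build _ _ _ (@stleb R N)
  (sigma_finite_product_measure1 (@lebesgue_measure R) (leb N)).

Section space_time.
Context {R : realType} {N : nat}.
Notation lam := (@lebesgue_measure R).
Notation Q := (measurableTypeR R * 'rV[R]_N)%type.
Notation nu := (@stleb R N).
Implicit Types (p q r : Q) (A B F G : Q -> \bar R) (f g : 'rV[R]_N -> \bar R).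
Local Open Scope ereal_scope.

(** The identities between convolutions are proved for these functions, with values in [0, +oo]:
    Tonelli's theorem then needs no integrability condition. *)
Definition nnm d (T : measurableType d) (F : T -> \bar R) :=
  measurable_fun setT F /\ forall x, 0 <= F x.

Definition qsub q p : Q := (q.1 - p.1, q.2 - p.2)%R.

Lemma qsubK q p : qsub q (qsub q p) = p.
Proof. by case: q p => [a x] [b y]; rewrite /qsub/= !subKr. Qed.

Lemma qsubAC q p r : qsub (qsub q p) r = qsub (qsub q r) p.
Proof. by congr pair; rewrite /= addrAC. Qed.

Lemma measurable_fun_qsub d (T : measurableType d) (f g : T -> Q) :
  measurable_fun setT f -> measurable_fun setT g ->
  measurable_fun setT (fun x => qsub (f x) (g x)).
Proof.
move=> mf mg; apply: measurable_fun_pair.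
  apply: measurable_funB; first exact: (measurableT_comp measurable_fst mf).
  exact: (measurableT_comp measurable_fst mg).
apply: measurable_fun_rVB; first exact: (measurableT_comp measurable_snd mf).
exact: (measurableT_comp measurable_snd mg).
Qed.

Lemma nnm_comp d d' (T : measurableType d) (U : measurableType d') (F : U -> \bar R)
  (h : T -> U) : nnm F -> measurable_fun setT h -> nnm (fun x => F (h x)).
Proof. by move=> [mF F0] mh; split => [|x]; [exact: (measurableT_comp mF mh)|exact: F0]. Qed.

Lemma nnmM d (T : measurableType d) (F G : T -> \bar R) :
  nnm F -> nnm G -> nnm (fun x => F x * G x).
Proof. by move=> [mF F0] [mG G0]; split => [|x]; [exact: emeasurable_funM|exact: mule_ge0]. Qed.

Lemma nnmD d (T : measurableType d) (F G : T -> \bar R) :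
  nnm F -> nnm G -> nnm (fun x => F x + G x).
Proof. by move=> [mF F0] [mG G0]; split => [|x]; [exact: emeasurable_funD|exact: adde_ge0]. Qed.

Lemma nnm_cst d (T : measurableType d) (c : \bar R) : 0 <= c -> nnm (fun _ : T => c).
Proof. by move=> c0; split. Qed.

Lemma nnm_integral d1 d2 (T1 : measurableType d1) (T2 : measurableType d2)
    (m2 : {sigma_finite_measure set T2 -> \bar R}) (h : T1 -> T2 -> \bar R) :
  nnm (fun z : T1 * T2 => h z.1 z.2) -> nnm (fun x => \int[m2]_y h x y).
Proof.
move=> [mh h0]; split => [|x]; last by apply: integral_ge0 => y _; exact: (h0 (x, y)).
by apply: measurable_integral_param => // x y; exact: (h0 (x, y)).
Qed.

Lemma nnm_swap d1 d2 (T1 : measurableType d1) (T2 : measurableType d2)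
    (m1 : {sigma_finite_measure set T1 -> \bar R})
    (m2 : {sigma_finite_measure set T2 -> \bar R}) (h : T1 -> T2 -> \bar R) :
  nnm (fun z : T1 * T2 => h z.1 z.2) ->
  \int[m1]_x \int[m2]_y h x y = \int[m2]_y \int[m1]_x h x y.
Proof. by move=> [mh h0]; apply: ge0_integral_swap => // x y; exact: (h0 (x, y)). Qed.

Lemma nnm_sec1 d1 d2 (T1 : measurableType d1) (T2 : measurableType d2)
    (h : T1 -> T2 -> \bar R) x : nnm (fun z : T1 * T2 => h z.1 z.2) -> nnm (h x).
Proof. by move=> [mh h0]; split => [|y]; [exact: (measurable_sec1 x mh)|exact: (h0 (x, y))]. Qed.

Lemma nnm_integralZl d (T : measurableType d) (m : {measure set T -> \bar R})
  (k : \bar R) (h : T -> \bar R) : 0 <= k -> nnm h ->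
  \int[m]_x (k * h x) = k * \int[m]_x h x.
Proof. by move=> k0 [mh h0]; rewrite ge0_integralZl. Qed.

Lemma nnm_integralZr d (T : measurableType d) (m : {measure set T -> \bar R})
  (k : \bar R) (h : T -> \bar R) : 0 <= k -> nnm h ->
  \int[m]_x (h x * k) = (\int[m]_x h x) * k.
Proof. by move=> k0 [mh h0]; rewrite ge0_integralZr. Qed.

Lemma nnm_integralD d (T : measurableType d) (m : {measure set T -> \bar R})
  (h k : T -> \bar R) : nnm h -> nnm k ->
  \int[m]_x (h x + k x) = \int[m]_x h x + \int[m]_x k x.
Proof. by move=> [mh h0] [mk k0]; rewrite ge0_integralD. Qed.

Lemma nnm_le_integral d (T : measurableType d) (m : {measure set T -> \bar R})
  (h k : T -> \bar R) : nnm h -> nnm k -> (forall x, h x <= k x) ->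
  \int[m]_x h x <= \int[m]_x k x.
Proof. by move=> [mh h0] [mk k0] hk; apply: ge0_le_integral. Qed.

Lemma leb_reflect (x : 'rV[R]_N) f : nnm f ->
  \int[leb N]_y f (x - y)%R = \int[leb N]_y f y.
Proof.
move=> [mf f0]; have := @ge0_integral_affine R N f (-1) x.
rewrite oppr_eq0 oner_eq0 => /(_ isT mf f0).
rewrite normrN1 expr1n invr1 mul1e => <-.
by apply: eq_integral => y _; rewrite scaleN1r addrC.
Qed.

Lemma lam_reflect (x : R) (h : R -> \bar R) : nnm h ->
  \int[lam]_y h (x - y)%R = \int[lam]_y h y.
Proof.
move=> [mf f0]; have := @ge0_integral_affine1 R h (-1) x.
rewrite oppr_eq0 oner_eq0 => /(_ isT mf f0).
rewrite normrN1 invr1 mul1e => <-.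
by apply: eq_integral => y _; rewrite mulN1r addrC.
Qed.

Lemma nu_integral F : nnm F ->
  \int[nu]_p F p = \int[lam]_s \int[leb N]_y F (s, y).
Proof. by move=> [mF F0]; rewrite /stleb fubini_tonelli1. Qed.

Lemma nnm_uncurry F : nnm F -> nnm (fun z : Q => F (z.1, z.2)).
Proof. by move=> [mF F0]; split => [|z] //; under eq_fun do rewrite -surjective_pairing. Qed.

Lemma nu_reflect q F : nnm F -> \int[nu]_p F (qsub q p) = \int[nu]_p F p.
Proof.
move=> hF.
have hq : nnm (fun p => F (qsub q p)).
  by apply: (nnm_comp hF); apply: measurable_fun_qsub.
rewrite (nu_integral hq) (nu_integral hF).
have hF' := nnm_uncurry hF.
transitivity (\int[lam]_s \int[leb N]_y F ((q.1 - s)%R, y)).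
  apply: eq_integral => s _.
  have hs : nnm (fun y => F ((q.1 - s)%R, y)).
    exact: (nnm_sec1 (h := fun s y => F (s, y)) (q.1 - s)%R hF').
  exact: (leb_reflect q.2 hs).
have hi : nnm (fun s => \int[leb N]_y F (s, y)).
  exact: (nnm_integral (leb N) (h := fun s y => F (s, y)) hF').
exact: (lam_reflect q.1 hi).
Qed.

(** [conv] is convolution in space-time, a Duhamel integral when both factors vanish at times <= 0;
    [sconv] is convolution in space only, at the time of [q]. *)
Definition conv A F q := \int[nu]_p (A (qsub q p) * F p).
Definition sconv A f q := \int[leb N]_y (A (q.1, q.2 - y)%R * f y).

Lemma nnm_conv2 A F : nnm A -> nnm F ->
  nnm (fun z : Q * Q => A (qsub z.1 z.2) * F z.2).
Proof.
move=> hA hF; apply: nnmM; apply: nnm_comp => //.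
exact: measurable_fun_qsub.
Qed.

Lemma nnm_conv_in q A F : nnm A -> nnm F -> nnm (fun p => A (qsub q p) * F p).
Proof.
move=> hA hF; apply: nnmM => //; apply: (nnm_comp hA).
exact: measurable_fun_qsub.
Qed.

Lemma nnm_conv A F : nnm A -> nnm F -> nnm (conv A F).
Proof.
move=> hA hF.
change (nnm (fun q => \int[nu]_p (A (qsub q p) * F p))).
exact: (nnm_integral nu (h := fun q p => A (qsub q p) * F p) (nnm_conv2 hA hF)).
Qed.

Lemma nnm_sconv2 A f : nnm A -> nnm f ->
  nnm (fun z : Q * 'rV[R]_N => A (z.1.1, z.1.2 - z.2)%R * f z.2).
Proof.
move=> hA hf; apply: nnmM; apply: nnm_comp => //.
apply: measurable_fun_pair; first exact: (measurableT_comp measurable_fst measurable_fst).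
apply: measurable_fun_rVB => //; exact: (measurableT_comp measurable_snd measurable_fst).
Qed.

Lemma nnm_sconv_in q A f : nnm A -> nnm f ->
  nnm (fun y : 'rV[R]_N => A (q.1, q.2 - y)%R * f y).
Proof.
move=> hA hf; apply: nnmM => //; apply: (nnm_comp hA).
by apply: measurable_fun_pair => //; exact: measurable_fun_rVB.
Qed.

Lemma nnm_sconv A f : nnm A -> nnm f -> nnm (sconv A f).
Proof.
move=> hA hf.
change (nnm (fun q => \int[leb N]_y (A (q.1, q.2 - y)%R * f y))).
exact: (nnm_integral (leb N) (h := fun q y => A (q.1, q.2 - y)%R * f y) (nnm_sconv2 hA hf)).
Qed.

Lemma convC A B q : nnm A -> nnm B -> conv A B q = conv B A q.
Proof.
move=> hA hB; rewrite /conv -[RHS](nu_reflect q).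
  by apply: eq_integral => p _; rewrite qsubK muleC.
exact: (nnm_conv_in q hB hA).
Qed.

Lemma convA A B F q : nnm A -> nnm B -> nnm F ->
  conv A (conv B F) q = conv (conv A B) F q.
Proof.
move=> hA hB hF; rewrite /conv.
have hBF := nnm_conv2 hB hF.
transitivity (\int[nu]_p \int[nu]_r (A (qsub q p) * (B (qsub p r) * F r))).
  apply: eq_integral => p _; rewrite nnm_integralZl//; first exact: hA.2.
  exact: (nnm_conv_in p hB hF).
rewrite nnm_swap; last first.
  apply: nnmM; last exact: hBF.
  by apply: (nnm_comp hA); exact: measurable_fun_qsub.
apply: eq_integral => r _.
transitivity ((\int[nu]_p (A (qsub q p) * B (qsub p r))) * F r).
  rewrite -nnm_integralZr; [|exact: hF.2|]; last first.
    apply: nnmM; first by apply: (nnm_comp hA); exact: measurable_fun_qsub.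
    by apply: (nnm_comp hB); exact: measurable_fun_qsub.
  by apply: eq_integral => p _; rewrite muleA.
congr (_ * _).
rewrite -[LHS](nu_reflect q); last first.
  apply: nnmM; first by apply: (nnm_comp hA); exact: measurable_fun_qsub.
  by apply: (nnm_comp hB); exact: measurable_fun_qsub.
rewrite -[RHS](nu_reflect (qsub q r)); last exact: (nnm_conv_in (qsub q r) hA hB).
apply: eq_integral => p _; by rewrite !qsubK qsubAC.
Qed.

Lemma conv_sconv A B f q : nnm A -> nnm B -> nnm f ->
  conv A (sconv B f) q = sconv (conv A B) f q.
Proof.
move=> hA hB hf; rewrite /conv /sconv.
have hBf := nnm_sconv2 hB hf.
transitivity (\int[nu]_p \int[leb N]_y (A (qsub q p) * (B (p.1, p.2 - y)%R * f y))).
  apply: eq_integral => p _; rewrite nnm_integralZl//; first exact: hA.2.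
  exact: (nnm_sconv_in p hB hf).
rewrite nnm_swap; last first.
  apply: nnmM; last exact: hBf.
  by apply: (nnm_comp hA); exact: measurable_fun_qsub.
apply: eq_integral => y _.
have mB : measurable_fun setT (fun p : Q => (p.1, p.2 - y)%R : Q).
  by apply: measurable_fun_pair => //; exact: measurable_fun_rVB.
transitivity ((\int[nu]_p (A (qsub q p) * B (p.1, p.2 - y)%R)) * f y).
  rewrite -nnm_integralZr; [|exact: hf.2|]; last first.
    apply: nnmM; first by apply: (nnm_comp hA); exact: measurable_fun_qsub.
    exact: (nnm_comp hB).
  by apply: eq_integral => p _; rewrite muleA.
congr (_ * _).
rewrite -[LHS](nu_reflect q); last first.
  apply: nnmM; first by apply: (nnm_comp hA); exact: measurable_fun_qsub.
  exact: (nnm_comp hB).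
rewrite -[RHS](nu_reflect (q.1, q.2 - y)%R); last first.
  exact: (nnm_conv_in (q.1, q.2 - y)%R hA hB).
apply: eq_integral => p _; rewrite !qsubK; congr (_ * B _).
by rewrite /qsub/= [(_ - _ - y)%R]addrAC.
Qed.

Lemma convDl A B F q : nnm A -> nnm B -> nnm F ->
  conv (fun p => A p + B p) F q = conv A F q + conv B F q.
Proof.
move=> hA hB hF; rewrite /conv -nnm_integralD.
- by apply: eq_integral => p _; rewrite ge0_muleDl; [| exact: hA.2|exact: hB.2].
- exact: (nnm_conv_in q hA hF).
- exact: (nnm_conv_in q hB hF).
Qed.

Lemma convDr A F G q : nnm A -> nnm F -> nnm G ->
  conv A (fun p => F p + G p) q = conv A F q + conv A G q.
Proof.
move=> hA hF hG; rewrite /conv -nnm_integralD.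
- by apply: eq_integral => p _; rewrite ge0_muleDr; [| exact: hF.2|exact: hG.2].
- exact: (nnm_conv_in q hA hF).
- exact: (nnm_conv_in q hA hG).
Qed.

Lemma sconvDl A B f q : nnm A -> nnm B -> nnm f ->
  sconv (fun p => A p + B p) f q = sconv A f q + sconv B f q.
Proof.
move=> hA hB hf; rewrite /sconv -nnm_integralD.
- by apply: eq_integral => p _; rewrite ge0_muleDl; [| exact: hA.2|exact: hB.2].
- exact: (nnm_sconv_in q hA hf).
- exact: (nnm_sconv_in q hB hf).
Qed.

Lemma sconvDr A f g q : nnm A -> nnm f -> nnm g ->
  sconv A (fun y => f y + g y) q = sconv A f q + sconv A g q.
Proof.
move=> hA hf hg; rewrite /sconv -nnm_integralD.
- by apply: eq_integral => p _; rewrite ge0_muleDr; [| exact: hf.2|exact: hg.2].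
- exact: (nnm_sconv_in q hA hf).
- exact: (nnm_sconv_in q hA hg).
Qed.

Lemma le_conv A B F G q : nnm A -> nnm B -> nnm F -> nnm G ->
  (forall p, A p <= B p) -> (forall p, F p <= G p) -> conv A F q <= conv B G q.
Proof.
move=> hA hB hF hG AB FG; apply: nnm_le_integral.
- exact: (nnm_conv_in q hA hF).
- exact: (nnm_conv_in q hB hG).
- by move=> p; apply: lee_pmul; [exact: hA.2|exact: hF.2|exact: AB|exact: FG].
Qed.

Lemma le_sconv A B f g q : nnm A -> nnm B -> nnm f -> nnm g ->
  (forall p, A p <= B p) -> (forall y, f y <= g y) -> sconv A f q <= sconv B g q.
Proof.
move=> hA hB hf hg AB fg; apply: nnm_le_integral.
- exact: (nnm_sconv_in q hA hf).
- exact: (nnm_sconv_in q hB hg).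
- by move=> p; apply: lee_pmul; [exact: hA.2|exact: hf.2|exact: AB|exact: fg].
Qed.

End space_time.

(** * Abstract heat kernels and the resolvent identity *)

Section heat_kernel.
Context {R : realType} {N : nat}.
Notation lam := (@lebesgue_measure R).
Notation Q := (measurableTypeR R * 'rV[R]_N)%type.
Notation nu := (@stleb R N).

(** Fourier analysis ends here: apart from the identification of [frac_heat] with a convolution, the
    kernel enters the sequel only through these properties. *)
Record is_heat (K : R -> 'rV[R]_N -> R) : Prop := IsHeat {
  heat_meas : measurable_fun [set: Q] (fun q : Q => K q.1 q.2);
  heat_ge0 : forall t x, 0 <= K t x;
  heat_le0 : forall (t : R) x, t <= 0 -> K t x = 0;
  heat_rdec : forall t x y, enorm x <= enorm y -> K t y <= K t x;
  heat_int1 : forall t : R, 0 < t -> (\int[leb N]_x (K t x)%:E = 1)%E;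
  heat_conv : forall (t s : R) x, 0 < t -> 0 < s ->
    (\int[leb N]_y (K t (x - y) * K s y)%:E = (K (t + s) x)%:E)%E;
  heat_cvg : forall (u : nat -> R) (t : R) x, 0 < t -> u @ \oo --> t ->
    K (u n) x @[n --> \oo] --> K t x;
  heat_tail : exists2 M : R, 0 <= M & exists2 b : R, 0 < b &
    forall t r : R, 0 < t -> 0 < r ->
    (\int[leb N]_(z in ~` eball 0 r) (K t z)%:E <= (M * t * r^-1 `^ b)%:E)%E }.

Context (K : R -> 'rV[R]_N -> R) (hK : is_heat K).
Implicit Types (p q r : Q) (A B F G : Q -> \bar R) (f g : 'rV[R]_N -> \bar R)
  (x y z : 'rV[R]_N) (t s L : R).
Local Open Scope ereal_scope.

Lemma leb_shift x f : nnm f ->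
  \int[leb N]_y f (y + x)%R = \int[leb N]_y f y.
Proof.
move=> [mf f0]; have := @ge0_integral_affine R N f 1 x.
rewrite oner_eq0 => /(_ isT mf f0).
rewrite normr1 expr1n invr1 mul1e => <-.
by apply: eq_integral => y _; rewrite scale1r.
Qed.

Definition dheat L : Q -> \bar R := fun q => (expR (- (L * q.1)) * K q.1 q.2)%:E.

Lemma dheat0E q : dheat 0 q = (K q.1 q.2)%:E.
Proof. by rewrite /dheat mul0r oppr0 expR0 mul1r. Qed.

Lemma nnm_dheat L : nnm (dheat L).
Proof.
split => [|q]; last by rewrite lee_fin mulr_ge0 ?expR_ge0 ?heat_ge0.
apply/measurable_EFinP; apply: measurable_funM; last exact: (heat_meas hK).
apply: (measurableT_comp (@measurable_expR R)).
by apply: measurable_funN; apply: measurable_funM.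
Qed.

Lemma dheat_le0 L t x : (t <= 0)%R -> dheat L (t, x) = 0.
Proof. by move=> t0; rewrite /dheat/= (heat_le0 hK)// mulr0. Qed.

Lemma nnm_dheat_sec L t x : nnm (fun y => dheat L (t, y - x)%R).
Proof.
apply: (nnm_comp (nnm_dheat L)).
by apply: measurable_fun_pair => //; exact: measurable_fun_rVB.
Qed.

Lemma nnm_dheat_refl L t x : nnm (fun y => dheat L (t, x - y)%R).
Proof.
apply: (nnm_comp (nnm_dheat L)).
by apply: measurable_fun_pair => //; exact: measurable_fun_rVB.
Qed.

Lemma dheat_sem0 L t s x : (0 < t)%R -> (0 < s)%R ->
  \int[leb N]_z (dheat L (t, x - z)%R * dheat L (s, z)) = dheat L (t + s, x)%R.
Proof.
move=> t0 s0.
transitivity (\int[leb N]_z ((expR (- (L * (t + s))))%:E *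
                 (K t (x - z) * K s z)%:E)).
  apply: eq_integral => z _; rewrite /dheat/= -!EFinM; congr (_%:E).
  by rewrite mulrDr opprD expRD mulrACA.
rewrite ge0_integralZl ?lee_fin ?expR_ge0//.
- by rewrite (heat_conv hK).
- have h := nnmM (nnm_dheat_refl 0 t x) (nnm_dheat_sec 0 s 0).
  have := h.1; apply: eq_measurable_fun => z _.
  by rewrite !dheat0E /= subr0.
- by move=> z _; rewrite lee_fin mulr_ge0 ?heat_ge0.
Qed.

Lemma dheat_sem L t s x y : (0 < t)%R -> (0 < s)%R ->
  \int[leb N]_z (dheat L (t, x - z)%R * dheat L (s, z - y)%R) = dheat L (t + s, x - y)%R.
Proof.
move=> t0 s0; rewrite -dheat_sem0// -[RHS](leb_shift (- y)%R).
  by apply: eq_integral => z _; rewrite opprB addrA subrK.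
have := nnmM (nnm_dheat_refl L t (x - y)) (nnm_dheat_sec L s 0).
by under eq_fun do rewrite subr0.
Qed.

Lemma sconv_le0 L f t x : (t <= 0)%R -> sconv (dheat L) f (t, x) = 0.
Proof.
move=> t0; rewrite /sconv integral0_eq// => y _.
by rewrite dheat_le0// mul0e.
Qed.

Lemma nnm_row t F : nnm F -> nnm (fun x => F (t, x)).
Proof. by move=> hF; apply: (nnm_comp hF); exact: measurable_fun_pair. Qed.

Lemma sconv_sem L f t s x : nnm f -> (0 < t)%R -> (0 < s)%R ->
  sconv (dheat L) (fun z => sconv (dheat L) f (s, z)) (t, x) = sconv (dheat L) f (t + s, x)%R.
Proof.
move=> hf t0 s0; rewrite /sconv/=.
transitivity (\int[leb N]_z \int[leb N]_y
   (dheat L (t, x - z)%R * (dheat L (s, z - y)%R * f y))).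
  apply: eq_integral => z _; rewrite nnm_integralZl//; first exact: (nnm_dheat L).2.
  exact: (nnm_sconv_in (s, z) (nnm_dheat L) hf).
rewrite nnm_swap; last first.
  apply: nnmM; first by apply: (nnm_comp (nnm_dheat_refl L t x)).
  apply: nnmM; last exact: (nnm_comp hf).
  by apply: (nnm_comp (nnm_dheat L)); apply: measurable_fun_pair => //; exact: measurable_fun_rVB.
apply: eq_integral => y _.
rewrite -(dheat_sem L x y t0 s0) -nnm_integralZr; [|exact: hf.2|].
  by apply: eq_integral => z _; rewrite muleA.
exact: nnmM (nnm_dheat_refl L t x) (nnm_dheat_sec L s y).
Qed.

(** A source that is switched off from time s on contributes at time s only through kernels at
    positive times s - r, and the semigroup law adds t to each of these times. *)
Lemma sconv_conv L F t s x : nnm F -> (forall p, (s <= p.1)%R -> F p = 0) ->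
  (0 < t)%R ->
  sconv (dheat L) (fun z => conv (dheat L) F (s, z)) (t, x) = conv (dheat L) F (t + s, x)%R.
Proof.
move=> hF F0 t0; rewrite /sconv /conv/=.
have mq z : measurable_fun setT (qsub (s, z)) by exact: measurable_fun_qsub.
transitivity (\int[leb N]_z \int[nu]_p
   (dheat L (t, x - z)%R * (dheat L (qsub (s, z) p) * F p))).
  apply: eq_integral => z _; rewrite nnm_integralZl//; first exact: (nnm_dheat L).2.
  exact: (nnm_conv_in (s, z) (nnm_dheat L) hF).
rewrite nnm_swap; last first.
  apply: nnmM; first by apply: (nnm_comp (nnm_dheat_refl L t x)).
  apply: nnmM; last exact: (nnm_comp hF).
  apply: (nnm_comp (nnm_dheat L)); apply: measurable_fun_qsub => //.
  exact: measurable_fun_pair.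
apply: eq_integral => p _.
transitivity (\int[leb N]_z (dheat L (t, x - z)%R * dheat L (s - p.1, z - p.2)%R) * F p).
  rewrite -nnm_integralZr; [|exact: hF.2|].
    by apply: eq_integral => z _; rewrite muleA.
  exact: nnmM (nnm_dheat_refl L t x) (nnm_dheat_sec L (s - p.1) p.2).
have [sp|ps] := leP s p.1; first by rewrite F0// !mule0.
by rewrite dheat_sem ?subr_gt0// addrA.
Qed.

Lemma integral_exp_itv L t : (0 <= t)%R ->
  \int[lam]_(s in `]0%R, t[) (L * expR (- (L * s)))%:E = (1 - expR (- (L * t)))%:E.
Proof.
rewrite le_eqVlt => /predU1P[<-|t0].
  by rewrite set_itvoo0 integral_set0 mulr0 oppr0 expR0 subrr.
pose F s := (- expR (- (L * s)))%R; pose F' s := (L * expR (- (L * s)))%R.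
have dN s : is_derive s 1%R (fun s => expR (- (L * s)))%R (- F' s)%R.
  have h := is_derive_compf (is_derive_expR _) (is_derive_oppf (is_derive_linf L s)).
  by apply: (is_derive_eq h); rewrite /F' mulrN mulrC.
have dF s : is_derive s 1%R F (F' s).
  by apply: (is_derive_eq (is_derive_oppf (dN s))); rewrite opprK.
have cF : continuous F by exact: is_derive_continuous dF.
have cF' : continuous F'.
  by apply: is_derive_continuous.
have mF' : measurable_fun setT (EFin \o F').
  apply/measurable_EFinP; exact: continuous_measurable_fun.
rewrite integral_itv_bndo_bndc; last exact: measurable_funTS.
rewrite integral_itv_obnd_cbnd; last exact: measurable_funTS.
rewrite (@continuous_FTC2 _ F' F)//.
- by rewrite -EFinB /F mulr0 oppr0 expR0 opprK addrC.
- exact: continuous_subspaceT.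
- split.
  + by move=> s _; have [] := dF s.
  + exact/cvg_at_right_filter/cF.
  + exact/cvg_at_left_filter/cF.
- by move=> s _; rewrite derive1E; have [_ ->] := dF s.
Qed.

(** By the semigroup law the convolution is K_t times the integral of L exp(-L s) over (0, t), which
    is 1 - exp(-L t). *)
Lemma dheat_resolvent L q : (0 <= L)%R ->
  dheat L q + conv (dheat 0) (fun p => L%:E * dheat L p) q = dheat 0 q.
Proof.
case: q => t x L0.
have hL : nnm (fun p => L%:E * dheat L p).
  by apply: nnmM; [apply: nnm_cst; rewrite lee_fin|exact: nnm_dheat].
have [t0|t0] := leP t 0%R.
  rewrite !dheat_le0// add0e /conv integral0_eq// => -[s y] _.
  have [s0|s0] := leP s 0%R; first by rewrite (dheat_le0 L)// !mule0.
  by rewrite /qsub/= dheat_le0 ?mul0e// subr_le0 (le_trans t0)// ltW.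
rewrite /conv nu_integral; last exact: nnm_conv_in (nnm_dheat 0) hL.
suff -> : \int[lam]_s \int[leb N]_y (dheat 0 (qsub (t, x) (s, y)) * (L%:E * dheat L (s, y))) =
    (1 - expR (- (L * t)))%:E * dheat 0 (t, x).
  rewrite /dheat/= mul0r oppr0 expR0 mul1r -!EFinM -EFinD; congr (_%:E).
  by rewrite -mulrDl addrC subrK mul1r.
transitivity (\int[lam]_(s in `]0%R, t[) ((L * expR (- (L * s)))%:E * dheat 0 (t, x))).
  rewrite [RHS]integral_mkcond; apply: eq_integral => s _.
  rewrite patchE; case: ifPn => [|].
    rewrite inE/= in_itv/= => /andP[s0 st].
    rewrite -[in RHS](subrK s t) -dheat_sem0 ?subr_gt0//.
    rewrite -nnm_integralZl; last 2 first.
    - by rewrite lee_fin mulr_ge0 ?expR_ge0.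
    - exact: nnmM (nnm_dheat_refl 0 (t - s) x) (nnm_row s (nnm_dheat 0)).
    apply: eq_integral => y _; rewrite /dheat/= -!EFinM; congr (_%:E).
    by rewrite !mul0r oppr0 expR0 !mul1r; ring.
  move=> sN; apply: integral0_eq => y _.
  have [s0|s0] := leP s 0%R; first by rewrite (dheat_le0 L)// !mule0.
  rewrite /qsub/= dheat_le0 ?mul0e// subr_le0 leNgt; apply/negP => st.
  by move: sN; rewrite notin_setE/= in_itv/= s0 st.
rewrite ge0_integralZr//.
- by rewrite integral_exp_itv// ltW.
- apply/measurable_EFinP; apply: measurable_funTS.
  apply: measurable_funM => //; apply: (measurableT_comp (@measurable_expR R)).
  by apply: measurable_funN; apply: measurable_funM.
- by move=> s _; rewrite lee_fin mulr_ge0 ?expR_ge0.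
- by have := (nnm_dheat 0).2 (t, x).
Qed.

End heat_kernel.

(** * The perturbed semigroup on nonnegative functions *)

Section perturbed.
Context {R : realType} {N : nat}.
Notation lam := (@lebesgue_measure R).
Notation Q := (measurableTypeR R * 'rV[R]_N)%type.
Notation nu := (@stleb R N).
Implicit Types (p q r : Q) (A B F G : Q -> \bar R) (f g : 'rV[R]_N -> \bar R)
  (x y z : 'rV[R]_N) (t s : R).
Local Open Scope ereal_scope.

Lemma conv_scale A F k q : nnm A -> nnm F -> 0 <= k ->
  conv A (fun p => k * F p) q = k * conv A F q.
Proof.
move=> hA hF k0; rewrite /conv -nnm_integralZl//; last exact: nnm_conv_in.
by apply: eq_integral => p _; rewrite muleCA.
Qed.

Lemma sconv_scale A f k q : nnm A -> nnm f -> 0 <= k ->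
  sconv A (fun y => k * f y) q = k * sconv A f q.
Proof.
move=> hA hf k0; rewrite /sconv -nnm_integralZl//; last exact: nnm_sconv_in.
by apply: eq_integral => y _; rewrite muleCA.
Qed.

Lemma sconv_scalel A f k q : nnm A -> nnm f -> 0 <= k ->
  sconv (fun p => k * A p) f q = k * sconv A f q.
Proof.
move=> hA hf k0; rewrite /sconv -nnm_integralZl//; last exact: nnm_sconv_in.
by apply: eq_integral => y _; rewrite muleA.
Qed.

Context (K : R -> 'rV[R]_N -> R) (hK : is_heat K).
Context (W : 'rV[R]_N -> R) (L : R) (mW : measurable_fun setT W).
Context (W0 : forall y, (0 <= W y)%R) (WL : forall y, (W y <= L)%R).

Let L0 : (0 <= L)%R. Proof. exact: (le_trans (W0 0) (WL 0)). Qed.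

Definition potW p := (W p.2)%:E.
Definition potC p := (L - W p.2)%:E.

Lemma nnm_potW : nnm potW.
Proof.
split => [|p]; last by rewrite lee_fin.
by apply/measurable_EFinP; exact: (measurableT_comp mW measurable_snd).
Qed.

Lemma nnm_potC : nnm potC.
Proof.
split => [|p]; last by rewrite lee_fin subr_ge0.
apply/measurable_EFinP; apply: measurable_funB => //.
exact: (measurableT_comp mW measurable_snd).
Qed.

(* Picard iteration for the equation u = e^{-Lt} S_t f + \int e^{-L(t-s)} S_{t-s} ((L - W) u(s)) ds,
   all of whose terms are nonnegative *)
Fixpoint picard f n : Q -> \bar R :=
  if n is n'.+1 then
    fun q => sconv (dheat K L) f q + conv (dheat K L) (fun p => potC p * picard f n' p) q
  else fun=> 0.

Definition perturb f q := ereal_sup (range (fun n => picard f n q)).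

Let hL := nnm_dheat hK L.
Let h0 := nnm_dheat hK 0.

Lemma nnm_picard f n : nnm f -> nnm (picard f n).
Proof.
move=> hf; elim: n => [|n IH] /=; first exact: nnm_cst.
apply: nnmD; first exact: nnm_sconv.
by apply: nnm_conv => //; apply: nnmM => //; exact: nnm_potC.
Qed.

Let hCP f n : nnm f -> nnm (fun p => potC p * picard f n p).
Proof. by move=> hf; apply: nnmM; [exact: nnm_potC|exact: nnm_picard]. Qed.

Lemma picard_le f n q : nnm f -> picard f n q <= picard f n.+1 q.
Proof.
move=> hf; elim: n q => [|n IH] q; first exact: (nnm_picard 1 hf).2.
rewrite [leLHS]/= [leRHS]/=; apply: leeD => //.
apply: (le_conv _ hL hL (hCP n hf) (hCP n.+1 hf)) => // p.
by apply: lee_wpmul2l; [exact: nnm_potC.2|exact: IH].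
Qed.

Lemma picard_homo f q : nnm f -> {homo (fun n => picard f n q) : n m / (n <= m)%N >-> n <= m}.
Proof.
move=> hf; apply: homo_leq => //; first by move=> ? ? ?; exact: le_trans.
by move=> n; exact: picard_le.
Qed.

Lemma picard_cvg f q : nnm f -> picard f n q @[n --> \oo] --> perturb f q.
Proof. by move=> hf; apply: ereal_nondecreasing_cvgn; exact: picard_homo. Qed.

Lemma picard_le_perturb f n q : picard f n q <= perturb f q.
Proof. by apply: ereal_sup_ubound; exists n. Qed.

Lemma perturb_le f q c : (forall n, picard f n q <= c) -> perturb f q <= c.
Proof. by move=> h; apply: ge_ereal_sup => _ [n _ <-]. Qed.

Lemma nnm_perturb f : nnm f -> nnm (perturb f).
Proof.
move=> hf; split.
  apply: (emeasurable_fun_cvg (picard f)) => [n|q _]; first exact: (nnm_picard n hf).1.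
  exact: picard_cvg.
by move=> q; apply: (le_trans _ (picard_le_perturb f 0 q)).
Qed.

Let hCU f : nnm f -> nnm (fun p => potC p * perturb f p).
Proof. by move=> hf; apply: nnmM; [exact: nnm_potC|exact: nnm_perturb]. Qed.

Let hWU f : nnm f -> nnm (fun p => potW p * perturb f p).
Proof. by move=> hf; apply: nnmM; [exact: nnm_potW|exact: nnm_perturb]. Qed.

Lemma conv_picard_cvg f q : nnm f ->
  conv (dheat K L) (fun p => potC p * picard f n p) q @[n --> \oo] -->
  conv (dheat K L) (fun p => potC p * perturb f p) q.
Proof.
move=> hf; rewrite /conv.
have c p : dheat K L (qsub q p) * (potC p * picard f n p) @[n --> \oo] -->
    dheat K L (qsub q p) * (potC p * perturb f p).
  by apply: cvgeZl => //; apply: cvgeZl => //; exact: picard_cvg.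
rewrite (_ : (fun p => _) = fun p => limn (fun n => dheat K L (qsub q p) * (potC p * picard f n p))); last first.
  by apply/funext => p; apply/esym/cvg_lim.
apply: (@cvg_monotone_convergence _ _ _ nu setT measurableT
  (fun n p => dheat K L (qsub q p) * (potC p * picard f n p))).
- by move=> n; exact: (nnm_conv_in q hL (hCP n hf)).1.
- by move=> n p _; exact: (nnm_conv_in q hL (hCP n hf)).2.
- move=> p _ n m nm; apply: lee_wpmul2l; first exact: hL.2.
  apply: lee_wpmul2l; first exact: nnm_potC.2.
  exact: picard_homo.
Qed.

Lemma perturb_fix f q : nnm f ->
  perturb f q = sconv (dheat K L) f q + conv (dheat K L) (fun p => potC p * perturb f p) q.
Proof.
move=> hf; have h := picard_cvg (q := q) hf; rewrite -cvg_shiftS in h.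
apply: (cvg_unique _ h) => //=.
apply: cvgeD; [|exact: cvg_cst|exact: conv_picard_cvg].
by rewrite ge0_adde_def// inE; [exact: (nnm_sconv hL hf).2|exact: (nnm_conv hL (hCU hf)).2].
Qed.

(** By the resolvent identity S_t f solves the Picard equation with [L] in place of [L - W]; as L -
    W <= L, it dominates every iterate. *)
Lemma perturb_le_heat f q : nnm f -> perturb f q <= sconv (dheat K 0) f q.
Proof.
move=> hf; apply: perturb_le => n; elim: n q => [|n IH] q /=.
  exact: (nnm_sconv h0 hf).2.
have hLf : nnm (fun p => L%:E * sconv (dheat K 0) f p).
  by apply: nnmM; [exact: nnm_cst|exact: nnm_sconv].
have hLk : nnm (fun p => L%:E * dheat K 0 p) by apply: nnmM => //; exact: nnm_cst.
have hLl : nnm (fun p => L%:E * dheat K L p) by apply: nnmM => //; exact: nnm_cst.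
apply: (@le_trans _ _ (sconv (dheat K L) f q + conv (dheat K L) (fun p => L%:E * sconv (dheat K 0) f p) q)).
  apply: leeD => //; apply: le_conv => //; first exact: hCP.
  move=> p; apply: lee_pmul => //; first exact: nnm_potC.2.
  - exact: (nnm_picard n hf).2.
  - by rewrite lee_fin lerBlDr lerDl.
rewrite le_eqVlt; apply/orP; left; apply/eqP.
have -> : conv (dheat K L) (fun p => L%:E * sconv (dheat K 0) f p) q =
    sconv (conv (dheat K 0) (fun p => L%:E * dheat K L p)) f q.
  rewrite conv_scale//; last exact: nnm_sconv.
  rewrite conv_sconv// -sconv_scalel//; last exact: nnm_conv.
  congr (sconv _ f q); apply/funext => p.
  have L0' : 0 <= L%:E by rewrite lee_fin.
  rewrite (convC p hL h0).
  exact/esym/(conv_scale p h0 hL L0').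
rewrite -sconvDl//; last exact: nnm_conv.
by congr (sconv _ f q); apply/funext => p; rewrite dheat_resolvent.
Qed.

Lemma perturb_le0 f t x : nnm f -> (t <= 0)%R -> perturb f (t, x) = 0.
Proof.
move=> hf t0; apply/eqP; rewrite eq_le (nnm_perturb hf).2 andbT.
by apply: (le_trans (perturb_le_heat _ hf)); rewrite sconv_le0.
Qed.

Lemma sconv_le_cst f a t x : nnm f -> (forall y, f y <= a%:E) -> (0 <= a)%R ->
  sconv (dheat K 0) f (t, x) <= a%:E.
Proof.
move=> hf fa a0; have [t0|t0] := leP t 0%R; first by rewrite sconv_le0.
apply: (@le_trans _ _ (sconv (dheat K 0) (fun=> a%:E) (t, x))).
  by apply: le_sconv => //; exact: nnm_cst.
rewrite /sconv nnm_integralZr//; last exact: nnm_dheat_refl.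
rewrite (@leb_reflect _ _ x (fun y => dheat K 0 (t, y))); last exact: nnm_row.
rewrite (_ : \int[leb N]_y _ = 1) ?mul1e//.
by rewrite -[RHS](heat_int1 hK t0); apply: eq_integral => y _; rewrite dheat0E.
Qed.

Lemma perturb_le_cst f a q : nnm f -> (forall y, f y <= a%:E) -> (0 <= a)%R ->
  perturb f q <= a%:E.
Proof.
by case: q => t x hf fa a0; apply: (le_trans (perturb_le_heat _ hf)); exact: sconv_le_cst.
Qed.

Lemma conv_le_cst F a t x : nnm F -> (forall p, F p <= a%:E) ->
  (forall p, (p.1 <= 0)%R -> F p = 0) -> (0 <= a)%R -> (0 <= t)%R ->
  conv (dheat K 0) F (t, x) <= (t * a)%:E.
Proof.
move=> hF Fa F0 a0 t0.
rewrite /conv nu_integral; last exact: nnm_conv_in.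
have hs s : nnm (fun y => F (s, y)) by exact: nnm_row.
apply: (@le_trans _ _ (\int[lam]_s ((cst a%:E) \_ `]0%R, t[) s)).
  apply: ge0_le_integral => //.
  - by move=> s _; apply: integral_ge0 => y _; exact: (nnm_conv_in (t, x) h0 hF).2.
  - have h := nnm_uncurry (nnm_conv_in (t, x) h0 hF).
    exact: (nnm_integral (leb N) (h := fun s y => dheat K 0 (qsub (t, x) (s, y)) * F (s, y)) h).1.
  - by apply/(measurable_restrictT _ _).1.
  move=> s _; rewrite patchE; case: ifPn => [_|].
    exact: (sconv_le_cst (t - s) x (hs s)).
  move=> sN; rewrite integral0_eq// => y _.
  have [s0|s0] := leP s 0%R; first by rewrite F0// mule0.
  rewrite /qsub/= dheat_le0 ?mul0e// subr_le0 leNgt; apply/negP => st.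
  by move: sN; rewrite notin_setE/= in_itv/= s0 st.
rewrite -integral_mkcond integral_cst//= lebesgue_measure_itv/= lte_fin.
case: ifPn => _; last by rewrite mule0 lee_fin mulr_ge0.
by rewrite oppr0 adde0 -EFinM mulrC.
Qed.

(* Duhamel's formula: add S * (W P), where L P = (L - W) P + W P, to the Picard
   equation and use the resolvent identity; the finite term S * ((L - W) P) cancels *)
Lemma perturb_duhamel f a q : nnm f -> (forall y, f y <= a%:E) -> (0 <= a)%R ->
  perturb f q + conv (dheat K 0) (fun p => potW p * perturb f p) q = sconv (dheat K 0) f q.
Proof.
move=> hf fa a0; have hU := nnm_perturb hf.
have Ua p : perturb f p <= a%:E by exact: perturb_le_cst.
have [t0|t0] := leP q.1 0%R.
  case: q t0 => t x /= t0; rewrite perturb_le0// sconv_le0// add0e.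
  rewrite /conv integral0_eq// => -[s y] _.
  have [s0|s0] := leP s 0%R; first by rewrite perturb_le0// !mule0.
  by rewrite /qsub/= dheat_le0 ?mul0e// subr_le0 (le_trans t0)// ltW.
have hLl : nnm (fun p => L%:E * dheat K L p) by apply: nnmM => //; exact: nnm_cst.
have fin : conv (dheat K 0) (fun p => potC p * perturb f p) q \is a fin_num.
  rewrite ge0_fin_numE; last exact: (nnm_conv h0 (hCU hf)).2.
  apply: le_lt_trans (ltry (q.1 * (L * a))); case: q t0 => t x /= t0.
  apply: conv_le_cst (hCU hf) _ _ (mulr_ge0 L0 a0) (ltW t0) => [p|[s y] /= s0].
    rewrite EFinM; apply: lee_pmul => //; first exact: nnm_potC.2.
      exact: hU.2.
    by rewrite lee_fin lerBlDr lerDl.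
  by rewrite perturb_le0// mule0.
have e1 : conv (dheat K 0) (fun p => L%:E * perturb f p) q =
    conv (dheat K 0) (fun p => potC p * perturb f p) q +
    conv (dheat K 0) (fun p => potW p * perturb f p) q.
  rewrite -convDr//; [|exact: hCU|exact: hWU].
  congr (conv _ _ q); apply/funext => p.
  rewrite -ge0_muleDl; [|exact: nnm_potC.2|exact: nnm_potW.2].
  by rewrite -EFinD subrK.
have e2 : conv (dheat K 0) (fun p => L%:E * perturb f p) q =
    sconv (conv (dheat K 0) (fun p => L%:E * dheat K L p)) f q +
    conv (conv (dheat K 0) (fun p => L%:E * dheat K L p)) (fun p => potC p * perturb f p) q.
  rewrite -conv_sconv// -convA//; last exact: hCU.
  rewrite -convDr//; [|exact: nnm_sconv|by apply: nnm_conv => //; exact: hCU].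
  congr (conv _ _ q); apply/funext => p.
  rewrite sconv_scalel// (_ : conv _ _ p = L%:E * conv (dheat K L) (fun p => potC p * perturb f p) p).
    rewrite -ge0_muleDr; [|exact: (nnm_sconv hL hf).2|exact: (nnm_conv hL (hCU hf)).2].
    by rewrite -perturb_fix.
  rewrite convC//; last exact: hCU.
  by rewrite conv_scale// 1?convC//; exact: hCU.
have e3 : perturb f q + conv (dheat K 0) (fun p => L%:E * perturb f p) q =
    sconv (dheat K 0) f q + conv (dheat K 0) (fun p => potC p * perturb f p) q.
  have hKL : nnm (conv (dheat K 0) (fun p => L%:E * dheat K L p)) by exact: nnm_conv.
  have e4 := perturb_fix q hf.
  rewrite e2 e4 addeACA.
  congr (_ + _).
    apply: etrans (esym (sconvDl q hL hKL hf)) _.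
    by congr (sconv _ f q); apply/funext => p; rewrite dheat_resolvent.
  apply: etrans (esym (convDl q hL hKL (hCU hf))) _.
  by congr (conv _ _ q); apply/funext => p; rewrite dheat_resolvent.
move: e3; rewrite e1 addeCA addeC => e3.
by rewrite -[LHS](addeK _ fin) e3 addeK.
Qed.

End perturbed.

(** * Order properties and the semigroup inequality *)

Section perturbed_semigroup_properties.
Context {R : realType} {N : nat}.
Notation lam := (@lebesgue_measure R).
Notation Q := (measurableTypeR R * 'rV[R]_N)%type.
Notation nu := (@stleb R N).
Implicit Types (p q r : Q) (A B F G : Q -> \bar R) (f g : 'rV[R]_N -> \bar R)
  (x y z : 'rV[R]_N) (t s : R).
Local Open Scope ereal_scope.
Context (K : R -> 'rV[R]_N -> R) (hK : is_heat K).
Context (W : 'rV[R]_N -> R) (L : R) (mW : measurable_fun setT W).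
Context (W0 : forall y, (0 <= W y)%R) (WL : forall y, (W y <= L)%R).
Notation P := (perturb K W L).
Notation pic := (picard K W L).
Notation C := (@potC _ _ W L).

Let hL := nnm_dheat hK L.
Let hC : nnm C := nnm_potC mW WL.
Let hpic f n : nnm f -> nnm (pic f n) := nnm_picard hK mW WL n.
Let hP f : nnm f -> nnm (P f) := @nnm_perturb _ _ _ hK _ _ mW WL f.

Lemma perturb_mono f g q : nnm f -> nnm g -> (forall y, f y <= g y) ->
  P f q <= P g q.
Proof.
move=> hf hg fg; apply: perturb_le => n.
apply: (le_trans _ (picard_le_perturb _ _ _ _ n _)).
elim: n q => [|n IH] q //=; apply: leeD; first exact: le_sconv.
apply: (le_conv _ hL hL (nnmM hC (hpic n hf)) (nnmM hC (hpic n hg))) => // p.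
by apply: lee_wpmul2l; [exact: hC.2|exact: IH].
Qed.

Lemma perturb_subadd f g q : nnm f -> nnm g ->
  P (fun y => f y + g y) q <= P f q + P g q.
Proof.
move=> hf hg; apply: perturb_le => n.
apply: (@le_trans _ _ (pic f n q + pic g n q)); last first.
  by apply: leeD; exact: picard_le_perturb.
have hfn := nnmM hC (hpic n hf); have hgn := nnmM hC (hpic n hg).
elim: n q hfn hgn => [|n IH] q hfn hgn /=; first by rewrite adde0.
have hfn' := nnmM hC (hpic n hf); have hgn' := nnmM hC (hpic n hg).
rewrite (sconvDr q hL hf hg) [leRHS]addeACA; apply: leeD => //.
apply: le_trans (_ : conv (dheat K L) (fun p => C p * pic f n p + C p * pic g n p) q <= _).
  apply: (le_conv _ hL hL) => //.
  - by apply: nnmM => //; apply: hpic; exact: nnmD.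
  - exact: nnmD.
  - move=> p; rewrite -ge0_muleDr; [|exact: (hpic n hf).2|exact: (hpic n hg).2].
    by apply: lee_wpmul2l; [exact: hC.2|exact: IH].
by rewrite (convDr q hL hfn' hgn').
Qed.

Lemma perturb_scale f k q : nnm f -> 0 <= k -> P (fun y => k * f y) q <= k * P f q.
Proof.
move=> hf k0; apply: perturb_le => n.
apply: (@le_trans _ _ (k * pic f n q)); last first.
  by apply: lee_wpmul2l => //; exact: picard_le_perturb.
have hkf : nnm (fun y => k * f y) by apply: nnmM => //; exact: nnm_cst.
elim: n q => [|n IH] q /=; first by rewrite mule0.
have hfn := nnmM hC (hpic n hf).
rewrite ge0_muleDr; [|exact: (nnm_sconv hL hf).2|exact: (nnm_conv hL hfn).2].
apply: leeD; first by rewrite (sconv_scale q hL hf k0).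
rewrite -(conv_scale q hL hfn k0).
apply: (le_conv _ hL hL (nnmM hC (hpic n hkf))) => //.
  by apply: nnmM => //; exact: nnm_cst.
by move=> p; rewrite muleCA; apply: lee_wpmul2l; [exact: hC.2|exact: IH].
Qed.

(** A single time slice is a null set of space-time; this disposes of the instant at which the time
    integral is cut in the semigroup inequality. *)
Lemma conv_null A F q s : nnm A -> nnm F -> (forall p, p.1 != s -> F p = 0) ->
  conv A F q = 0.
Proof.
move=> hA hF F0; rewrite /conv nu_integral; last exact: nnm_conv_in.
transitivity (\int[lam]_(s' in setT) (cst 0 s')); last by rewrite integral0.
apply: ae_eq_integral => //.
- have h := nnm_uncurry (nnm_conv_in q hA hF).
  exact: (nnm_integral (leb N) (h := fun s y => A (qsub q (s, y)) * F (s, y)) h).1.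
- exists [set s]; split; [exact: measurable_set1|exact: lebesgue_measure_set1|].
  move=> s' /= h; apply/eqP/negPn/negP => ss'; apply: h => _.
  by apply: integral0_eq => y _; rewrite F0 ?mule0.
Qed.

Lemma conv_translate A F t s x : nnm A -> nnm F ->
  conv A F (t + s, x)%R = conv A (fun p => F (p.1 + s, p.2)%R) (t, x).
Proof.
move=> hA hF.
have hFs : nnm (fun p => F (p.1 + s, p.2)%R).
  apply: (nnm_comp hF); apply: measurable_fun_pair => //.
  by apply: measurable_funD.
rewrite convC// (convC (t, x) hA hFs) /conv; apply: eq_integral => p _.
by congr (F (_, _) * _); rewrite /= addrAC.
Qed.

Lemma nnm_restrict F (D : set Q) : measurable D -> nnm F -> nnm (F \_ D).
Proof.
move=> mD [mF F0]; split => [|p]; last by rewrite patchE; case: ifPn.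
by apply/(measurable_restrictT _ _).1 => //; exact: measurable_funTS.
Qed.

(* The Picard iterates at time t + s split at time s: the part of the time integral
   before s is S_t^L applied to an iterate at time s, the part after s is, by
   induction, dominated by the Picard equation restarted at time s *)
Lemma perturb_sem f t s x : nnm f -> (0 < t)%R -> (0 < s)%R ->
  P f (t + s, x)%R <= P (fun z => P f (s, z)) (t, x).
Proof.
move=> hf t0 s0; apply: perturb_le => n.
have hg : nnm (fun z => P f (s, z)) by exact: (nnm_row s (hP hf)).
set g := fun z => P f (s, z) in hg *.
elim: n t x t0 => [|n IH] t x t0; first exact: (hP hg).2.
set F := fun p => C p * pic f n p.
have hF : nnm F by exact: nnmM hC (hpic n hf).
have mfst (E : set R) : measurable E -> measurable ((fun p : Q => p.1) @^-1` E).
  by move=> mE; rewrite -[X in measurable X]setTI; exact: measurable_fst.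
set D1 := (fun p : Q => p.1) @^-1` `]-oo, s[%classic.
set D2 := (fun p : Q => p.1) @^-1` [set s].
set D3 := (fun p : Q => p.1) @^-1` `]s, +oo[%classic.
have D1E p : (p \in D1) = (p.1 < s)%R by apply/idP/idP; rewrite inE /D1/= in_itv.
have D2E p : (p \in D2) = (p.1 == s)%R by apply/idP/eqP; rewrite inE.
have D3E p : (p \in D3) = (s < p.1)%R.
  by apply/idP/idP; rewrite inE /D3/= in_itv/= andbT.
have h1 : nnm (F \_ D1) by apply: nnm_restrict => //; exact: mfst.
have h2 : nnm (F \_ D2) by apply: nnm_restrict => //; exact: mfst.
have h3 : nnm (F \_ D3) by apply: nnm_restrict => //; exact: mfst.
have FE : F = (fun p => (F \_ D1) p + ((F \_ D2) p + (F \_ D3) p)).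
  apply/funext => p; rewrite !patchE.
  rewrite D1E D2E D3E.
  by case: ltgtP => _; rewrite ?adde0 ?add0e.
rewrite [leLHS]/= -/F.
rewrite FE (convDr _ hL h1 (nnmD h2 h3)) (convDr _ hL h2 h3).
rewrite (@conv_null _ _ _ s hL h2) ?add0e; last first.
  by move=> p ps; rewrite patchE D2E (negbTE ps).
rewrite -(sconv_conv hK _ _ h1 _ t0); last first.
  by move=> p sp; rewrite patchE D1E ltNge sp.
rewrite -(sconv_sem hK L x hf t0 s0) addeA.
have hs1 : nnm (fun z => sconv (dheat K L) f (s, z)) by exact: (nnm_row s (nnm_sconv hL hf)).
have hs2 : nnm (fun z => conv (dheat K L) (F \_ D1) (s, z)) by exact: (nnm_row s (nnm_conv hL h1)).
rewrite (perturb_fix hK mW WL (t, x) hg); apply: leeD.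
  apply: le_trans (_ : sconv (dheat K L) (fun z => sconv (dheat K L) f (s, z) +
      conv (dheat K L) (F \_ D1) (s, z)) (t, x) <= _).
    by rewrite (sconvDr (t, x) hL hs1 hs2).
  apply: (le_sconv _ hL hL (nnmD hs1 hs2) hg) => // z.
  apply: (le_trans _ (picard_le_perturb _ _ _ _ n.+1 _)) => /=; apply: leeD => //.
  apply: (le_conv _ hL hL h1 hF) => // p.
  by rewrite patchE; case: ifPn => // _; exact: hF.2.
rewrite (conv_translate t s x hL h3); apply: (le_conv _ hL hL) => //.
- apply: (nnm_comp h3); apply: measurable_fun_pair => //; exact: measurable_funD.
- exact: nnmM hC (hP hg).
move=> [r y]; rewrite patchE D3E/=; case: ifPn => [|_]; last first.
  by rewrite mule_ge0//; [exact: hC.2|exact: (hP hg).2].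
rewrite ltrDr => r0.
by apply: lee_wpmul2l; [exact: hC.2|exact: IH].
Qed.

End perturbed_semigroup_properties.

(** * Morrey norms *)

Section morrey_estimates.
Context {R : realType} {N : nat}.
Implicit Types (f : 'rV[R]_N -> R) (x y z w : 'rV[R]_N) (p : \bar R)
  (l A eta beta rho t : R).

Let restrict_powR (f : 'rV[R]_N -> R) (D : set 'rV[R]_N) (r : R) : 0 < r ->
  (fun y => `|(EFin \o (f \_ D)) y| `^ r)%E = ((fun y => (`|f y| `^ r)%:E) \_ D).
Proof.
move=> r0; apply/funext => y /=; rewrite !patchE; case: ifPn => _.
  by [].
by rewrite [`|_|]normr0 powR0 ?gt_eqF.
Qed.

Let measurable_normpow f (r : R) : measurable_fun setT f ->
  measurable_fun setT (fun y => `|f y| `^ r).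
Proof.
move=> mf; apply: (measurableT_comp (@measurable_powR R r)).
exact: measurableT_comp.
Qed.

Lemma Lnorm_fin_le f (r : R) A : 0 < r -> 0 <= A ->
  (Lnorm (leb N) r%:E (EFin \o f) <= A%:E)%E ->
  (\int[leb N]_y (`|f y| `^ r)%:E <= (A `^ r)%:E)%E.
Proof.
move=> r0 A0; rewrite unlock; set I := integral _ _ _ => h.
have I0 : (0 <= I)%E by apply: integral_ge0 => y _; exact: poweR_ge0.
rewrite -(poweRe1 I0) -(mulVf (lt0r_neq0 r0)) poweRrM -poweR_EFin.
apply: (gt0_ler_poweR (ltW r0)) => //; rewrite in_itv/= leey andbT //.
exact: poweR_ge0.
Qed.

(** For finite p = r >= 1, the pointwise bound |f| <= A + A (|f|/A)^r replaces Hoelder's inequality;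
    on a unit ball the Morrey norm controls the integral of |f|^r by A^r, so both terms contribute a
    multiple of A. *)
Lemma morrey_local p l : (1 <= p)%E -> exists2 C : R, 0 <= C &
  forall f A x0, measurable_fun setT f -> 0 < A -> (morrey_norm p l f <= A%:E)%E ->
  (\int[leb N]_(y in eball x0 1) (`|f y|)%:E <= (C * A)%:E)%E.
Proof.
move=> p1; have [vol vol0 volE] := @leb_eball R N.
exists (vol + 1); first by rewrite addr_ge0// ltW.
move=> f A x0 mf A0; have mB := measurable_eball x0 1.
have mnf : measurable_fun (eball x0 1) (fun y => (`|f y|)%:E).
  by apply/measurable_EFinP; apply: measurable_funTS; exact: measurableT_comp.
case: p p1 => [r|_|]// => [|]; last first.
  rewrite /= unlock => h.
  have T0 : (0 < leb N [set: 'rV[R]_N])%E.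
    apply: (@lt_le_trans _ _ (leb N (eball 0 1))).
      by rewrite volE// expr1n mul1r lte_fin.
    by apply: le_measure => //; rewrite inE//; exact: measurable_eball.
  move: h; rewrite T0 => /ess_supP h.
  apply: (@le_trans _ _ (\int[leb N]_(y in eball x0 1) A%:E)%E).
    apply: ae_ge0_le_integral => //; first by move=> y _; rewrite lee_fin ltW.
    by apply: filterS h => y /= h _; exact: h.
  rewrite integral_cst//=.
  rewrite volE// expr1n mul1r -EFinM lee_fin mulrC.
  by rewrite ler_wpM2r ?(ltW A0)// lerDl.
rewrite lee_fin => r1 /= h.
have r0 : 0 < r by exact: lt_le_trans r1.
have {h} : (Lnorm (leb N) r%:E (EFin \o (f \_ (eball x0 1))) <= A%:E)%E.
  apply: le_trans h; apply: ereal_sup_ubound; exists x0, 1; split => //.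
  by rewrite powR1 mul1e.
move=> /(Lnorm_fin_le r0 (ltW A0)) h.
pose k := A / A `^ r.
have k0 : 0 <= k by rewrite divr_ge0 ?powR_ge0// ltW.
have mg : measurable_fun setT (fun y => `|(f \_ (eball x0 1)) y| `^ r).
  apply: measurable_normpow; apply/(measurable_restrictT f mB).
  exact: measurable_funTS.
apply: (@le_trans _ _ (\int[leb N]_(y in eball x0 1)
    (A%:E + k%:E * (`|(f \_ (eball x0 1)) y| `^ r)%:E))%E).
  apply: ge0_le_integral => //.
  - apply: emeasurable_funD => //; apply: emeasurable_funM => //.
    by apply/measurable_EFinP; exact: measurable_funTS.
  move=> y By; rewrite -EFinM -EFinD lee_fin patchE mem_set//.
  have [fA|Af] := leP `|f y| A.
    by rewrite (le_trans fA)// lerDl mulr_ge0 ?powR_ge0.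
  have e : k * `|f y| `^ r = A * (`|f y| / A) `^ r.
    have eV : A^-1 `^ r = (A `^ r)^-1.
      by rewrite -powR_inv1 ?(ltW A0)// -powRrM mulN1r powRN.
    by rewrite powRM ?invr_ge0 ?(ltW A0)// eV /k mulrAC mulrA.
  rewrite e -[leLHS](divfK (lt0r_neq0 A0)) mulrC.
  rewrite ler_wpDl ?(ltW A0)// ler_wpM2l ?(ltW A0)// le1r_powR//.
  by rewrite ler_pdivlMr// mul1r ltW.
rewrite ge0_integralD//; last 3 first.
- by move=> y _; rewrite lee_fin ltW.
- by move=> y _; rewrite mule_ge0// lee_fin ?powR_ge0.
- apply: emeasurable_funM => //.
  by apply/measurable_EFinP; exact: measurable_funTS.
rewrite integral_cst//= volE// expr1n mul1r ge0_integralZl//; last first.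
  by apply/measurable_EFinP; exact: measurable_funTS.
rewrite mulrDl mul1r EFinD mulrC EFinM; apply: leeD => //.
apply: (@le_trans _ _ (k%:E * (A `^ r)%:E)%E); last first.
  by rewrite -EFinM lee_fin /k divfK// gt_eqF// powR_gt0.
apply: lee_wpmul2l => //; apply: le_trans h.
by apply: ge0_subset_integral => //; apply/measurable_EFinP.
Qed.

(** On balls of radius rho >= 1, |f|^r <= eta^(r-1) |f| reduces to the L^1 bound and the power of
    rho is at most 1 because l <= N. On smaller balls the sup bound gives rho^((l-N)/r) rho^(N/r) =
    rho^(l/r) <= 1 because l >= 0. The inequality b^(1/r) <= 1 + b makes the constant independent of
    the exponents. *)
Lemma morrey_norm_le : exists2 c : R, 0 <= c & forall p l f eta beta,
  (1 <= p)%E -> 0 <= l <= N%:R -> measurable_fun setT f -> 0 <= eta -> 0 <= beta ->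
  (forall y, `|f y| <= eta) ->
  (\int[leb N]_y (`|f y|)%:E <= (eta * beta)%:E)%E ->
  (morrey_norm p l f <= (eta * (c + beta))%:E)%E.
Proof.
have [vol vol0 volE] := @leb_eball R N.
exists (1 + vol); first by rewrite addr_ge0// ltW.
move=> p l f eta beta p1 /andP[l0 lN] mf eta0 beta0 fe fb.
case: p p1 => [r|_|]// => [|]; last first.
  rewrite /= unlock; case: ifPn => _; last first.
    by rewrite lee_fin mulr_ge0// addr_ge0// addr_ge0// ltW.
  apply/ess_supP; apply: aeW => y /=; rewrite lee_fin (le_trans (fe y))//.
  by rewrite ler_peMr// -addrA lerDl addr_ge0// ltW.
rewrite lee_fin => r1; have r0 : 0 < r by exact: lt_le_trans r1.
apply: ge_ereal_sup => _ [x0 [rho [rho0 ->]]].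
have mB := measurable_eball x0 rho.
rewrite unlock (restrict_powR _ _ r0) -integral_mkcond.
set I := integral _ _ _.
have I0 : (0 <= I)%E by apply: integral_ge0 => y _; rewrite lee_fin powR_ge0.
have root_le (b : R) : 0 <= b -> b `^ r^-1 <= 1 + b.
  move=> b0; apply: (@le_trans _ _ ((1 + b) `^ r^-1)).
    by apply: ge0_ler_powR; rewrite ?nnegrE ?invr_ge0 ?addr_ge0 ?(ltW r0) ?lerDr.
  by apply: ler1_powR; rewrite ?lerDl// invf_le1.
have bnd (b : R) : 0 <= b -> (I <= (eta `^ r * b)%:E)%E ->
    (I `^ r^-1 <= (eta * b `^ r^-1)%:E)%E.
  move=> b0 h; have -> : eta * b `^ r^-1 = (eta `^ r * b) `^ r^-1.
    by rewrite powRM ?powR_ge0// -powRrM divff ?gt_eqF// powRr1.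
  rewrite -poweR_EFin; apply: gt0_ler_poweR => //; first by rewrite invr_ge0 ltW.
  - by rewrite in_itv/= leey andbT.
  - by rewrite in_itv/= leey andbT lee_fin mulr_ge0 ?powR_ge0.
have mI : measurable_fun (eball x0 rho) (fun y => (`|f y| `^ r)%:E).
  by apply/measurable_EFinP; apply: measurable_funTS; exact: measurable_normpow.
have [rho1|rho1] := leP 1 rho.
  have h : (I <= (eta `^ r * beta)%:E)%E.
    apply: (@le_trans _ _ (\int[leb N]_y ((eta `^ (r - 1))%:E * (`|f y|)%:E))%E).
      apply: (@le_trans _ _ (\int[leb N]_y (`|f y| `^ r)%:E)%E).
        apply: ge0_subset_integral => //.
          by apply/measurable_EFinP; exact: measurable_normpow.
      apply: ge0_le_integral => //.
      - by apply/measurable_EFinP; exact: measurable_normpow.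
      - by apply: emeasurable_funM => //; apply/measurable_EFinP; exact: measurableT_comp.
      move=> y _; rewrite -EFinM lee_fin -mulr_powRB1// mulrC ler_wpM2r//.
      by apply: ge0_ler_powR; rewrite ?nnegrE ?subr_ge0.
    rewrite ge0_integralZl//; last 2 first.
    - by apply/measurable_EFinP; exact: measurableT_comp.
    - by rewrite lee_fin powR_ge0.
    apply: (@le_trans _ _ ((eta `^ (r - 1))%:E * (eta * beta)%:E)%E).
      by apply: lee_wpmul2l => //; rewrite lee_fin powR_ge0.
    by rewrite -EFinM lee_fin mulrA (mulrC _ eta) mulr_powRB1.
  apply: (@le_trans _ _ (1%:E * (eta * beta `^ r^-1)%:E)%E).
    apply: lee_pmul; [by rewrite lee_fin powR_ge0|exact: poweR_ge0| |exact: bnd].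
    rewrite lee_fin -[leRHS](powRr0 rho); apply: ler_powR => //.
    by rewrite pmulr_lle0 ?invr_gt0// subr_le0.
  rewrite mul1e lee_fin ler_wpM2l// (le_trans (root_le _ beta0))//.
  by rewrite addrAC lerDl ltW.
have h : (I <= (eta `^ r * (rho ^+ N * vol))%:E)%E.
  apply: (@le_trans _ _ (\int[leb N]_(y in eball x0 rho) (eta `^ r)%:E)%E).
    apply: ge0_le_integral => //.
    by move=> y _; rewrite lee_fin; apply: ge0_ler_powR; rewrite ?nnegrE ?(ltW r0).
  by rewrite integral_cst//= volE// -EFinM.
apply: (@le_trans _ _ ((rho `^ ((l - N%:R) / r))%:E * (eta * (rho ^+ N * vol) `^ r^-1)%:E)%E).
  apply: lee_wpmul2l; first by rewrite lee_fin powR_ge0.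
  by apply: bnd h; rewrite mulr_ge0 ?exprn_ge0 ?ltW.
rewrite -EFinM lee_fin mulrCA ler_wpM2l//.
rewrite powRM ?exprn_ge0 ?(ltW rho0)// ?(ltW vol0)// mulrA.
rewrite -powR_mulrn ?(ltW rho0)// -powRrM -powRD; last by rewrite (gt_eqF rho0) implybT.
rewrite -mulrDl subrK.
apply: (@le_trans _ _ (1 * (1 + vol))).
  apply: ler_pM; rewrite ?powR_ge0//; last exact/root_le/ltW.
  rewrite -[leRHS](powRr0 rho); apply: ger_powR; first by rewrite rho0 ltW.
  by rewrite divr_ge0// ltW.
by rewrite mul1r lerDl.
Qed.

End morrey_estimates.

(** * Smoothing of Morrey functions by the heat semigroup *)

Section morrey_smoothing.
Context {R : realType} {N : nat}.
Notation Q := (measurableTypeR R * 'rV[R]_N)%type.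
Context (K : R -> 'rV[R]_N -> R) (hK : is_heat K).
Implicit Types (f : 'rV[R]_N -> R) (x y z w : 'rV[R]_N) (p : \bar R) (l A t : R).

Let ind w : R := \1_(eball 0 1) w.

Let indE x y : ind (x - y) = \1_(eball x 1) y.
Proof.
have e : (x - y \in eball 0 1) = (y \in eball x 1).
  by apply/idP/idP; rewrite !inE /eball/= subr0 enorm_distC.
by rewrite /ind !indicE e.
Qed.

Let hind : nnm (fun w => (ind w)%:E).
Proof.
split => [|w]; last by rewrite lee_fin.
by apply/measurable_EFinP; apply: measurable_indic; exact: measurable_eball.
Qed.

(* A radially nonincreasing function is at z bounded by its mean over the part of the
   unit ball around z which is closer to the origin *)
Lemma heat_ball_avg : exists2 c : R, 0 <= c & forall t z, 1 <= enorm z ->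
  ((K t z)%:E <= c%:E * \int[leb N]_w ((ind (z - w)%R)%:E * (K t w)%:E))%E.
Proof.
have [vol vol0 volE] := @leb_eball R N.
pose c := (4^-1 ^+ N * vol)^-1; have V0 : 0 < 4^-1 ^+ N * vol :> R.
  by rewrite mulr_gt0// exprn_gt0.
exists c; first by rewrite invr_ge0 ltW.
move=> t z z1.
have mB (v : 'rV[R]_N) (r : R) : measurable (eball v r) by exact: measurable_eball.
have z0 : 0 < enorm z by exact: lt_le_trans z1.
(* The centre k z lies at distance 1/2 from z towards the origin. The ball of radius 1/4 around it
   is contained in the unit ball around z, and its points have norm less than |z|. *)
pose k : R := 1 - (2 * enorm z)^-1.
have kz : enorm (z - k *: z) = 2^-1.
  rewrite -{1}(scale1r z) -scalerBl /k opprB addrCA subrr addr0 enormZ.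
  by rewrite ger0_norm ?invr_ge0 ?mulr_ge0 ?(ltW z0)// invfM divfK// gt_eqF.
have k0 : 0 <= k.
  rewrite /k subr_ge0 invf_le1 ?mulr_gt0//; lra.
have kz' : enorm (k *: z) = enorm z - 2^-1.
  by rewrite enormZ ger0_norm// /k mulrBl mul1r invfM divfK// gt_eqF.
have hK0 : nnm (fun w => (K t w)%:E).
  by have := nnm_row t (nnm_dheat hK 0); under eq_fun do rewrite dheat0E.
apply: (@le_trans _ _ (c%:E * \int[leb N]_(w in eball (k *: z) 4^-1) (K t z)%:E)%E).
  rewrite integral_cst//= volE// -!EFinM lee_fin /c.
  by rewrite mulrCA mulVf ?mulr1// gt_eqF.
apply: lee_wpmul2l; first by rewrite lee_fin invr_ge0 ltW.
rewrite integral_mkcond; apply: ge0_le_integral => //.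
- by move=> w _; rewrite patchE; case: ifPn => // _; rewrite lee_fin (heat_ge0 hK).
- by apply/(measurable_restrictT _ _).1.
- apply: emeasurable_funM; last exact: hK0.1.
  by apply: (measurableT_comp hind.1); exact: measurable_fun_rVB.
move=> w _; rewrite patchE indE indicE; case: ifPn => [|_]; last first.
  by rewrite mule_ge0// lee_fin// (heat_ge0 hK).
rewrite inE /eball/= => wk.
rewrite mem_set ?mul1e.
  rewrite lee_fin; apply: (heat_rdec hK).
  have := enormD (w - k *: z) (k *: z); rewrite subrK kz'; lra.
rewrite /eball/=; have := enormD (w - k *: z) (k *: z - z).
rewrite addrA subrK (enorm_distC (k *: z)) kz; lra.
Qed.

(** For |x - y| < 1 the kernel is bounded by its value at 0. For the other y it is bounded by its
    own mean over a unit ball; this averaging is moved onto |f|, whose integrals over unit balls are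
    uniformly bounded, and the kernel has mass 1. *)
Lemma morrey_smoothing t p l : 0 < t -> (1 <= p)%E -> exists2 C : R, 0 <= C &
  forall f A x, measurable_fun setT f -> 0 < A -> (morrey_norm p l f <= A%:E)%E ->
  (sconv (dheat K 0) (fun y => (`|f y|)%:E) (t, x) <= (C * A)%:E)%E.
Proof.
move=> t0 p1; have [C C0 loc] := @morrey_local R N p l p1.
have [c c0 avg] := heat_ball_avg.
have K00 := heat_ge0 hK t 0.
exists (K t 0 * C + c * C); first by rewrite addr_ge0// mulr_ge0.
move=> f A x mf A0 fA.
pose g y := (`|f y|)%:E; pose b w := (ind w)%:E.
have hg : nnm g.
  by split => [|y]; [apply/measurable_EFinP; exact: measurableT_comp|rewrite lee_fin].
have hk0 : nnm (fun w => (K t w)%:E).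
  by have := nnm_row t (nnm_dheat hK 0); under eq_fun do rewrite dheat0E.
have J z : (\int[leb N]_y (b (z - y)%R * g y) <= (C * A)%:E)%E.
  have := loc f A z mf A0 fA; rewrite integral_mkcond; apply: le_trans.
  rewrite le_eqVlt; apply/orP; left; apply/eqP; apply: eq_integral => y _.
  by rewrite patchE /b indE indicE; case: ifPn => _; rewrite ?mul1e ?mul0e.
have hb z : nnm (fun y => b (z - y)%R).
  by apply: (nnm_comp hind); exact: measurable_fun_rVB.
pose B w := (\int[leb N]_v (b (w - v)%R * (K t v)%:E))%E.
have hB2 : nnm (fun z : 'rV[R]_N * 'rV[R]_N => (b (z.1 - z.2)%R * (K t z.2)%:E)%E).
  apply: nnmM; last exact: (nnm_comp hk0).
  by apply: (nnm_comp hind); exact: measurable_fun_rVB.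
have hB : nnm B by exact: (nnm_integral (leb N) (h := fun w v => (b (w - v)%R * (K t v)%:E)%E) hB2).
have hBx : nnm (fun y => B (x - y)%R) by apply: (nnm_comp hB); exact: measurable_fun_rVB.
have cE : (0 <= c%:E)%E by rewrite lee_fin.
have KE : (0 <= (K t 0)%:E)%E by rewrite lee_fin.
have h1 : nnm (fun y => (K t 0)%:E * (b (x - y)%R * g y))%E.
  by apply: nnmM; [exact: nnm_cst|exact: nnmM].
have h2 : nnm (fun y => c%:E * (B (x - y)%R * g y))%E.
  by apply: nnmM; [exact: nnm_cst|exact: nnmM].
rewrite /sconv/=.
apply: (@le_trans _ _ (\int[leb N]_y ((K t 0)%:E * (b (x - y)%R * g y) +
                                     c%:E * (B (x - y)%R * g y)))%E).
  apply: nnm_le_integral; [exact: (nnm_sconv_in (t, x) (nnm_dheat hK 0) hg)|exact: nnmD|].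
  move=> y; rewrite dheat0E/= !muleA -ge0_muleDl; last 2 first.
  - by rewrite mule_ge0// ?(hb x).2.
  - by rewrite mule_ge0// ?hBx.2.
  apply: lee_wpmul2r; first exact: hg.2.
  have [xy|xy] := ltP (enorm (x - y)) 1.
    apply: (@le_trans _ _ ((K t 0)%:E * b (x - y)%R)%E); last first.
      by rewrite leeDl// mule_ge0// hBx.2.
    rewrite /b /ind indicE mem_set ?mule1; last by rewrite /eball/= subr0.
    by rewrite lee_fin; apply: (heat_rdec hK); rewrite -[X in enorm X](scale0r 0) enormZ normr0 mul0r enorm_ge0.
  by rewrite (le_trans (avg t _ xy))// leeDr// mule_ge0// (hb x).2.
rewrite nnm_integralD// mulrDl EFinD; apply: leeD.
  rewrite nnm_integralZl//; last exact: nnmM.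
  by rewrite -mulrA EFinM; apply: lee_wpmul2l.
rewrite nnm_integralZl//; last exact: nnmM.
rewrite -mulrA EFinM; apply: lee_wpmul2l => //.
have hvy : nnm (fun z : 'rV[R]_N * 'rV[R]_N => ((K t z.1)%:E * (b (x - z.1 - z.2)%R * g z.2))%E).
  apply: nnmM; first exact: (nnm_comp hk0).
  apply: nnmM; last exact: (nnm_comp hg).
  apply: (nnm_comp hind); apply: measurable_fun_rVB => //.
  exact: measurable_fun_rVB.
(* The averaging over the unit ball passes from the kernel to [g]: the integral over y becomes that
   of [g] over the unit ball around x - v. *)
have -> : (\int[leb N]_y (B (x - y)%R * g y) =
    \int[leb N]_v \int[leb N]_y ((K t v)%:E * (b (x - v - y)%R * g y)))%E.
  rewrite (nnm_swap _ _ (h := fun v y => ((K t v)%:E * (b (x - v - y)%R * g y))%E) hvy).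
  apply: eq_integral => y _; rewrite /B -nnm_integralZr; [|exact: hg.2|].
    by apply: eq_integral => v _; rewrite [(x - y - v)%R]addrAC muleCA muleA.
  by apply: nnmM => //; apply: (nnm_comp hb (h := id)).
apply: (@le_trans _ _ (\int[leb N]_v ((K t v)%:E * (C * A)%:E))%E).
  apply: nnm_le_integral.
  - exact: (nnm_integral (leb N) (h := fun v y => ((K t v)%:E * (b (x - v - y)%R * g y))%E) hvy).
  - apply: nnmM => //; apply: nnm_cst; rewrite lee_fin mulr_ge0//; exact: ltW.
  - move=> v; rewrite nnm_integralZl; [|exact: hk0.2|exact: nnmM].
    by apply: lee_wpmul2l; [exact: hk0.2|exact: J].
rewrite nnm_integralZr//; first by rewrite (heat_int1 hK t0) mul1e.
by rewrite lee_fin mulr_ge0// ltW.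
Qed.

End morrey_smoothing.

(** * Existence of solutions *)

Section perturbed_continuity.
Context {R : realType} {N : nat}.
Notation lam := (@lebesgue_measure R).
Notation Q := (measurableTypeR R * 'rV[R]_N)%type.
Notation nu := (@stleb R N).
Implicit Types (p q : Q) (A B F G : Q -> \bar R) (f g : 'rV[R]_N -> \bar R)
  (x y z : 'rV[R]_N) (t s r : R).
Local Open Scope ereal_scope.
Context (K : R -> 'rV[R]_N -> R) (hK : is_heat K).

Definition kdist t s := \int[leb N]_z (`|K t z - K s z|)%:E.

Let mKpair d (T : measurableType d) (h : T -> R) (k : T -> 'rV[R]_N) :
  measurable_fun setT h -> measurable_fun setT k ->
  measurable_fun setT (fun a => K (h a) (k a)).
Proof.
move=> mh mk.
exact: (measurableT_comp (heat_meas hK) (measurable_fun_pair mh mk)).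
Qed.

Let mK t : measurable_fun setT (K t).
Proof. exact: mKpair. Qed.

Lemma nnm_heat t : nnm (fun z => (K t z)%:E).
Proof. by split => [|z]; [exact/measurable_EFinP|rewrite lee_fin (heat_ge0 hK)]. Qed.

Lemma nnm_kdist1 t s : nnm (fun z => (`|K t z - K s z|)%:E).
Proof.
split => [|z]; last by rewrite lee_fin.
by apply/measurable_EFinP; apply: measurableT_comp => //; exact: measurable_funB.
Qed.

Lemma heat_int_le1 t : \int[leb N]_z (K t z)%:E <= 1.
Proof.
have [t0|t0] := leP t 0%R; last by rewrite (heat_int1 hK t0).
by rewrite integral0_eq ?lee01// => z _; rewrite (heat_le0 hK).
Qed.

Lemma kdist_le2 t s : kdist t s <= 2%:E.
Proof.
apply: (@le_trans _ _ (\int[leb N]_z ((K t z)%:E + (K s z)%:E))).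
  apply: nnm_le_integral; [exact: nnm_kdist1|by apply: nnmD; exact: nnm_heat|].
  move=> z; rewrite -EFinD lee_fin (le_trans (ler_normB _ _))//.
  by rewrite !ger0_norm ?(heat_ge0 hK).
rewrite nnm_integralD; [|exact: nnm_heat|exact: nnm_heat].
by rewrite (_ : 2%:E = 1 + 1)// leeD// heat_int_le1.
Qed.

(** Pointwise continuity of the kernel in time improves to continuity in L^1 because the kernels all
    have mass 1. *)
Lemma kdist_cvg (u : nat -> R) t : (0 < t)%R -> (u n @[n --> \oo] --> t)%classic ->
  (kdist t (u n) @[n --> \oo] --> 0)%classic.
Proof.
move=> t0 ut.
pose m n z := Num.max (K t z - K (u n) z)%R 0%R.
have mm n : measurable_fun setT (m n).
  by apply: measurable_maxr => //; exact: measurable_funB.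
have Kint : (leb N).-integrable setT (EFin \o K t).
  apply/integrableP; split; first exact/measurable_EFinP.
  under eq_integral do rewrite /= ger0_norm ?(heat_ge0 hK)//.
  by rewrite (heat_int1 hK t0) ltry.
have m0 z : (m n z @[n --> \oo] --> 0%R)%classic.
  have h : ((K t z - K (u n) z)%R @[n --> \oo] --> 0%R)%classic.
    rewrite -(subrr (K t z)); apply: cvgB; first exact: cvg_cst.
    exact: (heat_cvg hK).
  apply: (@squeeze_cvgr _ _ _ _ (cst 0%R) (fun n => `|K t z - K (u n) z|)%R).
  - by apply: nearW => n; rewrite /m le_max lexx orbT ge_max ler_norm normr_ge0.
  - exact: cvg_cst.
  - by rewrite -(@normr0 _ R); exact: cvg_norm.
have mlim : (\int[leb N]_z (m n z)%:E @[n --> \oo] --> 0)%classic.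
  have mb n z : (`|m n z| <= K t z)%R.
    rewrite ger0_norm ?le_max ?lexx ?orbT// ge_max (heat_ge0 hK) andbT.
    by rewrite lerBlDr lerDl (heat_ge0 hK).
  have [_ _] := dominated_cvg_real mm m0 Kint mb.
  by rewrite integral0.
have un0 : (\forall n \near \oo, (0 < u n)%R)%classic by exact: (cvgr_gt t ut).
have h0 : (2%:E * \int[leb N]_z (m n z)%:E @[n --> \oo] --> 0)%classic.
  by rewrite -(mule0 2%:E); exact: cvgeZl.
apply: cvg_trans h0; apply: near_eq_cvg; near=> n.
have unn : (0 < u n)%R by near: n.
have h1 : nnm (fun z => (m n z)%:E).
  by split => [|z]; [exact/measurable_EFinP|rewrite lee_fin le_max lexx orbT].
(* Scheffe: |a - b| + a = b + 2 (a - b)^+, and (a - b)^+ is dominated by a *)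
have : kdist t (u n) + 1 = 2%:E * \int[leb N]_z (m n z)%:E + 1.
  rewrite /kdist -{1}(heat_int1 hK t0) -[X in _ = _ + X](heat_int1 hK unn).
  rewrite -nnm_integralD; [|exact: nnm_kdist1|exact: nnm_heat].
  rewrite -nnm_integralZl//.
  rewrite -nnm_integralD; [|by apply: nnmM => //; exact: nnm_cst|exact: nnm_heat].
  apply: eq_integral => z _; rewrite -EFinM -!EFinD; congr (_%:E).
  rewrite /m; case: (leP (K t z - K (u n) z)%R 0%R) => h0.
    by rewrite ler0_norm//; lra.
  by rewrite gtr0_norm//; lra.
by move=> /(congr1 (fun a => a - 1)); rewrite !addeK.
Unshelve. all: by end_near. Qed.

Lemma nnm_kdist_pair t s : nnm (fun r => kdist (t - r)%R (s - r)%R).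
Proof.
apply: (nnm_integral (leb N) (h := fun r z => (`|K (t - r) z - K (s - r) z|)%:E)).
split => [|w]; last by rewrite lee_fin.
apply/measurable_EFinP; apply: measurableT_comp => //.
by apply: measurable_funB; apply: mKpair => //; apply: measurable_funB.
Qed.

Lemma integral_kdist_cvg (u : nat -> R) t (T : R) : (u n @[n --> \oo] --> t)%classic ->
  (\int[lam]_(r in `]0%R, T[) kdist (t - r)%R (u n - r)%R @[n --> \oo] --> 0)%classic.
Proof.
move=> ut.
have [] := @dominated_convergence _ _ R lam `]0%R, T[%classic (measurable_itv _)
  (fun n r => kdist (t - r)%R (u n - r)%R) (cst 0) (cst 2%:E).
- by move=> n; apply: measurable_funTS; exact: (nnm_kdist_pair t (u n)).1.
- exact: measurable_cst.
(* The only exceptional time is r = t: before it the L^1 continuity of the kernel applies, and after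
   it both kernels vanish for large n. *)
- exists [set t]; split; [exact: measurable_set1|exact: lebesgue_measure_set1|].
  move=> r /= h; apply/eqP/negPn/negP => rt; apply: h => _.
  have urt : ((u n - r)%R @[n --> \oo] --> (t - r)%R)%classic by apply: cvgB => //; exact: cvg_cst.
  move: rt; rewrite neq_lt => /orP[rt|tr].
    by apply: kdist_cvg => //; rewrite subr_gt0.
  apply: cvg_near_cst; near=> n.
  have unr : (u n < r)%R by near: n; exact: (cvgr_lt t ut).
  rewrite /kdist integral0_eq// => z _.
  by rewrite !(heat_le0 hK) ?subrr ?normr0// subr_le0 ltW.
- apply/integrableP; split => //.
  under eq_integral do rewrite /= gtr0_norm//.
  rewrite integral_cst//= lebesgue_measure_itv/= lte_fin.
  by case: ifPn => _; rewrite ?mule0 ?ltry// -EFinD -EFinM ltry.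
- apply: aeW => r n _ /=; rewrite gee0_abs ?kdist_le2//.
  exact: (nnm_kdist_pair t (u n)).2.
- by move=> _ _; rewrite integral0.
Unshelve. all: by end_near. Qed.

Lemma nnm_refl (k : 'rV[R]_N -> \bar R) x : nnm k -> nnm (fun y => k (x - y)%R).
Proof. by move=> hk; apply: (nnm_comp hk); exact: measurable_fun_rVB. Qed.

Lemma nnm_refl2 (k : 'rV[R]_N -> \bar R) g : nnm k -> nnm g ->
  nnm (fun z : 'rV[R]_N * 'rV[R]_N => k (z.1 - z.2)%R * g z.2).
Proof.
move=> hk hg; apply: nnmM; last exact: (nnm_comp hg).
by apply: (nnm_comp hk); exact: measurable_fun_rVB.
Qed.

Lemma integral_conv1 (k g : 'rV[R]_N -> \bar R) : nnm k -> nnm g ->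
  \int[leb N]_x \int[leb N]_y (k (x - y)%R * g y) =
  (\int[leb N]_z k z) * \int[leb N]_y g y.
Proof.
move=> hk hg.
have k0 : 0 <= \int[leb N]_z k z by apply: integral_ge0 => z _; exact: hk.2.
rewrite (nnm_swap _ _ (h := fun x y => k (x - y)%R * g y) (nnm_refl2 hk hg)).
rewrite -nnm_integralZl//; apply: eq_integral => y _.
rewrite nnm_integralZr; [|exact: hg.2|]; last first.
  by apply: (nnm_comp hk); exact: measurable_fun_rVB.
by rewrite (leb_shift (- y)%R hk).
Qed.

Lemma conv1_le_cst (k g : 'rV[R]_N -> \bar R) c x : nnm k -> nnm g -> 0 <= c ->
  (forall y, g y <= c) ->
  \int[leb N]_y (k (x - y)%R * g y) <= (\int[leb N]_z k z) * c.
Proof.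
move=> hk hg c0 gc.
rewrite -(leb_reflect x hk) -nnm_integralZr//; last exact: nnm_refl.
apply: nnm_le_integral.
- by apply: nnmM => //; exact: nnm_refl.
- by apply: nnmM; [exact: nnm_refl|exact: nnm_cst].
- by move=> y; apply: lee_wpmul2l; [exact: hk.2|exact: gc].
Qed.

Context (W : 'rV[R]_N -> R) (L : R) (mW : measurable_fun setT W).
Context (W0 : forall y, (0 <= W y)%R) (WL : forall y, (W y <= L)%R).
Notation P := (perturb K W L).

Let L0 : (0 <= L)%R. Proof. exact: le_trans (W0 0) (WL 0). Qed.
Let h0 := nnm_dheat hK 0.
Let hWP f : nnm f -> nnm (fun p => potW W p * P f p).
Proof.
move=> hf; apply: nnmM; first exact: nnm_potW.
exact (nnm_perturb hK mW WL hf).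
Qed.

Lemma integral_perturb_le f t : nnm f ->
  \int[leb N]_x P f (t, x) <= \int[leb N]_y f y.
Proof.
move=> hf; apply: (@le_trans _ _ (\int[leb N]_x sconv (dheat K 0) f (t, x))).
  apply: nnm_le_integral; first exact: (nnm_row t (nnm_perturb hK mW WL hf)).
    exact: (nnm_row t (nnm_sconv h0 hf)).
  by move=> x; exact: (perturb_le_heat hK mW W0 WL).
rewrite /sconv/= (integral_conv1 (nnm_row t h0) hf).
rewrite -[leRHS]mul1e; apply: lee_wpmul2r.
  by apply: integral_ge0 => y _; exact: hf.2.
by under eq_integral do rewrite dheat0E/=; exact: heat_int_le1.
Qed.

(** A bound for |P f(t, x) - P f(s, x)|: Duhamel's formula with each kernel replaced by its
    variation between the two times. The final time T is any time beyond both t and s, which keeps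
    the expression symmetric in them. *)
Definition perturb_var f t s T x :=
  \int[leb N]_y ((`|K t (x - y) - K s (x - y)|)%:E * f y) +
  \int[lam]_(r in `]0%R, T[) \int[leb N]_y
    ((`|K (t - r) (x - y) - K (s - r) (x - y)|)%:E * (potW W (r, y) * P f (r, y))).

(** The factor common to the sup bound and to the L^1 bound of [perturb_var]; together they control
    its Morrey norms. *)
Definition kernel_var t s T :=
  kdist t s + L%:E * \int[lam]_(r in `]0%R, T[) kdist (t - r)%R (s - r)%R.

Let nnm_var2 f t s : nnm f -> nnm (fun w : (R * 'rV[R]_N) * 'rV[R]_N =>
  (`|K (t - w.1.1) (w.1.2 - w.2) - K (s - w.1.1) (w.1.2 - w.2)|)%:E *
  (potW W (w.1.1, w.2) * P f (w.1.1, w.2))).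
Proof.
move=> hf; apply: nnmM.
  split => [|w]; last by rewrite lee_fin.
  have m1 : measurable_fun setT (fun w : (R * 'rV[R]_N) * 'rV[R]_N => w.1.1).
    exact: (measurableT_comp measurable_fst measurable_fst).
  have m2 : measurable_fun setT (fun w : (R * 'rV[R]_N) * 'rV[R]_N => (w.1.2 - w.2)%R).
    apply: measurable_fun_rVB => //.
    exact: (measurableT_comp measurable_snd measurable_fst).
  apply/measurable_EFinP; apply: measurableT_comp => //.
  by apply: measurable_funB; apply: mKpair => //; apply: measurable_funB.
apply: (nnm_comp (hWP hf)); apply: measurable_fun_pair => //.
exact: (measurableT_comp measurable_fst measurable_fst).
Qed.

Let varker t s r x y := (`|K (t - r) (x - y) - K (s - r) (x - y)|)%:E.

Let nnm_var1 f t s : nnm f -> nnm (fun w : R * 'rV[R]_N =>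
  \int[leb N]_y (varker t s w.1 w.2 y * (potW W (w.1, y) * P f (w.1, y)))).
Proof.
move=> hf.
exact: (nnm_integral (leb N) (h := fun w y =>
  varker t s w.1 w.2 y * (potW W (w.1, y) * P f (w.1, y))) (nnm_var2 t s hf)).
Qed.

Let nnm_time (h : R -> \bar R) (T : R) : nnm h -> nnm (h \_ `]0%R, T[).
Proof.
move=> [mh hh0]; split => [|r]; last by rewrite patchE; case: ifPn.
by apply/(measurable_restrictT _ _).1 => //; exact: measurable_funTS.
Qed.

Let hvark t s f x : nnm f -> nnm (fun y => (`|K t (x - y) - K s (x - y)|)%:E * f y).
Proof. by move=> hf; apply: nnmM => //; exact: (nnm_refl x (nnm_kdist1 t s)). Qed.

Lemma nnm_perturb_var f t s T : nnm f -> nnm (perturb_var f t s T).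
Proof.
move=> hf; apply: nnmD.
  exact: (nnm_integral (leb N) (h := fun x y => (`|K t (x - y) - K s (x - y)|)%:E * f y)
    (nnm_refl2 (nnm_kdist1 t s) hf)).
under eq_fun do rewrite integral_mkcond.
apply: (nnm_integral lam (h := fun x r => ((fun r => \int[leb N]_y
    (varker t s r x y * (potW W (r, y) * P f (r, y)))) \_ `]0%R, T[) r)).
split => [|w]; last first.
  rewrite patchE; case: ifPn => // _; apply: integral_ge0 => y _.
  exact: ((nnm_var2 t s hf).2 (w.2, w.1, y)).
rewrite (_ : (fun w => _) = (fun w => (\int[leb N]_y
    (varker t s w.2 w.1 y * (potW W (w.2, y) * P f (w.2, y)))) *
    (\1_(`]0%R, T[) w.2)%:E)); last first.
  apply/funext => w; rewrite patchE indicE; case: ifPn => _; first by rewrite mule1.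
  by rewrite mule0.
apply: emeasurable_funM.
  have h := (nnm_comp (h := fun w : 'rV[R]_N * R => (w.2, w.1)) (nnm_var1 t s hf) _).1.
  by apply: h; exact: measurable_fun_pair.
apply/measurable_EFinP; apply: (measurableT_comp _ measurable_snd).
exact: measurable_indic.
Qed.

Lemma perturb_var_le f a t s T x : nnm f -> (forall y, f y <= a%:E) -> (0 <= a)%R ->
  perturb_var f t s T x <= kernel_var t s T * a%:E.
Proof.
move=> hf fa a0.
have aE : 0 <= a%:E by rewrite lee_fin.
have k0 r : 0 <= kdist (t - r)%R (s - r)%R by exact: (nnm_kdist_pair t s).2.
have i0 : 0 <= \int[lam]_(r in `]0%R, T[) kdist (t - r)%R (s - r)%R.
  by apply: integral_ge0 => r _.
rewrite /kernel_var ge0_muleDl; last 2 first.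
- by apply: integral_ge0 => z _; exact: (nnm_kdist1 t s).2.
- by rewrite mule_ge0.
apply: leeD; first exact: (conv1_le_cst x (nnm_kdist1 t s) hf aE fa).
rewrite muleAC -EFinM -ge0_integralZl//; last 2 first.
- by apply: measurable_funTS; exact: (nnm_kdist_pair t s).1.
- by rewrite lee_fin mulr_ge0.
apply: ge0_le_integral => //.
- by move=> r _; apply: integral_ge0 => y _; exact: ((nnm_var2 t s hf).2 (r, x, y)).
- apply: measurable_funTS.
  have h := (nnm_comp (h := fun r : R => (r, x)) (nnm_var1 t s hf) _).1.
  by apply: h; exact: measurable_fun_pair.
- apply: emeasurable_funM => //.
  by apply: measurable_funTS; exact: (nnm_kdist_pair t s).1.
move=> r _; rewrite muleC.
apply: (conv1_le_cst x (nnm_kdist1 (t - r) (s - r)) (nnm_row r (hWP hf))) => [|y].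
  by rewrite lee_fin mulr_ge0.
rewrite EFinM; apply: lee_pmul => //; first by rewrite lee_fin.
- exact: (nnm_perturb hK mW WL hf).2.
- by rewrite lee_fin.
- exact: (perturb_le_cst hK mW W0 WL).
Qed.

Lemma integral_perturb_var_le f b t s T : nnm f -> \int[leb N]_y f y <= b%:E -> (0 <= b)%R ->
  \int[leb N]_x perturb_var f t s T x <= kernel_var t s T * b%:E.
Proof.
move=> hf fb b0.
have bE : 0 <= b%:E by rewrite lee_fin.
have k0 r : 0 <= kdist (t - r)%R (s - r)%R by exact: (nnm_kdist_pair t s).2.
have i0 : 0 <= \int[lam]_(r in `]0%R, T[) kdist (t - r)%R (s - r)%R.
  by apply: integral_ge0 => r _.
have k1 : 0 <= kdist t s by apply: integral_ge0 => z _; exact: (nnm_kdist1 t s).2.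
rewrite /kernel_var ge0_muleDl//; last by rewrite mule_ge0.
pose G x r := \int[leb N]_y (varker t s r x y * (potW W (r, y) * P f (r, y))).
have hG2 : nnm (fun w : 'rV[R]_N * R => ((G w.1) \_ `]0%R, T[) w.2).
  split => [|w]; last first.
    by rewrite patchE; case: ifPn => // _; apply: integral_ge0 => y _; exact: ((nnm_var2 t s hf).2 (w.2, w.1, y)).
  rewrite (_ : (fun w => _) = (fun w => G w.1 w.2 * (\1_(`]0%R, T[) w.2)%:E)); last first.
    apply/funext => w; rewrite patchE indicE; case: ifPn => _; first by rewrite mule1.
    by rewrite mule0.
  apply: emeasurable_funM.
    have h := (nnm_comp (h := fun w : 'rV[R]_N * R => (w.2, w.1)) (nnm_var1 t s hf) _).1.
    by apply: h; exact: measurable_fun_pair.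
  apply/measurable_EFinP; apply: (measurableT_comp _ measurable_snd).
  exact: measurable_indic.
rewrite /perturb_var.
under eq_integral do rewrite [X in _ + X]integral_mkcond.
rewrite nnm_integralD; last 2 first.
- exact: (nnm_integral (leb N) (h := fun x y => (`|K t (x - y) - K s (x - y)|)%:E * f y)
    (nnm_refl2 (nnm_kdist1 t s) hf)).
- exact: (nnm_integral lam (h := fun x r => ((G x) \_ `]0%R, T[) r) hG2).
apply: leeD.
  rewrite (integral_conv1 (nnm_kdist1 t s) hf); exact: lee_wpmul2l.
have e := nnm_swap (leb N) lam (h := fun x r => ((G x) \_ `]0%R, T[) r) hG2.
rewrite [X in X <= _](_ : _ = \int[lam]_r \int[leb N]_x ((G x) \_ `]0%R, T[) r)//.
rewrite muleAC -EFinM -ge0_integralZl//; last 2 first.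
- by apply: measurable_funTS; exact: (nnm_kdist_pair t s).1.
- by rewrite lee_fin mulr_ge0.
rewrite [leRHS]integral_mkcond; apply: nnm_le_integral.
- apply: (nnm_integral (leb N) (h := fun r x => ((G x) \_ `]0%R, T[) r)).
  have h := (nnm_comp (h := fun w : R * 'rV[R]_N => (w.2, w.1)) hG2 _).
  by apply: h; exact: measurable_fun_pair.
- apply: nnm_time; apply: nnmM; last exact: nnm_kdist_pair.
  by apply: nnm_cst; rewrite lee_fin mulr_ge0.
move=> r; rewrite patchE; case: ifPn => rT; last first.
  by rewrite integral0_eq// => x _; rewrite patchE (negbTE rT).
under eq_integral do rewrite patchE rT.
rewrite /G (integral_conv1 (nnm_kdist1 (t - r) (s - r)) (nnm_row r (hWP hf))) muleC.
apply: lee_wpmul2r; first exact: k0.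
apply: (@le_trans _ _ (\int[leb N]_y (L%:E * P f (r, y)))).
  have hPr := nnm_row r (nnm_perturb hK mW WL hf).
  apply: nnm_le_integral; first exact: (nnm_row r (hWP hf)).
    by apply: nnmM => //; apply: nnm_cst; rewrite lee_fin.
  by move=> y; apply: lee_wpmul2r; [exact: hPr.2|rewrite lee_fin].
rewrite nnm_integralZl; [|by rewrite lee_fin|exact: (nnm_row r (nnm_perturb hK mW WL hf))].
rewrite EFinM; apply: lee_wpmul2l; first by rewrite lee_fin.
exact: (le_trans (integral_perturb_le r hf)).
Qed.

(** By Duhamel's formula P f is S f minus a convolution. From s to t the first term grows by at most
    the first part of [perturb_var] and the convolution drops by at most the second. The subtraction
    is avoided by adding the finite convolution at time t to both sides. *)
Lemma perturb_le_var f a t s T x : nnm f -> (forall y, f y <= a%:E) -> (0 <= a)%R ->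
  (0 < t)%R -> (s <= T)%R ->
  P f (t, x) <= P f (s, x) + perturb_var f t s T x.
Proof.
move=> hf fa a0 t0 sT.
have C0 q : 0 <= conv (dheat K 0) (fun p => potW W p * P f p) q by exact: (nnm_conv h0 (hWP hf)).2.
have Cfin : conv (dheat K 0) (fun p => potW W p * P f p) (t, x) \is a fin_num.
  rewrite ge0_fin_numE//; apply: le_lt_trans (ltry (t * (L * a))).
  apply: (conv_le_cst hK x (hWP hf)) => [p|p p0| |]; [| |exact: mulr_ge0|exact: ltW].
    rewrite EFinM; apply: lee_pmul => //; first by rewrite lee_fin.
    - exact: (nnm_perturb hK mW WL hf).2.
    - by rewrite lee_fin.
    - exact: (perturb_le_cst hK mW W0 WL).
  by case: p p0 => r y /= r0; rewrite (perturb_le0 hK mW W0 WL)// mule0.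
have Dt := perturb_duhamel hK mW W0 WL (t, x) hf fa a0.
have Ds := perturb_duhamel hK mW W0 WL (s, x) hf fa a0.
rewrite -(leeD2rE _ _ Cfin) Dt /perturb_var.
set E1 := \int[leb N]_y ((`|K t (x - y) - K s (x - y)|)%:E * f y).
set E2 := \int[lam]_(r in `]0%R, T[) _.
apply: (@le_trans _ _ (sconv (dheat K 0) f (s, x) + E1)).
  rewrite /E1 /sconv/= -nnm_integralD; [|exact: (nnm_sconv_in (s, x) h0 hf)|exact: hvark].
  apply: nnm_le_integral; first exact: (nnm_sconv_in (t, x) h0 hf).
    by apply: nnmD; [exact: (nnm_sconv_in (s, x) h0 hf)|exact: hvark].
  move=> y; rewrite !dheat0E/= -ge0_muleDl ?lee_fin ?(heat_ge0 hK)//.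
  apply: lee_wpmul2r; first exact: hf.2.
  by rewrite -EFinD lee_fin -lerBlDl ler_norm.
have E10 : 0 <= E1 by apply: integral_ge0 => y _; exact: (hvark t s x hf).2.
have Cs : conv (dheat K 0) (fun p => potW W p * P f p) (s, x) <=
    conv (dheat K 0) (fun p => potW W p * P f p) (t, x) + E2.
  have hin u := nnm_conv_in (u, x) h0 (hWP hf).
  have hiu u : nnm (fun r => \int[leb N]_y (dheat K 0 (qsub (u, x) (r, y)) * (potW W (r, y) * P f (r, y)))).
    exact: (nnm_integral (leb N) (h := fun r y => dheat K 0 (qsub (u, x) (r, y)) *
      (potW W (r, y) * P f (r, y))) (nnm_uncurry (hin u))).
  have hv : nnm (fun r => \int[leb N]_y (varker t s r x y * (potW W (r, y) * P f (r, y)))).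
    have h := (nnm_comp (h := fun r : R => (r, x)) (nnm_var1 t s hf) _).
    by apply: h; exact: measurable_fun_pair.
  rewrite /conv nu_integral// [X in _ <= X + _]nu_integral// /E2 [X in _ + X]integral_mkcond.
  rewrite -nnm_integralD; [|exact: hiu|exact: nnm_time].
  apply: nnm_le_integral; first exact: hiu.
    by apply: nnmD; [exact: hiu|exact: nnm_time].
  move=> r; rewrite patchE; case: ifPn => [rT|rT].
    have hr u : nnm (fun y => dheat K 0 (qsub (u, x) (r, y)) * (potW W (r, y) * P f (r, y))).
      exact: (nnm_row r (hin u)).
    have hvr := hvark (t - r) (s - r) x (nnm_row r (hWP hf)).
    rewrite -nnm_integralD; [|exact: hr|exact: hvr].
    apply: nnm_le_integral; [exact: hr|apply: nnmD; [exact: hr|exact: hvr]|].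
    move=> y; rewrite !dheat0E/= -ge0_muleDl ?lee_fin ?(heat_ge0 hK)//.
    apply: lee_wpmul2r; first exact: (hWP hf).2.
    rewrite -EFinD lee_fin -lerBlDl; apply: le_trans (ler_norm _) _.
    by rewrite distrC.
  rewrite adde0 integral0_eq; first exact: (hiu t).2.
  move=> y _; have [r0|r0] := leP r 0%R.
    by rewrite (perturb_le0 hK mW W0 WL)// !mule0.
  rewrite (dheat_le0 hK) ?mul0e//= subr_le0 (le_trans sT)// leNgt; apply/negP => rT'.
  by move: rT; rewrite notin_setE/= in_itv/= r0 rT'.
have aux (u b c e1 e2 : \bar R) : b <= c + e2 -> u + b + e1 <= u + (e1 + e2) + c.
  move=> h; rewrite -[leLHS]addeA -[leRHS]addeA; apply: leeD2l.
  by rewrite addeC -addeA; apply: leeD2l; rewrite addeC.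
by rewrite -Ds; exact: aux.
Qed.

End perturbed_continuity.

Lemma morrey_norm_ge0 (R : realType) (N : nat) (p : \bar R) (l : R)
  (f : 'rV[R]_N -> R) : (0 <= morrey_norm p l f)%E.
Proof.
case: p => [r| |]; try exact: Lnorm_ge0.
apply: (le_trans _ (ereal_sup_ubound _)); last first.
  by exists 0, 1; split => //; reflexivity.
by rewrite mule_ge0 ?Lnorm_ge0// lee_fin powR_ge0.
Qed.

Lemma perturb_varC (R : realType) (N : nat) (K : R -> 'rV[R]_N -> R) W L f
    (t s T : R) x :
  perturb_var K W L f t s T x = perturb_var K W L f s t T x.
Proof.
have e (u v : R) : (`|u - v|)%:E = (`|v - u|)%:E by rewrite distrC.
have e1 : (fun y => `|K t (x - y) - K s (x - y)|%:E * f y)%E =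
    (fun y => `|K s (x - y) - K t (x - y)|%:E * f y)%E.
  by apply/funext => y; rewrite (e (K t _)).
have e2 : (fun r y => `|K (t - r) (x - y) - K (s - r) (x - y)|%:E) =
    (fun r y => `|K (s - r) (x - y) - K (t - r) (x - y)|%:E).
  by apply/funext => r; apply/funext => y; rewrite (e (K (t - r) _)).
pose I (k : R -> 'rV[R]_N -> \bar R) := (\int[lebesgue_measure]_(r in `]0%R, T[)
   \int[leb N]_y (k r y * (potW W (r, y) * perturb K W L f (r, y))))%E.
rewrite /perturb_var e1 -/(I (fun r y => `|K (t - r) (x - y) - K (s - r) (x - y)|%:E)).
by rewrite e2.
Qed.

(** * Solutions for bounded integrable data *)

Section existence.
Context {R : realType} {N : nat} (mu : R) (mu0 : 0 < mu) (mu1 : mu <= 1).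
Notation lam := (@lebesgue_measure R).
Notation Q := (measurableTypeR R * 'rV[R]_N)%type.
Notation nu := (@stleb R N).
Notation K := (@heatk R N mu).

Lemma is_heat_heatk : is_heat K.
Proof.
split.
- exact: measurable_heatk.
- by move=> t x; exact: heatk_ge0.
- by move=> t x t0; rewrite /heatk ltNge t0.
- by move=> t x y; exact: heatk_rdec.
- by move=> t t0; exact: integral_heatk.
- by move=> t s x t0 s0; exact: heatk_conv.
- by move=> u t x t0; exact: heatk_cvg.
- have [M M0 h] := @heatk_tail R N mu mu0 mu1.
  by exists M => //; exists (2 * mu); [rewrite mulr_gt0|exact: h].
Qed.

Lemma frac_heatE (t : R) (u : 'rV[R]_N -> R) x : 0 < t ->
  frac_heat mu t u x = \int[leb N]_y (K t (x - y) * u y).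
Proof.
move=> t0; rewrite /frac_heat gt_eqF//; apply: eq_Rintegral => y _.
by rewrite frac_heat_kernelE.
Qed.

Let hK := is_heat_heatk.
Let h0 := nnm_dheat hK 0.

Context (V W : 'rV[R]_N -> R) (L : R) (mV : measurable_fun setT V)
  (mW : measurable_fun setT W).
Context (W0 : forall y, 0 <= W y) (WL : forall y, W y <= L)
  (VW : {ae leb N, forall y, V y = - W y}).
Notation P := (perturb K W L).

Let L0 : 0 <= L. Proof. exact: le_trans (W0 0) (WL 0). Qed.

Section solution.
Context (f : 'rV[R]_N -> R) (a b : R) (mf : measurable_fun setT f)
  (f0 : forall y, 0 <= f y) (fa : forall y, f y <= a) (a0 : 0 < a) (b0 : 0 <= b)
  (fb : (\int[leb N]_y (f y)%:E <= b%:E)%E).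

Definition perturb_sol (g : 'rV[R]_N -> R) t x := fine (P (EFin \o g) (t, x)).

Notation U := (perturb_sol f).

Let hf : nnm (EFin \o f).
Proof. by split => [|y]; [exact/measurable_EFinP|rewrite lee_fin]. Qed.

Let hP : nnm (P (EFin \o f)) := nnm_perturb hK mW WL hf.

Let hWP : nnm (fun p => potW W p * P (EFin \o f) p)%E.
Proof. by apply: nnmM => //; exact: nnm_potW. Qed.

Let Pa q : (P (EFin \o f) q <= a%:E)%E.
Proof. by apply: (perturb_le_cst hK mW W0 WL) => //; exact: ltW. Qed.

Let Pfin q : P (EFin \o f) q \is a fin_num.
Proof. by rewrite ge0_fin_numE; [exact: le_lt_trans (Pa q) (ltry a)|exact: hP.2]. Qed.

Lemma perturb_solE t x : (U t x)%:E = P (EFin \o f) (t, x).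
Proof. by rewrite /perturb_sol fineK. Qed.

Let U0 t x : 0 <= U t x.
Proof. by rewrite -lee_fin perturb_solE; exact: hP.2. Qed.

Let Ua t x : U t x <= a.
Proof. by rewrite -lee_fin perturb_solE. Qed.

Let mU t : measurable_fun setT (U t).
Proof.
apply/measurable_EFinP; rewrite (_ : EFin \o U t = fun x => P (EFin \o f) (t, x)).
  exact: (nnm_row t hP).1.
by apply/funext => x /=; rewrite perturb_solE.
Qed.

Lemma kernel_var_cvg (t T : R) (u : nat -> R) : 0 < t -> u n @[n --> \oo] --> t ->
  kernel_var K L t (u n) T @[n --> \oo] --> 0%E.
Proof.
move=> t0 ut; rewrite -(adde0 0%E); apply: cvgeD => //.
  exact: kdist_cvg.
rewrite -(mule0 L%:E); apply: cvgeZl => //.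
exact: integral_kdist_cvg.
Qed.

Lemma kernel_var_ge0 (t s T : R) : (0 <= kernel_var K L t s T)%E.
Proof.
rewrite adde_ge0//; first by apply: integral_ge0 => z _; exact: (nnm_kdist1 hK t s).2.
rewrite mule_ge0 ?lee_fin//; apply: integral_ge0 => r _.
exact: (nnm_kdist_pair hK t s).2.
Qed.

Lemma kernel_var_fin (t s T : R) : kernel_var K L t s T \is a fin_num.
Proof.
rewrite ge0_fin_numE ?kernel_var_ge0// lte_add_pinfty//.
  exact: le_lt_trans (kdist_le2 hK t s) (ltry 2).
rewrite lte_mul_pinfty ?lee_fin//.
apply: (@le_lt_trans _ _ (\int[lam]_(r in `]0%R, T[) 2%:E)%E).
  apply: ge0_le_integral => //.
  - by move=> r _; exact: (nnm_kdist_pair hK t s).2.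
  - by apply: measurable_funTS; exact: (nnm_kdist_pair hK t s).1.
  - by move=> r _; exact: kdist_le2.
rewrite integral_cst//= lebesgue_measure_itv/= lte_fin.
by case: ifPn => _; rewrite ?mule0 ?ltry// -EFinD -EFinM ltry.
Qed.

Lemma perturb_sol_dist (t s T : R) x : 0 < t -> 0 < s -> t <= T -> s <= T ->
  ((`|U t x - U s x|)%:E <= perturb_var K W L (EFin \o f) t s T x)%E.
Proof.
move=> t0 s0 tT sT.
have h t' s' : 0 < t' -> s' <= T ->
    ((U t' x - U s' x)%:E <= perturb_var K W L (EFin \o f) t' s' T x)%E.
  move=> t'0 s'T; rewrite EFinB leeBlDl// !perturb_solE.
  exact: (perturb_le_var hK mW W0 WL x hf fa (ltW a0) t'0 s'T).
have [ts|st] := leP 0 (U t x - U s x); first by rewrite ger0_norm// h.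
by rewrite ltr0_norm// opprB perturb_varC h.
Qed.

Lemma perturb_sol_heat (t : R) x : 0 < t ->
  U t x = frac_heat mu t f x - fine (conv (dheat K 0) (fun p => potW W p * P (EFin \o f) p)%E (t, x)).
Proof.
move=> t0.
have D := perturb_duhamel hK mW W0 WL (t, x) hf fa (ltW a0).
have S : (sconv (dheat K 0) (EFin \o f) (t, x)) = (\int[leb N]_y (K t (x - y) * f y)%:E)%E.
  by apply: eq_integral => y _; rewrite dheat0E.
have Sfin : sconv (dheat K 0) (EFin \o f) (t, x) \is a fin_num.
  rewrite ge0_fin_numE; last exact: (nnm_sconv h0 hf).2.
  by apply: le_lt_trans (ltry a); apply: (sconv_le_cst hK t x hf fa (ltW a0)).
have Cfin : conv (dheat K 0) (fun p => potW W p * P (EFin \o f) p)%E (t, x) \is a fin_num.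
  by move: Sfin; rewrite -D fin_numD => /andP[].
rewrite frac_heatE// /Rintegral -S -D fineD// addrK.
by [].
Qed.

Let G t x s := (\int[leb N]_y (dheat K 0 (qsub (t, x) (s, y)) * (potW W (s, y) * P (EFin \o f) (s, y))))%E.

Let hG t x : nnm (G t x).
Proof.
exact: (nnm_integral (leb N) (h := fun s y => dheat K 0 (qsub (t, x) (s, y)) *
  (potW W (s, y) * P (EFin \o f) (s, y)))%E (nnm_uncurry (nnm_conv_in (t, x) h0 hWP))).
Qed.

Let GLa t x s : (G t x s <= (L * a)%:E)%E.
Proof.
apply: (sconv_le_cst hK (t - s) x (nnm_row s hWP)); last by rewrite mulr_ge0// ltW.
move=> y; rewrite EFinM; apply: lee_pmul => //; first by rewrite lee_fin.
  exact: hP.2.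
by rewrite lee_fin.
Qed.

Let Gfin t x s : G t x s \is a fin_num.
Proof.
by rewrite ge0_fin_numE; [exact: le_lt_trans (GLa t x s) (ltry _)|exact: (hG t x).2].
Qed.

(** The null set on which V differs from -W disappears under the space integral, so that the
    identity holds at every x. *)
Lemma frac_heat_perturb_sol (t s : R) x : s < t ->
  frac_heat mu (t - s) (V \* U s) x = - fine (G t x s).
Proof.
move=> st; rewrite frac_heatE ?subr_gt0// -fineN; congr fine.
rewrite /G -integral_ge0N; last by move=> y _; exact: (nnm_conv_in (t, x) h0 hWP).2.
have mk : measurable_fun setT (fun y : 'rV[R]_N => K (t - s) (x - y)).
  have := (nnm_dheat_refl hK 0 (t - s) x).1.
  by under eq_fun do rewrite dheat0E/=; move/measurable_EFinP.
apply: ae_eq_integral => //.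
- by apply/measurable_EFinP; apply: measurable_funM => //; exact: measurable_funM.
- exact: (measurableT_comp (@oppe_measurable R setT)
    (nnm_row s (nnm_conv_in (t, x) h0 hWP)).1).
apply: filterS VW => y VWy _ /=.
by rewrite dheat0E /potW -perturb_solE -!EFinM -EFinN VWy mulNr mulrN.
Qed.

Lemma perturb_sol_eq (t : R) x : 0 < t ->
  let F s := frac_heat mu (t - s) (V \* U s) x in
  lam.-integrable `]0%R, t[ (EFin \o F) /\
  U t x = frac_heat mu t f x + \int[lam]_(s in `]0%R, t[) F s.
Proof.
move=> t0 F.
have FG : {in `]0%R, t[%classic, EFin \o F =1 (fun s => - G t x s)%E}.
  move=> s; rewrite inE/= in_itv/= => /andP[_ st].
  by rewrite /F frac_heat_perturb_sol// EFinN fineK.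
have CG : conv (dheat K 0) (fun p => potW W p * P (EFin \o f) p)%E (t, x) =
    (\int[lam]_(s in `]0%R, t[) G t x s)%E.
  rewrite /conv nu_integral; last exact: nnm_conv_in.
  rewrite [RHS]integral_mkcond; apply: eq_integral => s _.
  rewrite patchE; case: ifPn => // st; apply: integral0_eq => y _.
  have [s0|s0] := leP s 0; first by rewrite (perturb_le0 hK mW W0 WL)// !mule0.
  rewrite (dheat_le0 hK) ?mul0e//= subr_le0 leNgt; apply/negP => st'.
  by move: st; rewrite notin_setE/= in_itv/= s0 st'.
have Cfin : ((\int[lam]_(s in `]0%R, t[) G t x s) < +oo)%E.
  rewrite -CG; apply: le_lt_trans (ltry (t * (L * a))).
  apply: (conv_le_cst hK x hWP) => [p|p p0| |]; [| |by rewrite mulr_ge0// ltW|exact: ltW].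
    rewrite EFinM; apply: lee_pmul => //; first by rewrite lee_fin.
    - exact: hP.2.
    - by rewrite lee_fin.
  by case: p p0 => r y /= r0; rewrite (perturb_le0 hK mW W0 WL)// mule0.
split.
  apply: (@eq_integrable _ _ _ lam `]0%R, t[%classic (measurable_itv _) (fun s => - G t x s)%E).
    by move=> s sI; rewrite FG.
  apply: integrableN => //; apply/integrableP; split.
    by apply: measurable_funTS; exact: (hG t x).1.
  by under eq_integral do rewrite gee0_abs ?(hG t x).2//.
rewrite perturb_sol_heat// CG; congr (_ + _).
rewrite /Rintegral -fineN; congr fine.
rewrite -integral_ge0N; last by move=> s _; exact: (hG t x).2.
by apply: eq_integral => s sI; rewrite -FG.
Qed.

(** The sup bound and the L^1 bound of the datum are inherited by the solution at every time, which
    bounds all its Morrey norms at once. The integral equation even holds at every point. *)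
Lemma perturb_sol_solution p l : (1 <= p)%E -> 0 <= l <= N%:R ->
  perturbed_solution mu V p l f U.
Proof.
move=> p1 lN; have [c c0 mn] := @morrey_norm_le R N.
have Ub t : (\int[leb N]_x (`|U t x|)%:E <= b%:E)%E.
  apply: le_trans fb.
  under eq_integral do rewrite ger0_norm// perturb_solE.
  exact: (integral_perturb_le hK mW W0 WL).
have Unorm t : (morrey_norm p l (U t) <= (a * (c + b / a))%:E)%E.
  apply: mn => //; [exact: ltW|by rewrite divr_ge0// ltW|by move=> y; rewrite ger0_norm|].
  by rewrite mulrC divfK ?gt_eqF.
split.
- by move=> t t0; split => //; exact: le_lt_trans (Unorm t) (ltry _).
- move=> t t0; pose g s := fine (kernel_var K L t s (t + 1)).
  have g0 s : 0 <= g s by rewrite fine_ge0 ?kernel_var_ge0.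
  have gE s : (g s)%:E = kernel_var K L t s (t + 1) by rewrite fineK ?kernel_var_fin.
  have gcvg : g s @[s --> t] --> 0.
    apply/(@cvg_nbhsP _ R^o) => u ut; apply: (@fine_cvg _ _ _ _ (fun n => kernel_var K L t (u n) (t + 1))).
    exact: kernel_var_cvg.
  apply: (@squeeze_cvge _ _ _ _ (cst 0%E) _ (fun s => (a * g s * (c + b / a))%:E)).
  + near=> s.
    have s0 : 0 < s by near: s; exact: lt_nbhsr.
    have sT : s <= t + 1 by apply: ltW; near: s; apply: lt_nbhsl; rewrite ltrDl.
    have tT : t <= t + 1 by rewrite lerDl.
    apply/andP; split.
      exact: morrey_norm_ge0.
    have d x : ((`|U s x - U t x|)%:E <= perturb_var K W L (EFin \o f) t s (t + 1) x)%E.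
      by rewrite distrC; exact: perturb_sol_dist.
    (* The sup norm and the L^1 norm of the difference both carry the factor [g s], which tends to
       0; so does its Morrey norm. *)
    apply: mn => //.
    * exact: measurable_funB.
    * by rewrite mulr_ge0// ltW.
    * by rewrite divr_ge0// ltW.
    * move=> x; rewrite -lee_fin; apply: (le_trans (d x)).
      rewrite mulrC EFinM gE.
      by apply: (perturb_var_le hK mW W0 WL _ _ _ _ hf fa); exact: ltW.
    * apply: (@le_trans _ _ (\int[leb N]_x perturb_var K W L (EFin \o f) t s (t + 1) x)%E).
        apply: ge0_le_integral => //.
        - by apply/measurable_EFinP; apply: measurableT_comp => //; exact: measurable_funB.
        - exact: (nnm_perturb_var hK mW W0 WL t s (t + 1) hf).1.
        - by move=> x _; exact: d.
      have -> : a * g s * (b / a) = g s * b by field; rewrite gt_eqF.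
      rewrite EFinM gE; exact: (integral_perturb_var_le hK mW W0 WL).
  + exact: cvg_cst.
  + apply: cvg_EFin; first exact: nearW.
    have gc : a * g s * (c + b / a) @[s --> t] --> a * 0 * (c + b / a).
      by apply: cvgM; [apply: cvgM => //|]; exact: cvg_cst.
    by rewrite mulr0 mul0r in gc.
- by move=> T T0; exists (a * (c + b / a)) => t _; exact: Unorm.
- by move=> t t0; apply: aeW => x; exact: perturb_sol_eq.
Unshelve. all: by end_near. Qed.

End solution.
End existence.

(** * Uniqueness of solutions *)

Lemma measurable_truncn_eq (R : realType) k :
  measurable [set x : R | Num.truncn x = k].
Proof.
have mlt j : measurable [set x : R | (j < Num.truncn x)%N].
  rewrite (_ : [set x | _] = `[j.+1%:R, +oo[%classic); first exact: measurable_itv.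
  by apply/seteqP; split => x /=; rewrite in_itv/= andbT truncn_gt_nat.
rewrite (_ : [set x | _] = [set x : R | (k <= Num.truncn x)%N] `\`
    [set x | (k < Num.truncn x)%N]).
  apply: measurableD => //; case: k => [|k]; last exact: mlt.
  by rewrite (_ : [set x | _] = setT)//; apply/seteqP; split.
apply/seteqP; split => x /=; first by move=> ->; rewrite leqnn ltnn.
by move=> [kx /negP]; rewrite -leqNgt => xk; apply/eqP; rewrite eqn_leq xk kx.
Qed.

(** Serves the freezing of a solution on a time grid: a function that is piecewise constant in time
    is jointly measurable as soon as each of its values is measurable in space. *)
Lemma measurable_fun_step d (T : measurableType d) (R : realType) (m : R)
    (g : nat -> T -> R) : (forall k, measurable_fun setT (g k)) ->
  measurable_fun setT (fun z : measurableTypeR R * T => g (Num.truncn (m * z.1)) z.2).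
Proof.
move=> mg _ B mB; rewrite setTI.
rewrite (_ : _ @^-1` B = \bigcup_k
    ([set s : R | Num.truncn (m * s) = k] `*` (g k @^-1` B))).
  apply: bigcup_measurable => k _; apply: measurableX.
    have mm : measurable_fun setT (fun s : R => m * s) by exact: measurable_funM.
    by have := mm measurableT _ (@measurable_truncn_eq R k); rewrite setTI.
  by have := mg k measurableT _ mB; rewrite setTI.
apply/seteqP; split => [[s y] /= h|[s y] [k _ [/= <- h]]] //.
by exists (Num.truncn (m * s)).
Qed.

Section uniqueness.
Context {R : realType} {N : nat}.
Notation lam := (@lebesgue_measure R).
Notation Q := (measurableTypeR R * 'rV[R]_N)%type.
Implicit Types (x y z : 'rV[R]_N) (t s : R).
Context (K : R -> 'rV[R]_N -> R) (hK : is_heat K).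
Context (V : 'rV[R]_N -> R) (L : R) (mV : measurable_fun setT V) (L0 : 0 < L)
  (VL : {ae leb N, forall y, `|V y| <= L}).
Context (p : \bar R) (l : R) (p1 : (1 <= p)%E) (u v : R -> 'rV[R]_N -> R)
  (g : R -> 'rV[R]_N -> R) (B : R).

Let F (w : R -> 'rV[R]_N -> R) t x s := \int[leb N]_y (K (t - s) (x - y) * (V y * w s y)).

Context (umorrey : forall t, 0 < t -> morrey p l (u t))
  (ucvg : forall t, 0 < t -> morrey_norm p l (u s \- u t) @[s --> t] --> 0%E)
  (ubnd : forall T, 0 < T -> exists C : R, forall t, 0 < t <= T ->
    (morrey_norm p l (u t) <= C%:E)%E)
  (usol : forall t, 0 < t -> {ae leb N, forall x,
    lam.-integrable `]0%R, t[ (EFin \o F u t x) /\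
    u t x = g t x + \int[lam]_(s in `]0%R, t[) F u t x s}).
Context (mv : measurable_fun setT (fun q : Q => v q.1 q.2))
  (vB : forall t x, `|v t x| <= B)
  (vsol : forall t, 0 < t -> forall x,
    lam.-integrable `]0%R, t[ (EFin \o F v t x) /\
    v t x = g t x + \int[lam]_(s in `]0%R, t[) F v t x s).

Let h0 := nnm_dheat hK 0.
Let mvt t : measurable_fun setT (v t) := measurable_sec1 t mv.
Let mut t : 0 < t -> measurable_fun setT (u t).
Proof. by move=> t0; have [] := umorrey t0. Qed.
Let B0 : 0 <= B. Proof. exact: le_trans (normr_ge0 _) (vB 0 0). Qed.

Let nrm (f : 'rV[R]_N -> R) y := (`|f y|)%:E.

Let nnm_nrm f : measurable_fun setT f -> nnm (nrm f).
Proof.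
by move=> mf; split => [|y]; [apply/measurable_EFinP; exact: measurableT_comp|rewrite lee_fin].
Qed.

Let mk t x : measurable_fun setT (fun y => K t (x - y)).
Proof.
have := (nnm_dheat_refl hK 0 t x).1.
by under eq_fun do rewrite dheat0E/=; move/measurable_EFinP.
Qed.

Let w s := u s \- v s.
Let mw s : 0 < s -> measurable_fun setT (w s).
Proof. by move=> s0; apply: measurable_funB => //; exact: mut. Qed.

Let hnu s : 0 < s -> nnm (nrm (u s)).
Proof. by move=> s0; apply: nnm_nrm; exact: mut. Qed.

Let hnv s : nnm (nrm (v s)).
Proof. exact: nnm_nrm. Qed.

Let hnw s : 0 < s -> nnm (nrm (w s)).
Proof. by move=> s0; apply: nnm_nrm; exact: mw. Qed.

Let S t f x := sconv (dheat K 0) (nrm f) (t, x).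

Let nnm_S t f : measurable_fun setT f -> nnm (S t f).
Proof. by move=> mf; exact: (nnm_row t (nnm_sconv h0 (nnm_nrm mf))). Qed.

Let S_morrey t f A x : 0 < t -> measurable_fun setT f -> (morrey_norm p l f <= A%:E)%E ->
  (S t f x < +oo)%E.
Proof.
move=> t0 mf fA; have [C C0 h] := morrey_smoothing hK l t0 p1.
pose A' := Num.max A 1; have A'0 : 0 < A' by rewrite lt_max ltr01 orbT.
apply: le_lt_trans (h f A' x mf A'0 _) (ltry _); apply: (le_trans fA).
by rewrite lee_fin le_max lexx.
Qed.

Let S_u t s x : 0 < t -> 0 < s -> (S t (u s) x < +oo)%E.
Proof.
move=> t0 s0; have [C h] := ubnd s0; apply: S_morrey => //; first exact: mut.
by apply: h; rewrite s0 lexx.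
Qed.

Let S_v t s x : (S t (v s) x <= B%:E)%E.
Proof. by apply: (sconv_le_cst hK t x (hnv s)) => // y; rewrite lee_fin. Qed.

Let S_w_le t s x : 0 < s -> (S t (w s) x <= S t (u s) x + S t (v s) x)%E.
Proof.
move=> s0; rewrite /S -(sconvDr (t, x) h0 (hnu s0) (hnv s)).
apply: (le_sconv (t, x) h0 h0 (hnw s0) (nnmD (hnu s0) (hnv s))) => // y.
by rewrite -EFinD lee_fin ler_normB.
Qed.

Let S_w t s x : 0 < t -> 0 < s -> (S t (w s) x < +oo)%E.
Proof.
move=> t0 s0; apply: le_lt_trans (S_w_le t x s0) _.
by rewrite lte_add_pinfty ?S_u//; exact: le_lt_trans (S_v t s x) (ltry _).
Qed.

Let int_kernel t f x : measurable_fun setT f -> (S t f x < +oo)%E ->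
  (leb N).-integrable setT (EFin \o (fun y => K t (x - y) * (V y * f y))) /\
  (\int[leb N]_y (`|K t (x - y) * (V y * f y)|)%:E <= L%:E * S t f x)%E.
Proof.
move=> mf Sf.
have mi : measurable_fun setT (fun y => K t (x - y) * (V y * f y)).
  by apply: measurable_funM => //; exact: measurable_funM.
have hn := nnm_sconv_in (t, x) h0 (nnm_nrm mf).
have le : (\int[leb N]_y (`|K t (x - y) * (V y * f y)|)%:E <= L%:E * S t f x)%E.
  rewrite /S /sconv -nnm_integralZl//; last by rewrite lee_fin ltW.
  apply: ae_ge0_le_integral => //.
  - by apply/measurable_EFinP; exact: measurableT_comp.
  - by move=> y _; rewrite mule_ge0 ?hn.2// lee_fin ltW.
  - by apply: emeasurable_funM => //; exact: hn.1.
  apply: filterS VL => y Vy _.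
  rewrite dheat0E -!EFinM lee_fin !normrM ger0_norm ?(heat_ge0 hK)// mulrCA.
  by apply: ler_wpM2r => //; rewrite mulr_ge0 ?(heat_ge0 hK).
split => //; apply/integrableP; split; first exact/measurable_EFinP.
apply: le_lt_trans le _.
by rewrite lte_mul_pinfty// lee_fin ltW.
Qed.

Let F_diff t s x : 0 < s < t ->
  ((`|F u t x s - F v t x s|)%:E <= L%:E * S (t - s) (w s) x)%E.
Proof.
move=> /andP[s0 st]; have ts0 : 0 < t - s by rewrite subr_gt0.
have [iu _] := int_kernel (mut s0) (S_u x ts0 s0).
have [iv _] := int_kernel (mvt s) (le_lt_trans (S_v (t - s) s x) (ltry _)).
have [iw lw] := int_kernel (mw s0) (S_w x ts0 s0).
apply: le_trans lw; rewrite /F -RintegralB//.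
rewrite (_ : (fun y => _) = (fun y => K (t - s) (x - y) * (V y * w s y))); last first.
  by apply/funext => y; rewrite /w -!mulrBr.
have := le_normr_Rintegral measurableT iw; rewrite -lee_fin => /le_trans; apply.
rewrite /Rintegral fineK//; apply: integrable_fin_num => //.
exact: integrable_norm.
Qed.

(** The first multiple of 1/(n + 1) beyond s. The successor keeps it positive, and [u] is a Morrey
    function only at positive times. *)
Let a n s : R := (Num.truncn (n.+1%:R * s)).+1%:R / n.+1%:R.

Let a_gt0 n s : 0 < a n s. Proof. by rewrite divr_gt0. Qed.

Let a_cvg s : 0 < s -> a n s @[n --> \oo] --> s.
Proof.
move=> s0; apply: (@squeeze_cvgr _ _ _ _ (cst s) (fun n => s + n.+1%:R^-1)).
- apply: nearW => n; have n0 : 0 < n.+1%:R :> R by [].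
  have /truncn_itv/andP[lo up] : 0 <= n.+1%:R * s by rewrite mulr_ge0// ltW.
  rewrite /a /cst ler_pdivlMr// mulrC (ltW up)/= ler_pdivrMr// mulrDl mulVf ?gt_eqF//.
  by rewrite -[X in X <= _]natr1 lerD2r [leRHS]mulrC.
- exact: cvg_cst.
- rewrite -[X in _ --> X]addr0; apply: cvgD; first exact: cvg_cst.
  exact: cvg_harmonic.
Qed.

Let D t : set Q := (fun q : Q => q.1) @^-1` `]0%R, t[%classic.

Let mD t : measurable (D t).
Proof. by rewrite -[X in measurable X]setTI; exact: measurable_fst. Qed.

Let H t (q : Q) := S (t - q.1) (w q.1) q.2.

(** Since [u] is given time by time, joint measurability of [H] is not immediate. It holds for [Hn],
    in which [u] is frozen on the grid, and passes to the limit. *)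
Let Hn t n (q : Q) := S (t - q.1) (u (a n q.1) \- v q.1) q.2.

Let nnm_Hn t n : nnm (Hn t n).
Proof.
change (nnm (fun q : Q => \int[leb N]_y (dheat K 0 (t - q.1, q.2 - y)%R *
  (`|u (a n q.1) y - v q.1 y|)%:E))%E).
apply: (nnm_integral (leb N) (h := fun (q : Q) y => (dheat K 0 (t - q.1, q.2 - y)%R *
  (`|u (a n q.1) y - v q.1 y|)%:E)%E)).
have m11 : measurable_fun setT (fun z : Q * 'rV[R]_N => z.1.1).
  exact: (measurableT_comp measurable_fst measurable_fst).
have m12 : measurable_fun setT (fun z : Q * 'rV[R]_N => z.1.2).
  exact: (measurableT_comp measurable_snd measurable_fst).
apply: nnmM.
  apply: (nnm_comp h0); apply: measurable_fun_pair; first exact: measurable_funB.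
  exact: measurable_fun_rVB.
split => [|z]; last by rewrite lee_fin.
have mz : measurable_fun setT (fun z : Q * 'rV[R]_N => (z.1.1, z.2) : Q).
  exact: measurable_fun_pair.
apply/measurable_EFinP; apply: measurableT_comp => //; apply: measurable_funB.
  pose G k y := u (k.+1%:R / n.+1%:R) y.
  have mG k : measurable_fun setT (G k) by apply: mut; rewrite divr_gt0.
  exact: (measurableT_comp (measurable_fun_step n.+1%:R mG) mz).
exact: (measurableT_comp mv mz).
Qed.

(** The difference is at most S_(t-s) applied to |u(a_n) - u(s)|; this tends to 0 pointwise, because
    [u] is continuous in the Morrey norm and the smoothing estimate turns that norm into a pointwise
    bound. *)
Let Hn_cvg t q : D t q -> Hn t n q @[n --> \oo] --> H t q.
Proof.
case: q => s x; rewrite /D/= in_itv/= => /andP[s0 st].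
have ts0 : 0 < t - s by rewrite subr_gt0.
pose d n := u (a n s) \- u s.
have md n : measurable_fun setT (d n) by apply: measurable_funB; exact: mut.
have mwn n : measurable_fun setT (u (a n s) \- v s).
  by apply: measurable_funB => //; exact: mut.
pose Dn n := S (t - s) (d n) x.
have hd n : nnm (nrm (d n)) by exact: nnm_nrm.
have hwn n : nnm (nrm (u (a n s) \- v s)) by exact: nnm_nrm.
have le1 n : (Hn t n (s, x) <= H t (s, x) + Dn n)%E.
  rewrite /Hn /H /Dn /S/= -(sconvDr (t - s, x) h0 (hnw s0) (hd n)).
  apply: (le_sconv (t - s, x) h0 h0 (hwn n) (nnmD (hnw s0) (hd n))) => // y.
  rewrite -EFinD lee_fin; apply: le_trans (ler_normD _ _).
  by rewrite le_eqVlt; apply/orP; left; apply/eqP; congr (`|_|); rewrite /w /d/=; ring.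
have le2 n : (H t (s, x) <= Hn t n (s, x) + Dn n)%E.
  rewrite /Hn /H /Dn /S/= -(sconvDr (t - s, x) h0 (hwn n) (hd n)).
  apply: (le_sconv (t - s, x) h0 h0 (hnw s0) (nnmD (hwn n) (hd n))) => // y.
  rewrite -EFinD lee_fin; apply: le_trans (ler_normB _ _).
  by rewrite le_eqVlt; apply/orP; left; apply/eqP; congr (`|_|); rewrite /w /d/=; ring.
have Dn0 : Dn n @[n --> \oo] --> 0%E.
  have [C C0 sm] := morrey_smoothing hK l ts0 p1.
  have Dge n : (0 <= Dn n)%E by exact: (nnm_S (t - s) (md n)).2.
  have dlim : morrey_norm p l (d n) @[n --> \oo] --> 0%E.
    exact: (cvg_comp _ _ (a_cvg s0) (ucvg s0)).
  have [dfin dcvg] := (fine_cvgP _ _).1 dlim.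
  have Deps e : 0 < e -> \forall n \near \oo, (Dn n <= (C * e)%:E)%E.
    move=> e0; move/cvgrPdist_le : dcvg => /(_ e e0) dn.
    near=> n; apply: sm => //.
    have dnfin : morrey_norm p l (d n) \is a fin_num by near: n.
    have dne : `|0 - fine (morrey_norm p l (d n))| <= e by near: n.
    rewrite -(fineK dnfin) lee_fin; apply: le_trans dne.
    by rewrite sub0r normrN ler_norm.
  apply/fine_cvgP; split.
    apply: filterS (Deps 1 ltr01) => n dn.
    by rewrite ge0_fin_numE//; exact: le_lt_trans dn (ltry _).
  apply/cvgrPdist_le => e e0.
  have C1 : 0 < C + 1 by rewrite ltr_wpDl.
  apply: filterS (Deps (e / (C + 1)) (divr_gt0 e0 C1)) => n dn.
  have dnfin : Dn n \is a fin_num.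
    by rewrite ge0_fin_numE//; exact: le_lt_trans dn (ltry _).
  rewrite sub0r normrN ger0_norm ?fine_ge0// -lee_fin fineK//.
  apply: (le_trans dn); rewrite lee_fin mulrA ler_pdivrMr// mulrC.
  by apply: ler_wpM2l; [exact: ltW|rewrite lerDl].
have Hfin : H t (s, x) \is a fin_num.
  by rewrite ge0_fin_numE; [exact: S_w|exact: (nnm_S (t - s) (mw s0)).2].
apply: (@squeeze_cvge _ _ _ _ (fun n => H t (s, x) - Dn n)%E _ (fun n => H t (s, x) + Dn n)%E).
- have [dfin _] := (fine_cvgP _ _).1 Dn0.
  near=> n; rewrite le1 andbT leeBlDr//.
  by near: n.
- rewrite -[X in _ --> X]sube0; apply: cvgeB => //; [exact: fin_num_adde_defr|exact: cvg_cst].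
- rewrite -[X in _ --> X]adde0; apply: cvgeD => //; [exact: fin_num_adde_defr|exact: cvg_cst].
Unshelve. all: by end_near. Qed.

Let nnm_HD t : nnm ((H t) \_ (D t)).
Proof.
split; last first.
  move=> [s x]; rewrite patchE; case: ifPn => // /set_mem; rewrite /D/= in_itv/=.
  by move=> /andP[s0 _]; exact: (nnm_S (t - s) (mw s0)).2.
apply: (emeasurable_fun_cvg (fun n => (Hn t n) \_ (D t))).
  by move=> n; exact: (nnm_restrict (mD t) (nnm_Hn t n)).1.
move=> q _; rewrite patchE; case: ifPn => [/set_mem qD|qD].
  by under eq_fun do rewrite patchE mem_set//; exact: Hn_cvg.
by under eq_fun do rewrite patchE (negbTE qD); exact: cvg_cst.
Qed.

Let w_bound t : 0 < t -> {ae leb N, forall x,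
  (nrm (w t) x <= L%:E * \int[lam]_s ((H t) \_ (D t)) (s, x))%E}.
Proof.
move=> t0; apply: filterS (usol t0) => x [iu ue].
have [iv ve] := vsol t0 x.
have mI : measurable (`]0%R, t[%classic : set (measurableTypeR R)) by exact: measurable_itv.
have -> : nrm (w t) x = (`|\int[lam]_(s in `]0%R, t[) (F u t x s - F v t x s)|)%:E.
  by rewrite RintegralB// /nrm /w/= ue ve opprD addrACA subrr add0r.
have iuv : lam.-integrable `]0%R, t[ (EFin \o (fun s => F u t x s - F v t x s)).
  exact: (integrableB mI iu iv).
apply: (@le_trans _ _ (\int[lam]_(s in `]0%R, t[) (`|F u t x s - F v t x s|)%:E)%E).
  have := le_normr_Rintegral mI iuv.
  rewrite -lee_fin => /le_trans; apply.
  rewrite /Rintegral fineK//; apply: integrable_fin_num => //.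
  exact: integrable_norm.
have hH : nnm (fun s => ((H t) \_ (D t)) (s, x)).
  apply: (nnm_comp (nnm_HD t)); exact: measurable_fun_pair.
rewrite -nnm_integralZl//; last by rewrite lee_fin ltW.
rewrite [X in (X <= _)%E]integral_mkcond; apply: nnm_le_integral.
- split => [|s]; last by rewrite patchE; case: ifPn => // _; rewrite lee_fin.
  apply/(measurable_restrictT _ _).1 => //.
  by have /integrableP[] := integrable_norm iuv.
- by apply: nnmM => //; apply: nnm_cst; rewrite lee_fin ltW.
move=> s; rewrite !patchE.
have -> : ((s, x) \in D t) = (s \in `]0%R, t[%classic) by apply/idP/idP; rewrite !inE.
case: ifPn => [|_]; last by rewrite mule0.
by rewrite inE/= in_itv/= => st; exact: F_diff.
Qed.

(** In [w_bound] the smoothing estimate gives no control of S_(t-s)|w(s)| that is uniform as s tends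
    to t. Acting with S_1 and commuting it past S_(t-s) gives an inequality in S_1|w| alone; it
    holds at every point, since S_1 ignores the exceptional null set. *)
Let S1_le t x0 (b : R -> R) : 0 < t -> measurable_fun setT b -> (forall s, 0 <= b s) ->
  (forall s x, 0 < s < t -> (S 1 (w s) x <= (b s)%:E)%E) ->
  (S 1 (w t) x0 <= L%:E * \int[lam]_(s in `]0%R, t[) (b s)%:E)%E.
Proof.
move=> t0 mb b0 Sb; have hHD := nnm_HD t.
have hI : nnm (fun x => \int[lam]_s ((H t) \_ (D t)) (s, x))%E.
  apply: (nnm_integral lam (h := fun x s => ((H t) \_ (D t)) (s, x))).
  by apply: (nnm_comp hHD); exact: measurable_fun_pair.
have LE : (0 <= L%:E)%E by rewrite lee_fin ltW.
have hLI : nnm (fun x => L%:E * \int[lam]_s ((H t) \_ (D t)) (s, x))%E.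
  by apply: nnmM => //; exact: nnm_cst.
have hk := nnm_dheat_refl hK 0 1 x0.
apply: (@le_trans _ _ (\int[leb N]_x (dheat K 0 (1, x0 - x)%R *
   (L%:E * \int[lam]_s ((H t) \_ (D t)) (s, x))))%E).
  apply: ae_ge0_le_integral => //.
  - by move=> x _; exact: (nnm_sconv_in (1, x0) h0 (nnm_nrm (mw t0))).2.
  - exact: (nnm_sconv_in (1, x0) h0 (nnm_nrm (mw t0))).1.
  - by move=> x _; exact: (nnmM hk hLI).2.
  - exact: (nnmM hk hLI).1.
  apply: filterS (w_bound t0) => x wx _.
  by apply: lee_wpmul2l => //; exact: hk.2.
have hxs : nnm (fun z : 'rV[R]_N * R => dheat K 0 (1, x0 - z.1)%R * ((H t) \_ (D t)) (z.2, z.1))%E.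
  apply: nnmM; first exact: (nnm_comp hk).
  by apply: (nnm_comp hHD); exact: measurable_fun_pair.
have -> : (\int[leb N]_x (dheat K 0 (1, x0 - x)%R * (L%:E * \int[lam]_s ((H t) \_ (D t)) (s, x))) =
   L%:E * \int[lam]_s \int[leb N]_x (dheat K 0 (1, x0 - x)%R * ((H t) \_ (D t)) (s, x)))%E.
  rewrite -(nnm_swap (leb N) lam (h := fun x s => dheat K 0 (1, x0 - x)%R * ((H t) \_ (D t)) (s, x))%E hxs).
  rewrite -nnm_integralZl//; last first.
    exact: (nnm_integral lam (h := fun x s => dheat K 0 (1, x0 - x)%R * ((H t) \_ (D t)) (s, x))%E hxs).
  apply: eq_integral => x _; rewrite nnm_integralZl; [by rewrite muleCA|exact: hk.2|].
  by apply: (nnm_comp hHD); exact: measurable_fun_pair.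
apply: lee_wpmul2l => //; rewrite [leRHS]integral_mkcond.
apply: nnm_le_integral.
- apply: (nnm_integral (leb N) (h := fun s x => dheat K 0 (1, x0 - x)%R * ((H t) \_ (D t)) (s, x))%E).
  apply: nnmM; first exact: (nnm_comp hk measurable_snd).
  apply: (nnm_comp hHD (h := fun z : R * 'rV[R]_N => (z.1, z.2) : Q)).
  exact: measurable_fun_pair.
- split => [|s]; last by rewrite patchE; case: ifPn => // _; rewrite lee_fin.
  apply/(measurable_restrictT _ _).1 => //.
  by apply: measurable_funTS; exact/measurable_EFinP.
move=> s; rewrite patchE.
have eD x : ((s, x) \in D t) = (s \in `]0%R, t[%classic) by apply/idP/idP; rewrite !inE.
case: ifPn => st; last first.
  by rewrite integral0_eq// => x _; rewrite patchE eD (negbTE st) mule0.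
move: (st); rewrite inE/= in_itv/= => /andP[s0 ts].
have ts0 : 0 < t - s by rewrite subr_gt0.
have -> : (\int[leb N]_x (dheat K 0 (1, x0 - x)%R * ((H t) \_ (D t)) (s, x)))%E =
    sconv (dheat K 0) (S 1 (w s)) (t - s, x0).
  rewrite /S (sconv_sem hK 0 x0 (hnw s0) ts0 ltr01) addrC.
  rewrite -(sconv_sem hK 0 x0 (hnw s0) ltr01 ts0).
  by apply: eq_integral => x _; rewrite patchE eD st.
apply: (sconv_le_cst hK _ _ (nnm_S 1 (mw s0))) => // y.
by apply: Sb; rewrite s0.
Qed.

Lemma integral_exp_itvN c t : 0 <= c -> 0 <= t ->
  (\int[lam]_(s in `]0%R, t[) (c * expR (c * s))%:E = (expR (c * t) - 1)%:E)%E.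
Proof.
move=> c0 t0; have := integral_exp_itv (- c) t0; rewrite mulNr opprK => h.
rewrite -(opprB 1) EFinN -h -[LHS]oppeK; congr (- _)%E.
rewrite -integral_ge0N; last by move=> s _; rewrite lee_fin mulr_ge0 ?expR_ge0.
by apply: eq_integral => s _; rewrite -EFinN !mulNr opprK.
Qed.

(** Gronwall's argument for S_1|w|, which is bounded on (0, t] because [u] is bounded there in the
    Morrey norm and [v] in the sup norm. It shows S_1|w(t)| = 0, hence w(t) = 0 a.e. *)
Lemma solution_unique t : 0 < t -> {ae leb N, forall x, u t x = v t x}.
Proof.
move=> t0; have [Cu hCu] := ubnd t0.
have [C C0 sm] := morrey_smoothing hK l ltr01 p1.
pose A := C * Num.max Cu 1 + B.
have A0 : 0 <= A by rewrite addr_ge0// mulr_ge0// le_max ler01 orbT.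
have SA s x : 0 < s <= t -> (S 1 (w s) x <= A%:E)%E.
  move=> /andP[s0 st]; apply: le_trans (S_w_le 1 x s0) _.
  rewrite EFinD; apply: leeD => //; apply: sm; first exact: mut.
    by rewrite lt_max ltr01 orbT.
  by apply: (le_trans (hCu s _)); [rewrite s0 st|rewrite lee_fin le_max lexx].
(* With the weight exp(2 L s), L times the integral over (0, s) is at most half of the weight, so
   each application of [S1_le] gains a factor 1/2. *)
pose bd n s := A / 2 ^+ n * expR (2 * L * s).
have bd0 n s : 0 <= bd n s by rewrite mulr_ge0 ?expR_ge0// divr_ge0// exprn_ge0.
have Sn n s x : 0 < s <= t -> (S 1 (w s) x <= (bd n s)%:E)%E.
  elim: n s x => [|n IH] s x /andP[s0 st].
    apply: (le_trans (SA s x _)); first by rewrite s0.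
    rewrite /bd expr0 divr1 lee_fin ler_peMr// -expR0 ler_expR.
    by rewrite mulr_ge0// ?ltW// mulr_gt0.
  have mbd : measurable_fun setT (bd n).
    apply: measurable_funM => //; apply: (measurableT_comp (@measurable_expR R)).
    exact: measurable_funM.
  apply: (le_trans (S1_le x s0 mbd (bd0 n) _)).
    by move=> r y /andP[r0 rs]; apply: IH; rewrite r0 (le_trans (ltW rs)).
  pose c := A / 2 ^+ n / (2 * L).
  have c0 : 0 <= c by rewrite divr_ge0// ?divr_ge0 ?exprn_ge0// ltW// mulr_gt0.
  have -> : (\int[lam]_(r in `]0%R, s[) (bd n r)%:E =
      c%:E * \int[lam]_(r in `]0%R, s[) (2 * L * expR (2 * L * r))%:E)%E.
    rewrite -ge0_integralZl//.
    - apply: eq_integral => r _; rewrite -EFinM /bd /c; congr (_%:E).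
      by field; rewrite lt0r_neq0// lt0r_neq0 ?exprn_gt0.
    - apply/measurable_EFinP; apply: measurable_funTS; apply: measurable_funM => //.
      apply: (measurableT_comp (@measurable_expR R)); exact: measurable_funM.
    - by move=> r _; rewrite lee_fin mulr_ge0 ?expR_ge0// ltW// mulr_gt0.
  rewrite integral_exp_itvN ?(ltW s0) ?mulr_ge0 ?(ltW L0)// -!EFinM lee_fin /bd.
  have -> : L * (c * (expR (2 * L * s) - 1)) = A / 2 ^+ n.+1 * (expR (2 * L * s) - 1).
    by rewrite /c exprS; field; rewrite lt0r_neq0// lt0r_neq0 ?exprn_gt0.
  apply: ler_wpM2l; first by rewrite divr_ge0// exprn_ge0.
  by rewrite lerBlDr lerDl.
have S0 x : S 1 (w t) x = 0%E.
  have Sge := (nnm_S 1 (mw t0)).2 x.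
  have Sfin : S 1 (w t) x \is a fin_num by rewrite ge0_fin_numE// S_w.
  apply/eqP; rewrite eq_le Sge andbT -(fineK Sfin) lee_fin leNgt; apply/negP => r0.
  set r := fine _ in r0; pose M := A * expR (2 * L * t).
  have M0 : 0 <= M by rewrite mulr_ge0 ?expR_ge0.
  pose n := (Num.truncn (M / r)).+1.
  have : r <= bd n t.
    by rewrite -lee_fin fineK//; apply: Sn; rewrite t0 lexx.
  apply/negP; rewrite -ltNge /bd mulrAC -/M ltr_pdivrMr ?exprn_gt0//.
  rewrite mulrC -ltr_pdivrMr//.
  apply: lt_trans (truncnS_gt _) _; rewrite -natrX ltr_nat; exact: ltn_expl.
(* The kernel has mass 1, so S_1|w(t)| and |w(t)| have the same integral. *)
have I0 : (\int[leb N]_y nrm (w t) y = 0)%E.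
  have := integral_conv1 (nnm_row 1 h0) (hnw t0).
  rewrite (_ : (\int[leb N]_z dheat K 0 (1%R, z)) = 1)%E ?mul1e; last first.
    by under eq_integral do rewrite dheat0E/=; exact: (heat_int1 hK).
  move=> <-; apply: integral0_eq => x _; exact: S0.
have mwt : measurable_fun setT (EFin \o w t) by apply/measurable_EFinP; exact: mw.
have /(ae_eq_integral_abs _ measurableT mwt) h : (\int[leb N]_y `|(EFin \o w t) y| = 0)%E.
  by rewrite -[RHS]I0; apply: eq_integral.
apply: filterS h => x /(_ I) [] /eqP; rewrite subr_eq0 => /eqP //.
Qed.

End uniqueness.

(** * Decay and lower bounds for the potential *)

Section decay.
Context {R : realType} {N : nat}.
Notation lam := (@lebesgue_measure R).
Notation Q := (measurableTypeR R * 'rV[R]_N)%type.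
Implicit Types (x y z : 'rV[R]_N) (t s r : R).
Context (K : R -> 'rV[R]_N -> R) (hK : is_heat K).
Context (W : 'rV[R]_N -> R) (L : R) (mW : measurable_fun setT W).
Context (W0 : forall y, 0 <= W y) (WL : forall y, W y <= L).
Notation P := (perturb K W L).
Let h0 := nnm_dheat hK 0.
Let L0 : 0 <= L. Proof. exact: le_trans (W0 0) (WL 0). Qed.

Definition one_fun : 'rV[R]_N -> \bar R := fun=> 1%E.

Let h1 : nnm one_fun. Proof. exact: nnm_cst. Qed.

Let P1fin q : P one_fun q \is a fin_num.
Proof.
rewrite ge0_fin_numE; last exact: (nnm_perturb hK mW WL h1).2.
apply: le_lt_trans (ltry 1).
exact: (perturb_le_cst hK mW W0 WL q h1 (fun=> le_refl _) ler01).
Qed.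

Lemma sconv_far (M b : R) t r x (c : R) (f : 'rV[R]_N -> \bar R) :
  (forall t r, 0 < t -> 0 < r ->
    (\int[leb N]_(z in ~` eball 0 r) (K t z)%:E <= (M * t * r^-1 `^ b)%:E)%E) ->
  0 < t -> 0 < r -> 0 <= c -> nnm f -> (forall y, f y <= c%:E)%E ->
  (forall y, enorm (x - y) < r -> f y = 0%E) ->
  (sconv (dheat K 0) f (t, x) <= (c * (M * t * r^-1 `^ b))%:E)%E.
Proof.
move=> tail t0 r0 c0 hf fc fx; have cE : (0 <= c%:E)%E by rewrite lee_fin.
pose k z := (c%:E * ((fun z => (K t z)%:E) \_ (~` eball 0 r)) z)%E.
have hKt : nnm (fun z => (K t z)%:E) := nnm_heat hK t.
have mB : measurable (~` @eball R N 0 r) by apply: measurableC; exact: measurable_eball.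
have hr : nnm ((fun z => (K t z)%:E) \_ (~` eball 0 r)).
  split => [|z]; last by rewrite patchE; case: ifPn => // _; exact: hKt.2.
  by apply/(measurable_restrictT _ _).1 => //; apply: measurable_funTS; exact: hKt.1.
have hk : nnm k by apply: nnmM => //; exact: nnm_cst.
apply: (@le_trans _ _ (\int[leb N]_y k (x - y)%R)%E).
  apply: nnm_le_integral; [exact: (nnm_sconv_in (t, x) h0 hf)|exact: (nnm_refl x hk)|].
  move=> y; rewrite dheat0E/= /k patchE.
  case: ifPn => [_|]; first by rewrite muleC; apply: lee_wpmul2r => //; exact: hKt.2.
  rewrite notin_setE/= => /contrapT; rewrite /eball/= subr0 => xy.
  by rewrite fx// !mule0.
rewrite (leb_reflect x hk) /k nnm_integralZl// EFinM; apply: lee_wpmul2l => //.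
by rewrite -integral_mkcond; exact: tail.
Qed.

(** The constant function 1 is split into the indicator functions of a ball around x and of its
    complement. The hypothesis on normalised data, with S_1 already applied, handles the ball, and
    the tail of the kernel handles the complement. *)
Lemma half_contraction (c1 vol A0 omega : R) :
  (0 < N)%N -> 0 <= c1 -> 0 < vol -> 0 <= A0 -> 0 < omega ->
  (forall x r, 0 < r -> leb N (eball x r) = (r ^+ N * vol)%:E) ->
  (forall t (f : 'rV[R]_N -> R) a beta x, 1 <= t -> measurable_fun setT f ->
    0 < a -> 0 < beta -> a * (c1 + beta) <= 1 -> (forall y, 0 <= f y <= a) ->
    (\int[leb N]_y (f y)%:E <= (a * beta)%:E)%E ->
    (sconv (dheat K 0) (fun z => P (EFin \o f) (t, z)) (1%R, x) <= (A0 * expR (- (omega * t)))%:E)%E) ->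
  exists2 T : R, 0 < T & forall x, (P one_fun (T, x) <= 2^-1%:E)%E.
Proof.
move=> N0 c10 vol0 A00 omega0 volE dec.
have [M M0 [b b0 tail]] := heat_tail hK.
have Nr : 0 < N%:R :> R by rewrite ltr0n.
(* The tail at the radius chosen below is M (1 + t) exp(-2 kap t); half of this rate absorbs the
   factor 1 + t. *)
pose kap := omega * b / (2 * N%:R) / 2.
have kap0 : 0 < kap by rewrite /kap !divr_gt0 ?mulr_gt0.
pose D1 := (c1 + vol) * A0; pose D2 := M * (1 + kap^-1).
pose eps := Num.min (omega / 2) kap.
have eps0 : 0 < eps by rewrite lt_min kap0 divr_gt0.
have D10 : 0 <= D1 by rewrite mulr_ge0// addr_ge0// ltW.
have D20 : 0 <= D2 by rewrite mulr_ge0// addr_ge0// invr_ge0 ltW.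
(* Since exp(eps t) >= 1 + eps t >= 2 (D1 + D2), the sum of the two contributions is at most 1/2. *)
pose t := Num.max 1 (2 * (D1 + D2) / eps).
have t1 : 1 <= t by rewrite le_max lexx.
have t0 : 0 < t by exact: lt_le_trans t1.
have key : D1 * expR (- (omega / 2 * t)) + D2 * expR (- (kap * t)) <= 2^-1.
  have e1 : expR (- (omega / 2 * t)) <= expR (- (eps * t)).
    by rewrite ler_expR lerN2 ler_pM2r// ge_min lexx.
  have e2 : expR (- (kap * t)) <= expR (- (eps * t)).
    by rewrite ler_expR lerN2 ler_pM2r// ge_min lexx orbT.
  apply: (@le_trans _ _ ((D1 + D2) * expR (- (eps * t)))).
    by rewrite mulrDl lerD// ler_wpM2l.
  rewrite expRN ler_pdivrMr ?expR_gt0// [leRHS]mulrC.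
  apply: (@le_trans _ _ ((1 + eps * t) / 2)); last first.
    by rewrite ler_pM2r ?invr_gt0// expR_ge1Dx.
  rewrite ler_pdivlMr// mulrC.
  have : 2 * (D1 + D2) <= eps * t.
    rewrite -ler_pdivrMl// mulrC /t; rewrite [X in X <= _](_ : _ = 2 * (D1 + D2) / eps).
      by rewrite le_max lexx orbT.
    by [].
  by move=> h; apply: (le_trans h); rewrite lerDr.
exists (1 + t); first by rewrite addr_gt0.
(* The radius for which r^N = exp(omega t / 2). *)
move=> x; pose r := expR (omega * t / (2 * N%:R)).
have r0 : 0 < r by exact: expR_gt0.
have r1 : 1 <= r by rewrite -expR0 ler_expR mulr_ge0 ?mulr_ge0 ?invr_ge0 ?mulr_ge0 ?ltW.
have rN : r ^+ N = expR (omega / 2 * t).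
  by rewrite /r -expRM_natl; congr expR; field; rewrite lt0r_neq0.
pose B := eball x r; have mB : measurable B := measurable_eball x r.
pose beta := r ^+ N * vol; have beta0 : 0 < beta by rewrite mulr_gt0// exprn_gt0.
(* Division by [cc] gives the indicator function of the ball a Morrey norm of at most 1. *)
pose cc := c1 + beta; have cc0 : 0 < cc by rewrite ltr_wpDl.
pose f y := cc^-1 * \1_B y.
have mf : measurable_fun setT f.
  by apply: measurable_funM => //; exact: measurable_indic.
have f0 y : 0 <= f y <= cc^-1.
  by rewrite /f indicE; case: (_ \in _); rewrite ?mulr1 ?mulr0 ?lexx ?invr_ge0 ltW.
have intB : (\int[leb N]_y (\1_B y)%:E = beta%:E)%E.
  by apply: etrans (volE x r r0); rewrite integral_indic// setIT.
have hB : nnm (fun y => (\1_B y)%:E : \bar R).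
  by split => [|y]; [apply/measurable_EFinP; exact: measurable_indic|rewrite lee_fin].
have hBC : nnm (fun y => (\1_(~` B) y)%:E : \bar R).
  split => [|y]; last by rewrite lee_fin.
  by apply/measurable_EFinP; apply: measurable_indic; exact: measurableC.
have hf : nnm (EFin \o f).
  split => [|y]; first exact/measurable_EFinP.
  by rewrite lee_fin; have /andP[] := f0 y.
have Pf : (P (EFin \o f) (1 + t, x)%R <= (A0 * expR (- (omega * t)))%:E)%E.
  apply: (le_trans (perturb_sem hK mW WL x hf ltr01 t0)).
  apply: (le_trans (perturb_le_heat hK mW W0 WL _ (nnm_row t (nnm_perturb hK mW WL hf)))).
  apply: (dec t f cc^-1 beta x) => //; first by rewrite invr_gt0.
    by rewrite mulVf// gt_eqF.
  rewrite (_ : (fun y => _) = fun y => (cc^-1%:E * (\1_B y)%:E)%E)//.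
  rewrite nnm_integralZl ?lee_fin ?invr_ge0 ?(ltW cc0)//.
  by rewrite intB -EFinM.
have PB : (P (fun y => (\1_B y)%:E) (1 + t, x)%R <= (cc * (A0 * expR (- (omega * t))))%:E)%E.
  rewrite (_ : (fun y => _) = fun y => (cc%:E * (EFin \o f) y)%E); last first.
    by apply/funext => y; rewrite /f/= -EFinM mulrA divff ?mul1r// gt_eqF.
  have ccE : (0 <= cc%:E)%E by rewrite lee_fin ltW.
  apply: (le_trans (perturb_scale hK mW WL _ hf ccE)).
  by rewrite EFinM; apply: lee_wpmul2l.
have PBC : (P (fun y => (\1_(~` B) y)%:E) (1 + t, x)%R <= (1 * (M * (1 + t) * r^-1 `^ b))%:E)%E.
  apply: (le_trans (perturb_le_heat hK mW W0 WL _ hBC)).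
  apply: (sconv_far tail _ r0) => //; first by rewrite addr_gt0.
    by move=> y; rewrite lee_fin indicE; case: (_ \in _).
  move=> y xy; rewrite indicE memNset//= => /(_ _); apply.
  by rewrite /B /eball/= enorm_distC.
have -> : one_fun = (fun y => (\1_B y)%:E + (\1_(~` B) y)%:E)%E.
  apply/funext => y; rewrite -EFinD !indicE in_setC.
  by case: (_ \in _); rewrite ?addr0 ?add0r.
apply: (le_trans (perturb_subadd hK mW WL _ hB hBC)).
apply: (le_trans (leeD PB PBC)); rewrite -EFinD lee_fin.
apply: le_trans key; apply: lerD.
  rewrite /cc mulrA; apply: (@le_trans _ _ (((c1 + vol) * r ^+ N * A0) * expR (- (omega * t)))).
    apply: ler_wpM2r; first exact: expR_ge0.
    apply: ler_wpM2r => //; rewrite mulrDl [vol * _]mulrC lerD2r.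
    by rewrite ler_peMr// exprn_ege1.
  have e : expR (- (omega / 2 * t)) = expR (omega / 2 * t) * expR (- (omega * t)).
    by rewrite -expRD; congr expR; field.
  by rewrite rN /D1 e le_eqVlt; apply/orP; left; apply/eqP; ring.
have rb : r^-1 `^ b = expR (- (2 * kap * t)).
  rewrite /r -expRN -expRM; congr expR; rewrite /kap; field.
  by rewrite lt0r_neq0.
have h1t : 1 + t <= (1 + kap^-1) * expR (kap * t).
  rewrite mulrDl mul1r lerD//; first by rewrite -expR0 ler_expR mulr_ge0// ltW.
  by rewrite ler_pdivlMl// (le_trans _ (expR_ge1Dx _))// lerDr.
have e : expR (- (kap * t)) = expR (kap * t) * expR (- (2 * kap * t)).
  by rewrite -expRD; congr expR; ring.
rewrite rb mul1r /D2 e mulrA -[leLHS]mulrA -[leRHS]mulrA -[X in _ <= X]mulrA.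
apply: ler_wpM2l => //; rewrite mulrA; apply: ler_wpM2r => //; exact: expR_ge0.
Qed.

(** By monotonicity each further time T halves P_t 1, which gives the rate ln 2 / T; the factor 2
    accounts for the last incomplete period. *)
Lemma perturb_one_decay (T : R) : 0 < T -> (forall x, (P one_fun (T, x) <= 2^-1%:E)%E) ->
  forall t x, 0 < t -> (P one_fun (t, x) <= (2 * expR (- (ln 2 / T * t)))%:E)%E.
Proof.
move=> T0 PT.
have step t x : 0 < t -> (P one_fun (t + T, x)%R <= 2^-1%:E * P one_fun (t, x))%E.
  move=> t0; apply: (le_trans (perturb_sem hK mW WL x h1 t0 T0)).
  have hPT := nnm_row T (nnm_perturb hK mW WL h1).
  have h2 : (0 <= 2^-1%:E :> \bar R)%E by rewrite lee_fin.
  apply: le_trans (perturb_scale hK mW WL _ h1 h2).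
  apply: (perturb_mono hK mW WL _ hPT) => [|y]; last by rewrite /one_fun mule1.
  by apply: nnmM => //; exact: nnm_cst.
have main n t x : 0 < t -> t <= n.+1%:R * T ->
    (P one_fun (t, x) <= (2 * expR (- (ln 2 / T * t)))%:E)%E.
  elim: n t x => [|n IH] t x t0 tn.
    apply: (@le_trans _ _ 1%E).
      exact: (perturb_le_cst hK mW W0 WL _ h1 (fun=> le_refl _) ler01).
    rewrite lee_fin -ler_pdivrMl// mulr1 -[leLHS]lnK ?posrE// ler_expR lnV ?posrE//.
    rewrite lerN2 mulrAC ler_pdivrMr//; apply: ler_wpM2l; first by rewrite ln_ge0// ler1n.
    by rewrite mul1r in tn.
  have [tT|Tt] := leP t T; first by apply: IH => //; apply: (le_trans tT); rewrite ler_peMl ?ler1n// ltW.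
  have tT0 : 0 < t - T by rewrite subr_gt0.
  rewrite -(subrK T t); apply: (le_trans (step _ _ tT0)).
  have IHt : (P one_fun (t - T, x)%R <= (2 * expR (- (ln 2 / T * (t - T))))%:E)%E.
    by apply: IH => //; rewrite lerBlDr -{2}(mul1r T) -mulrDl natr1.
  have h2 : (0 <= 2^-1%:E :> \bar R)%E by rewrite lee_fin.
  apply: (le_trans (lee_wpmul2l h2 IHt)); rewrite subrK -EFinM lee_fin.
  rewrite mulrA mulVf// mul1r mulrBr opprB expRD divfK ?gt_eqF// lnK ?posrE//.
move=> t x t0; apply: (main (Num.truncn (t / T))) => //.
by rewrite -ler_pdivrMr// ltW// truncnS_gt.
Qed.

(* Duhamel's formula gives 1/2 <= \int_0^T S_{T-s} W (x) ds for every x; for x in a ball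
   of radius r, only the values of W on the ball of radius 2 r matter when r is large *)
Lemma potential_ball_lower (T : R) : 0 < T -> (forall x, (P one_fun (T, x) <= 2^-1%:E)%E) ->
  exists2 d : R, 0 < d & exists2 r0 : R, 0 < r0 & forall r x0, r0 <= r ->
    ((d * r ^+ N)%:E <= \int[leb N]_(y in eball x0 (2 * r)) (W y)%:E)%E.
Proof.
move=> T0 PT.
have [M M0 [b b0 tail]] := heat_tail hK.
have [vol vol0 volE] := @leb_eball R N.
(* The values of W outside of the large ball contribute at most T L (M T r^(-b)) = c r^(-b), and r^b
   >= 4 c + 1 makes this at most 1/4. *)
pose c := T * (L * (M * T)).
have c0 : 0 <= c by rewrite /c !mulr_ge0// ltW.
exists (vol / (4 * T)); first by rewrite divr_gt0// mulr_gt0.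
exists ((4 * c + 1) `^ b^-1); first by rewrite powR_gt0// ltr_wpDl// mulr_ge0.
move=> r x0 rr.
have r0 : 0 < r by apply: lt_le_trans rr; rewrite powR_gt0// ltr_wpDl// mulr_ge0.
have cr : c * r^-1 `^ b <= 4^-1.
  have rb : 4 * c + 1 <= r `^ b.
    have := @ge0_ler_powR R b (ltW b0) ((4 * c + 1) `^ b^-1) r.
    rewrite !nnegrE powR_ge0 (ltW r0) => /(_ isT isT rr).
    by rewrite -powRrM mulVf ?gt_eqF// powRr1// addr_ge0// mulr_ge0.
  have rb0 : 0 < r `^ b by rewrite powR_gt0.
  have -> : r^-1 `^ b = (r `^ b)^-1 by rewrite -powR_inv1 ?ltW// -powRrM mulN1r powRN.
  rewrite ler_pdivrMr//; lra.
pose B2 := eball x0 (2 * r).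
have mB2 : measurable B2 by exact: measurable_eball.
have hW : nnm (EFin \o W) by split => [|y]; [exact/measurable_EFinP|rewrite lee_fin].
have hWE E : measurable E -> nnm ((EFin \o W) \_ E).
  move=> mE; split => [|y]; last by rewrite patchE; case: ifPn => // _; exact: hW.2.
  by apply/(measurable_restrictT _ _).1 => //; apply: measurable_funTS; exact: hW.1.
(* W does not depend on time; the cutoff at negative times makes the convolution an integral over
   (0, T). *)
pose ti s : \bar R := (\1_(`]0%R, +oo[%classic) s)%:E.
have hti : nnm (ti : measurableTypeR R -> _).
  by split => [|s]; [apply/measurable_EFinP; exact: measurable_indic|rewrite lee_fin].
pose F E (q : Q) := (((EFin \o W) \_ E) q.2 * ti q.1)%E.
have hF E : measurable E -> nnm (F E).
  move=> mE; apply: nnmM; first exact: (nnm_comp (hWE E mE) measurable_snd).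
  exact: (nnm_comp hti measurable_fst).
pose I E x := conv (dheat K 0) (F E) (T, x).
have FE E s y : F E (s, y) = if 0 < s then ((EFin \o W) \_ E) y else 0%E.
  rewrite /F /ti indicE; case: ifPn => s0.
    by rewrite mem_set ?mule1//= in_itv/= s0.
  by rewrite memNset ?mule0//= in_itv/= (negbTE s0).
have innerE E s x : (\int[leb N]_y (dheat K 0 (qsub (T, x) (s, y)) * F E (s, y)))%E =
    if (0 < s < T) then sconv (dheat K 0) ((EFin \o W) \_ E) (T - s, x) else 0%E.
  case: ifPn => [/andP[s0 sT]|].
    by apply: eq_integral => y _; rewrite FE s0.
  rewrite negb_and -!leNgt => /orP[s0|sT]; apply: integral0_eq => y _.
    by rewrite FE ltNge s0 mule0.
  by rewrite dheat_le0 ?mul0e//= subr_le0.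
have mT : measurable (setT : set 'rV[R]_N) by exact: measurableT.
have half x : (2^-1%:E <= I setT x)%E.
  have D := perturb_duhamel hK mW W0 WL (T, x) h1 (fun=> le_refl _) ler01.
  have S1 : sconv (dheat K 0) one_fun (T, x) = 1%E.
    rewrite /sconv; under eq_integral do rewrite mule1.
    rewrite (leb_reflect x (nnm_row T h0)).
    by under eq_integral do rewrite dheat0E/=; exact: (heat_int1 hK).
  have h : (conv (dheat K 0) (fun p => potW W p * P one_fun p) (T, x) <= I setT x)%E.
    apply: le_conv => //.
    - apply: nnmM; [exact: nnm_potW|exact: (nnm_perturb hK mW WL h1)].
    - exact: hF.
    move=> [s y]; rewrite FE patchE mem_set//; case: ifPn => s0.
      rewrite -[leRHS]mule1; apply: lee_wpmul2l; first by rewrite lee_fin.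
      exact: (perturb_le_cst hK mW W0 WL _ h1 (fun=> le_refl _) ler01).
    by rewrite (perturb_le0 hK mW W0 WL) ?mule0// leNgt.
  apply: le_trans h; move: D; rewrite S1 => D.
  have : (1 <= 2^-1%:E + conv (dheat K 0) (fun p => potW W p * P one_fun p) (T, x))%E.
    by rewrite -[leLHS]D; apply: leeD2r; exact: PT.
  rewrite -leeBlDl// => /le_trans h; apply: le_trans (h _ (le_refl _)).
  by rewrite -EFinB lee_fin; lra.
have split x : I setT x = (I B2 x + I (~` B2) x)%E.
  rewrite /I -convDr//; [|exact: hF|by apply: hF; exact: measurableC].
  congr (conv _ _ _); apply/funext => -[s y]; rewrite !FE; case: ifPn => _; last by rewrite adde0.
  rewrite !patchE in_setT in_setC.
  by case: (_ \in B2); rewrite /= ?adde0 ?add0e.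
have far x : eball x0 r x -> (I (~` B2) x <= 4^-1%:E)%E.
  move=> xr; rewrite /I /conv nu_integral; last first.
    by apply: nnm_conv_in => //; apply: hF; exact: measurableC.
  under eq_integral do rewrite innerE.
  apply: (@le_trans _ _ (\int[lam]_(s in `]0%R, T[) (L * (M * T * r^-1 `^ b))%:E)%E).
    rewrite [leRHS]integral_mkcond; apply: ge0_le_integral => //.
    - move=> s _; case: ifPn => // _.
      by have := (nnm_sconv h0 (hWE _ (measurableC mB2))).2.
    - have := (nnm_integral (leb N) (h := fun s y => dheat K 0 (qsub (T, x) (s, y)) * F (~` B2) (s, y))%E
        (nnm_uncurry (nnm_conv_in (T, x) h0 (hF _ (measurableC mB2))))).1.
      by under eq_fun do rewrite innerE.
    - by apply/(measurable_restrictT _ _).1.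
    move=> s _; rewrite patchE.
    have -> : (s \in `]0%R, T[%classic) = (0 < s < T) by apply/idP/idP; rewrite inE/= in_itv.
    case: ifPn => // /andP[s0 sT]; have Ts0 : 0 < T - s by rewrite subr_gt0.
    apply: (le_trans (sconv_far tail Ts0 r0 L0 (hWE _ (measurableC mB2)) _ _)).
    - by move=> y; rewrite patchE; case: ifPn => // _; rewrite lee_fin.
    - move=> y xy; rewrite patchE memNset//=; apply; rewrite /B2 /eball/=.
      have := enormD (y - x) (x - x0); rewrite subrKA => /le_lt_trans; apply.
      by rewrite mulr_natl mulr2n ltrD// enorm_distC.
    rewrite lee_fin ler_wpM2l// ler_wpM2r ?powR_ge0// ler_wpM2l//.
    by rewrite lerBlDr lerDl ltW.
  rewrite integral_cst//= lebesgue_measure_itv/= lte_fin T0 oppr0 adde0 -EFinM lee_fin.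
  by move: cr; rewrite /c; lra.
have near x : eball x0 r x -> (4^-1%:E <= I B2 x)%E.
  move=> xr; have := half x; rewrite split => h.
  have : (2^-1%:E <= I B2 x + 4^-1%:E)%E by apply: (le_trans h); apply: leeD2l; exact: far.
  rewrite -leeBlDr// => /(le_trans _); apply.
  by rewrite -EFinB lee_fin; lra.
have hI : nnm (I B2) by exact: (nnm_row T (nnm_conv h0 (hF B2 mB2))).
have WB2 : (\int[leb N]_(y in B2) (W y)%:E)%E = (\int[leb N]_y ((EFin \o W) \_ B2) y)%E.
  by rewrite integral_mkcond.
(* Each S_(T-s) preserves the integral over the whole space, and the times s fill an interval of
   length T. Compared with the lower bound r^N vol / 4, this gives the constant vol / (4 T). *)
have up : (\int[leb N]_x I B2 x <= T%:E * \int[leb N]_(y in B2) (W y)%:E)%E.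
  rewrite /I /conv; under eq_integral do rewrite (nu_integral (nnm_conv_in _ h0 (hF B2 mB2))).
  have hxs : nnm (fun z : 'rV[R]_N * R => \int[leb N]_y (dheat K 0 (qsub (T, z.1) (z.2, y)) * F B2 (z.2, y)))%E.
    apply: (nnm_integral (leb N) (h := fun (z : 'rV[R]_N * R) y =>
      (dheat K 0 (qsub (T, z.1) (z.2, y)) * F B2 (z.2, y))%E)).
    have m11 : measurable_fun setT (fun w : ('rV[R]_N * R) * 'rV[R]_N => w.1.1).
      exact: (measurableT_comp measurable_fst measurable_fst).
    have m12 : measurable_fun setT (fun w : ('rV[R]_N * R) * 'rV[R]_N => w.1.2).
      exact: (measurableT_comp measurable_snd measurable_fst).
    have mz : measurable_fun setT (fun w : ('rV[R]_N * R) * 'rV[R]_N => (w.1.2, w.2) : Q).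
      exact: measurable_fun_pair.
    apply: nnmM; last exact: (nnm_comp (hF B2 mB2) mz).
    apply: (nnm_comp h0); apply: measurable_fun_qsub => //.
    exact: measurable_fun_pair.
  rewrite (nnm_swap (leb N) lam (h := fun x s => (\int[leb N]_y (dheat K 0 (qsub (T, x) (s, y)) * F B2 (s, y)))%E) hxs).
  have -> : (T%:E * \int[leb N]_(y in B2) (W y)%:E = \int[lam]_(s in `]0%R, T[)
      (\int[leb N]_(y in B2) (W y)%:E))%E.
    rewrite integral_cst//= lebesgue_measure_itv/= lte_fin T0 oppr0 adde0 muleC.
    by [].
  rewrite [leRHS]integral_mkcond le_eqVlt; apply/orP; left; apply/eqP.
  apply: eq_integral => s _; rewrite patchE.
  have -> : (s \in `]0%R, T[%classic) = (0 < s < T) by apply/idP/idP; rewrite inE/= in_itv.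
  under eq_integral do rewrite innerE.
  case: ifPn => [/andP[s0 sT]|_]; last by rewrite integral0.
  have Ts0 : 0 < T - s by rewrite subr_gt0.
  rewrite /sconv/= (integral_conv1 (nnm_row (T - s) h0) (hWE B2 mB2)) WB2.
  rewrite (_ : (\int[leb N]_z dheat K 0 (T - s, z)%R = 1)%E) ?mul1e//.
  by under eq_integral do rewrite dheat0E/=; exact: (heat_int1 hK).
have low : ((4^-1 * (r ^+ N * vol))%:E <= \int[leb N]_x I B2 x)%E.
  apply: (@le_trans _ _ (\int[leb N]_(x in eball x0 r) 4^-1%:E)%E).
    by rewrite integral_cst//=; [rewrite volE|exact: measurable_eball].
  rewrite integral_mkcond; apply: ge0_le_integral => //.
  - by move=> x _; rewrite patchE; case: ifPn => // _; rewrite lee_fin.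
  - by apply/(measurable_restrictT _ _).1 => //; exact: measurable_eball.
  - exact: hI.1.
  move=> x _; rewrite patchE; case: ifPn => [/set_mem|_]; [exact: near|exact: hI.2].
have := le_trans low up.
rewrite muleC -lee_pdivrMr// => h; apply: le_trans h.
rewrite -EFinM lee_fin le_eqVlt; apply/orP; left; apply/eqP; field.
by rewrite lt0r_neq0.
Qed.

End decay.

Lemma integrable_heat_bounded (R : realType) (N : nat) (K : R -> 'rV[R]_N -> R)
    (hK : is_heat K) t x (f : 'rV[R]_N -> R) (c : R) :
  measurable_fun setT f -> {ae leb N, forall y, `|f y| <= c} ->
  (leb N).-integrable setT (EFin \o (fun y => K t (x - y) * f y)).
Proof.
move=> mf fc.
have hk := nnm_dheat_refl hK 0 t x.
have mk : measurable_fun setT (fun y : 'rV[R]_N => K t (x - y)).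
  by have := hk.1; under eq_fun do rewrite dheat0E/=; move/measurable_EFinP.
pose c' := Num.max c 0; have c'0 : 0 <= c' by rewrite le_max lexx orbT.
have c'E : (0 <= c'%:E)%E by rewrite lee_fin.
apply/integrableP; split; first by apply/measurable_EFinP; exact: measurable_funM.
apply: (@le_lt_trans _ _ (\int[leb N]_y (dheat K 0 (t, x - y)%R * c'%:E))%E).
  apply: ae_ge0_le_integral => //.
  - apply: measurableT_comp => //; apply/measurable_EFinP; exact: measurable_funM.
  - by move=> y _; rewrite mule_ge0// hk.2.
  - by apply: emeasurable_funM => //; exact: hk.1.
  apply: filterS fc => y fy _; rewrite dheat0E/= lee_fin normrM ger0_norm ?(heat_ge0 hK)//.
  by apply: ler_wpM2l; [exact: heat_ge0|rewrite (le_trans fy)// le_max lexx].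
rewrite (nnm_integralZr _ c'E hk) (leb_reflect x (nnm_row t (nnm_dheat hK 0))).
under eq_integral do rewrite dheat0E/=.
apply: (@le_lt_trans _ _ (1 * c'%:E)%E); last by rewrite mul1e ltry.
by apply: lee_wpmul2r => //; exact: heat_int_le1.
Qed.

(** * Representation of solutions with bounded data *)

Section representation.
Context {R : realType} {N : nat} (mu : R) (mu0 : 0 < mu) (mu1 : mu <= 1).
Notation lam := (@lebesgue_measure R).
Notation K := (@heatk R N mu).
Context (V W : 'rV[R]_N -> R) (L : R) (mV : measurable_fun setT V)
  (mW : measurable_fun setT W) (L0 : 0 < L).
Context (W0 : forall y, 0 <= W y) (WL : forall y, W y <= L)
  (VW : {ae leb N, forall y, V y = - W y}).
Notation P := (perturb K W L).
Notation U := (perturb_sol mu W L).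
Let hK := is_heat_heatk mu0 mu1 : is_heat K.

Let pos (f : 'rV[R]_N -> R) y := Num.max (f y) 0.
Let neg (f : 'rV[R]_N -> R) y := Num.max (- f y) 0.

Let VL : {ae leb N, forall y, `|V y| <= L}.
Proof. by apply: filterS VW => y ->; rewrite normrN ger0_norm. Qed.

(** Bounded data need not be integrable, so the evolutions of the positive and negative parts are
    not known to belong to the Morrey class. Uniqueness asks less of the comparison function:
    boundedness, joint measurability and the integral equation at every point. *)
Lemma perturbed_solution_repr p l (phi : 'rV[R]_N -> R) (a : R) u : (1 <= p)%E ->
  measurable_fun setT phi -> 0 < a -> (forall y, `|phi y| <= a) ->
  perturbed_solution mu V p l phi u -> forall t, 0 < t ->
  {ae leb N, forall x, u t x = U (pos phi) t x - U (neg phi) t x}.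
Proof.
move=> p1 mphi a0 phia [u1 u2 u3 u4] t t0.
have mpos : measurable_fun setT (pos phi) by exact: measurable_maxr.
have mneg : measurable_fun setT (neg phi) by apply: measurable_maxr => //; exact: measurableT_comp.
have pos0 y : 0 <= pos phi y by rewrite le_max lexx orbT.
have neg0 y : 0 <= neg phi y by rewrite le_max lexx orbT.
have posa y : pos phi y <= a by rewrite ge_max (ltW a0) andbT (le_trans (ler_norm _)).
have nega y : neg phi y <= a.
  by rewrite ge_max (ltW a0) andbT (le_trans (ler_norm _))// normrN.
have hpos : nnm (EFin \o pos phi) by split => [|y]; [exact/measurable_EFinP|rewrite lee_fin].
have hneg : nnm (EFin \o neg phi) by split => [|y]; [exact/measurable_EFinP|rewrite lee_fin].
have mUq (f : 'rV[R]_N -> R) : nnm (EFin \o f) ->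
    measurable_fun setT (fun q : measurableTypeR R * 'rV[R]_N => U f q.1 q.2).
  move=> hf; have := (nnm_perturb hK mW WL hf).1.
  move=> m; have := measurableT_comp (fine_measurable measurableT) m.
  by apply: eq_measurable_fun => -[s x].
have Ub f s x : nnm (EFin \o f) -> (forall y, f y <= a) -> 0 <= U f s x <= a.
  move=> hf fa.
  have Pa : (P (EFin \o f) (s, x) <= a%:E)%E.
    by apply: (perturb_le_cst hK mW W0 WL) => //; exact: ltW.
  have P0 := (nnm_perturb hK mW WL hf).2 (s, x).
  rewrite /perturb_sol fine_ge0//= -lee_fin fineK// ge0_fin_numE//.
  exact: le_lt_trans Pa (ltry _).
have mUt f s : nnm (EFin \o f) -> measurable_fun setT (U f s).
  by move=> hf; exact: (measurable_sec1 s (mUq f hf)).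
pose v s x := U (pos phi) s x - U (neg phi) s x.
pose g s x := \int[leb N]_y (K s (x - y) * phi y).
have iVU f s r x : nnm (EFin \o f) -> (forall y, f y <= a) ->
    (leb N).-integrable setT (EFin \o (fun y => K r (x - y) * (V y * U f s y))).
  move=> hf fa; apply: (@integrable_heat_bounded _ _ _ hK r x _ (L * a)).
    by apply: measurable_funM => //; exact: mUt.
  apply: filterS VL => y Vy; rewrite normrM; apply: ler_pM => //.
  by have /andP[h1 h2] := Ub f s y hf fa; rewrite ger0_norm.
apply: (@solution_unique _ _ K hK V L mV L0 VL p l p1 u v g (2 * a)) => //.
- move=> s s0; apply: filterS (u4 s s0) => x [iF eF].
  have FE : {in `]0%R, s[%classic, (fun r => frac_heat mu (s - r) (V \* u r) x) =1
      (fun r => \int[leb N]_y (K (s - r) (x - y) * (V y * u r y)))}.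
    move=> r; rewrite inE/= in_itv/= => /andP[_ rs].
    by rewrite frac_heatE ?subr_gt0.
  split.
    apply: eq_integrable iF => //.
    by move=> r rI /=; rewrite FE.
  rewrite eF frac_heatE//; congr (_ + _).
  by apply: eq_Rintegral => r rI; rewrite FE.
- apply: measurable_funB; exact: mUq.
- move=> s x; have /andP[p0 pa] := Ub _ s x hpos posa.
  have /andP[n0 na] := Ub _ s x hneg nega.
  rewrite (le_trans (ler_normB _ _))// !ger0_norm// mulr_natl mulr2n lerD//.
- move=> s s0 x.
  have [ip ep] := perturb_sol_eq mu0 mu1 mV mW W0 WL VW mpos pos0 posa a0 x s0.
  have [im em] := perturb_sol_eq mu0 mu1 mV mW W0 WL VW mneg neg0 nega a0 x s0.
  have mI : measurable (`]0%R, s[%classic : set (measurableTypeR R)) by exact: measurable_itv.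
  have FE : {in `]0%R, s[%classic, (fun r => frac_heat mu (s - r) (V \* U (pos phi) r) x -
        frac_heat mu (s - r) (V \* U (neg phi) r) x) =1
      (fun r => \int[leb N]_y (K (s - r) (x - y) * (V y * v r y)))}.
    move=> r; rewrite inE/= in_itv/= => /andP[_ rs].
    rewrite !frac_heatE ?subr_gt0// -RintegralB//; [|exact: iVU|exact: iVU].
    by apply: eq_Rintegral => y _; rewrite /v -!mulrBr.
  split.
    have := integrableB mI ip im; apply: eq_integrable => //.
    by move=> r rI /=; rewrite -EFinB -FE.
  rewrite /v ep em opprD addrACA; congr (_ + _).
    rewrite !frac_heatE// /g -RintegralB//.
    + apply: eq_Rintegral => y _; rewrite -mulrBr; congr (_ * _).
      rewrite /pos /neg; case: (leP (phi y) 0) => h.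
        by rewrite max_l ?oppr_ge0// sub0r opprK.
      by rewrite max_r ?subr0// oppr_le0 ltW.
    + apply: (@integrable_heat_bounded _ _ _ hK s x _ a) => //.
      by apply: aeW => y; rewrite ger0_norm.
    + apply: (@integrable_heat_bounded _ _ _ hK s x _ a) => //.
      by apply: aeW => y; rewrite ger0_norm.
  rewrite -RintegralB//; by apply: eq_Rintegral => r rI; rewrite FE.
Qed.

End representation.

(** * Essential bounds and divergent integrals *)

Section Linfty_norm.
Context {R : realType} {N : nat}.
Implicit Types (f : 'rV[R]_N -> R) (c : R).

Let leb_setT_gt0 : (0 < leb N [set: 'rV[R]_N])%E.
Proof.
apply: (@lt_le_trans _ _ (leb N (eball 0 1))); first exact: leb_eball_gt0.
by apply: le_measure => //; rewrite inE//; exact: measurable_eball.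
Qed.

Lemma Lnorm_Linfty_leP f c :
  (Lnorm (leb N) +oo (EFin \o f) <= c%:E)%E <-> {ae leb N, forall y, `|f y| <= c}.
Proof.
rewrite unlock leb_setT_gt0; split.
  by move=> /ess_supP; apply: filterS => y.
by move=> h; apply/ess_supP; apply: filterS h => y.
Qed.

Lemma Linfty_ae_bounded f : (Lnorm (leb N) +oo (EFin \o f) < +oo)%E ->
  exists2 c : R, 0 < c & {ae leb N, forall y, `|f y| <= c}.
Proof.
move=> foo; have f0 : (0 <= Lnorm (leb N) +oo (EFin \o f))%E by exact: Lnorm_ge0.
exists (Num.max (fine (Lnorm (leb N) +oo (EFin \o f))) 1).
  by rewrite lt_max ltr01 orbT.
apply/Lnorm_Linfty_leP; rewrite -[leLHS]fineK ?ge0_fin_numE//.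
by rewrite lee_fin le_max lexx.
Qed.

End Linfty_norm.

(* No measurability of D is assumed: an open set need not be known to be measurable *)
Lemma integral_eqNy (R : realType) d (T : measurableType d)
    (m : {measure set T -> \bar R}) (D : set T) (f : T -> \bar R) :
  measurable_fun setT f -> {ae m, forall x, (f x <= 0)%E} ->
  (forall M : R, exists2 E, E `<=` D & (M%:E <= \int[m]_(x in E) f^\- x)%E) ->
  (\int[m]_(x in D) f x = -oo)%E.
Proof.
move=> mf f0 big.
(* The integral of a nonnegative function is a supremum over simple functions below its restriction,
   and the family for E is contained in that for F. *)
have mono (h : T -> \bar R) (E F : set T) : (forall x, (0 <= h x)%E) -> E `<=` F ->
    (\int[m]_(x in E) h x <= \int[m]_(x in F) h x)%E.
  move=> h0 EF; rewrite !ge0_integralE//.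
  apply: le_ereal_sup => _ [g /= gh <-]; exists g => //= x.
  apply: (le_trans (gh x)); rewrite !patchE; case: ifPn => [/set_mem Ex|_].
    by rewrite mem_set//; exact: EF.
  by case: ifPn.
have fp : (\int[m]_(x in D) f^\+ x = 0)%E.
  apply/eqP; rewrite eq_le; apply/andP; split; last by apply: integral_ge0 => x _; exact: funepos_ge0.
  apply: (le_trans (mono _ D setT (fun x => funepos_ge0 f x) (fun x _ => I))).
  rewrite le_eqVlt; apply/orP; left; apply/eqP.
  transitivity (\int[m]_x (cst 0%E x))%E; last by rewrite integral0.
  apply: ae_eq_integral => //; first exact: measurable_funepos.
  by apply: filterS f0 => x fx _; rewrite funeposE max_r.
have fn : (\int[m]_(x in D) f^\- x = +oo)%E.
  apply/eqyP => M _; have [E ED ME] := big M; apply: (le_trans ME).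
  by apply: mono => // x; exact: funeneg_ge0.
by rewrite integralE fp fn.
Qed.

(** * Decay in the sup norm and the Arendt-Batty condition *)

Theorem theorem7p3 (R : realType) (N : nat) (mu : R) (V : 'rV[R]_N -> R)
  (mu_gt0 : 0 < mu) (mu_le1 : mu <= 1)
  (V_meas : measurable_fun setT V)
  (V_Linfty : (Lnorm (leb N) +oo (EFin \o V) < +oo)%E)
  (V_le0 : {ae leb N, forall x, V x <= 0})
  (p q : \bar R) (s l : R)
  (p_ge1 : (1 <= p)%E) (q_ge1 : (1 <= q)%E)
  (s_gt0 : 0 < s) (s_le_l : s <= l) (l_le_N : l <= N%:R)
  (sq_le_lp : rdive s q <= rdive l p)
  (S_decay : exists C omega : R, [/\ 0 < C, 0 < omega & forall t : R, 0 < t ->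
     (morrey_opnorm p l q s (perturbed_semigroup mu V p l t)
      <= (C * expR (- (omega * t))
          / (t `^ ((2 * mu)^-1 * (rdive l p - rdive s q))))%:E)%E]) :
  (0 < exp_type_Linfty mu V)%E /\
  forall G : set 'rV[R]_N, large_open G ->
    (\int[leb N]_(x in G) (V x)%:E = -oo)%E.
Proof.
have hK := is_heat_heatk mu_gt0 mu_le1 : is_heat (@heatk R N mu).
have [L L0 VL] := Linfty_ae_bounded V_Linfty.
(* A representative of -V whose values lie in [0, L] everywhere, as the Picard iteration
   requires. *)
pose W y := Num.min (Num.max (- V y) 0) L.
have mW : measurable_fun setT W.
  apply: measurable_minr => //; apply: measurable_maxr => //.
  exact: measurableT_comp.
have W0 y : 0 <= W y by rewrite le_min (ltW L0) andbT le_max lexx orbT.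
have WL y : W y <= L by rewrite ge_min lexx orbT.
have VW : {ae leb N, forall y, V y = - W y}.
  apply: filterS2 V_le0 VL => y V0 VyL; rewrite /W max_l ?oppr_ge0//.
  by rewrite min_l ?opprK// -(ler0_norm V0).
have N0 : (0 < N)%N by rewrite -(@ltr0n R) (lt_le_trans s_gt0)// (le_trans s_le_l).
have l0 : 0 <= l by rewrite (le_trans (ltW s_gt0)).
have [C [omega [C0 omega0 dec]]] := S_decay.
have [c1 c10 mn] := @morrey_norm_le R N.
have [vol vol0 volE] := @leb_eball R N.
have [C1 C10 sm] := morrey_smoothing hK s ltr01 q_ge1.
have [T T0 PT] : exists2 T : R, 0 < T &
    forall x, (perturb (@heatk R N mu) W L one_fun (T, x) <= 2^-1%:E)%E.
  apply: (half_contraction hK mW W0 WL (c1 := c1) (vol := vol) (A0 := C1 * C)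
    (omega := omega)) => //; first by rewrite mulr_ge0// ltW.
  move=> t f a beta x t1 mf a0 beta0 abeta fa fb.
  have t0 : 0 < t by exact: lt_le_trans t1.
  have f0 y : 0 <= f y by have /andP[] := fa y.
  have fle y : f y <= a by have /andP[] := fa y.
  have fnorm y : `|f y| <= a by rewrite ger0_norm.
  have hf : nnm (EFin \o f) by split => [|y]; [exact/measurable_EFinP|rewrite lee_fin].
  have f1 : (morrey_norm p l f <= 1)%E.
    apply: (@le_trans _ _ (a * (c1 + beta))%:E); last by rewrite lee_fin.
    apply: mn => //; [by rewrite l0|exact: ltW|exact: ltW|].
    by under eq_integral do rewrite ger0_norm//.
  (* The solution chosen by [perturbed_semigroup]. Existence shows that it is a genuine solution,
     and uniqueness will identify it with [perturb]. *)
  pose u := xget (fun _ _ => 0) [set u | perturbed_solution mu V p l f u].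
  have hu : perturbed_solution mu V p l f u.
    apply: (xgetPex (fun _ _ => 0)); exists (perturb_sol mu W L f).
    by apply: (perturb_sol_solution mu_gt0 mu_le1 V_meas mW W0 WL VW mf f0 fle a0 _ fb) => //;
      rewrite ?l0// mulr_ge0// ltW.
  have ut : (morrey_norm q s (u t) <= (C * expR (- (omega * t)))%:E)%E.
    apply: (@le_trans _ _ (morrey_opnorm p l q s (perturbed_semigroup mu V p l t))).
      apply: ereal_sup_ubound; exists f; last by rewrite /perturbed_semigroup gt_eqF.
      by split => //; split => //; exact: le_lt_trans f1 (ltry _).
    apply: (le_trans (dec t t0)); rewrite lee_fin ler_pdivrMr ?powR_gt0//.
    rewrite ler_peMr ?mulr_ge0 ?expR_ge0 ?(ltW C0)// -[leLHS](powRr0 t) ler_powR//.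
    by rewrite mulr_ge0 ?subr_ge0// invr_ge0 mulr_ge0// ltW.
  have [mut _] : morrey p l (u t) by have [h _ _ _] := hu; exact: h.
  have Ce : 0 < C * expR (- (omega * t)) by rewrite mulr_gt0 ?expR_gt0.
  (* The bound on u(t) in M^(q,s) becomes a pointwise bound after one more unit of time. *)
  rewrite -mulrA; apply: le_trans (sm (u t) _ x mut Ce ut).
  rewrite le_eqVlt; apply/orP; left; apply/eqP; rewrite /sconv/=.
  have hk := nnm_dheat_refl hK 0 1 x.
  apply: ae_eq_integral => //.
  - exact: (nnmM hk (nnm_row t (nnm_perturb hK mW WL hf))).1.
  - apply: emeasurable_funM; first exact: hk.1.
    by apply/measurable_EFinP; exact: measurableT_comp.
  apply: filterS (perturbed_solution_repr mu_gt0 mu_le1 V_meas mW L0 W0 WL VW p_ge1 mf a0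
    fnorm hu t0) => y uy _.
  congr (_ * _)%E; rewrite uy.
  have -> : (fun y => Num.max (f y) 0) = f by apply/funext => z; rewrite max_l.
  (* The datum is nonnegative, so the evolution of its negative part is 0. *)
  have -> : perturb_sol mu W L (fun y => Num.max (- f y) 0) t y = 0.
    pose nf (z : 'rV[R]_N) := Num.max (- f z) 0.
    have hz : nnm (EFin \o nf).
      split => [|z]; last by rewrite lee_fin le_max lexx orbT.
      by apply/measurable_EFinP; apply: measurable_maxr => //; exact: measurableT_comp.
    have z0 z : ((EFin \o nf) z <= 0%:E)%E.
      by rewrite lee_fin ge_max lexx andbT oppr_le0.
    rewrite /perturb_sol (_ : perturb _ _ _ _ _ = 0%E)//; apply/eqP.
    rewrite eq_le (perturb_le_cst hK mW W0 WL _ hz z0)//=.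
    exact: (nnm_perturb hK mW WL hz).2.
  rewrite subr0 ger0_norm -?lee_fin (perturb_solE mu_gt0 mu_le1 mW W0 WL mf f0 fle a0)//.
  exact: (nnm_perturb hK mW WL hf).2.
have decay := perturb_one_decay hK mW W0 WL T0 PT.
split.
  have ln2 : 0 < ln 2 :> R by rewrite ln_gt0// ltr1n.
  apply: (@lt_le_trans _ _ (ln 2 / T)%:E); first by rewrite lte_fin divr_gt0.
  apply: ereal_sup_ubound; exists (ln 2 / T) => //; exists 2; first by rewrite ler1n.
  move=> t t0; apply: ge_ereal_sup => _ [phi [[mphi _] phi1] <-].
  rewrite le_eqVlt in t0; case/predU1P: t0 => [<-|t0].
    rewrite /perturbed_semigroup eqxx mulr0 oppr0 expR0 mulr1.
    by apply: (le_trans phi1); rewrite lee_fin ler1n.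
  rewrite /perturbed_semigroup gt_eqF//; set S := [set u | _].
  have E0 : 0 <= 2 * expR (- (ln 2 / T * t)) by rewrite mulr_ge0 ?expR_ge0.
  (* If there is no solution, the choice returns the zero function, which satisfies every bound. *)
  apply/Lnorm_Linfty_leP; have [S0|S0] := pselect (S !=set0); last first.
    rewrite xgetPN; first by apply: aeW => y; rewrite normr0.
    by move=> u Su; apply: S0; exists u.
  have := xgetPex (fun _ _ => 0) S0; set u := xget _ _ => -[u1 u2 u3 u4].
  have /Lnorm_Linfty_leP phiae := phi1.
  (* The datum is bounded by 1 only almost everywhere. Its truncation is bounded everywhere and has
     the same solutions, since the heat semigroup ignores null sets. *)
  pose psi y := Num.max (Num.min (phi y) 1) (-1).
  have mpsi : measurable_fun setT psi.
    by apply: measurable_maxr => //; exact: measurable_minr.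
  have psi1 y : `|psi y| <= 1.
    by rewrite ler_norml /psi le_max lexx orbT/= ge_max ge_min lexx orbT/=; lra.
  have psiE : {ae leb N, forall y, psi y = phi y}.
    apply: filterS phiae => y; rewrite ler_norml => /andP[lo up].
    by rewrite /psi (min_l up) max_l.
  have hu : perturbed_solution mu V +oo N%:R psi u.
    split => // r r0; apply: filterS (u4 r r0) => x [iF ->]; split => //; congr (_ + _).
    rewrite !frac_heatE//; congr fine.
    have mk : measurable_fun setT (fun y : 'rV[R]_N => heatk mu r (x - y)).
      have := (nnm_dheat_refl hK 0 r x).1.
      by under eq_fun do rewrite dheat0E/=; move/measurable_EFinP.
    apply: ae_eq_integral => //.
    - by apply/measurable_EFinP; exact: measurable_funM.
    - by apply/measurable_EFinP; exact: measurable_funM.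
    by apply: filterS psiE => y -> _.
  have repr := perturbed_solution_repr mu_gt0 mu_le1 V_meas mW L0 W0 WL VW (leey 1) mpsi
    ltr01 psi1 hu t0.
  have Ub (f : 'rV[R]_N -> R) y : measurable_fun setT f -> (forall y, 0 <= f y <= 1) ->
      0 <= perturb_sol mu W L f t y <= 2 * expR (- (ln 2 / T * t)).
    move=> mf f01.
    have hf : nnm (EFin \o f).
      by split => [|z]; [exact/measurable_EFinP|rewrite lee_fin; have /andP[] := f01 z].
    have h1 : nnm (@one_fun R N) by exact: nnm_cst.
    have P0 := (nnm_perturb hK mW WL hf).2 (t, y).
    have Pl : (perturb (@heatk R N mu) W L (EFin \o f) (t, y) <=
        (2 * expR (- (ln 2 / T * t)))%:E)%E.
      apply: le_trans (decay t y t0); apply: (perturb_mono hK mW WL _ hf h1) => z.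
      by rewrite lee_fin; have /andP[] := f01 z.
    rewrite /perturb_sol fine_ge0//= -lee_fin fineK// ge0_fin_numE//.
    exact: le_lt_trans Pl (ltry _).
  apply: filterS repr => y ->.
  have /andP[p0 p1] : 0 <= perturb_sol mu W L (fun y => Num.max (psi y) 0) t y <= 2 * expR (- (ln 2 / T * t)).
    apply: Ub => [|z]; first exact: measurable_maxr.
    by rewrite le_max lexx orbT ge_max ler01 andbT (le_trans (ler_norm _)).
  have /andP[n0 n1] : 0 <= perturb_sol mu W L (fun y => Num.max (- psi y) 0) t y <= 2 * expR (- (ln 2 / T * t)).
    apply: Ub => [|z]; first by apply: measurable_maxr => //; exact: measurableT_comp.
    by rewrite le_max lexx orbT ge_max ler01 andbT (le_trans (ler_norm _))// normrN.
  by rewrite ler_norml; apply/andP; split; lra.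
move=> G [_ Gbig].
have [d d0 [r0 r00 low]] := potential_ball_lower hK mW W0 WL T0 PT.
apply: integral_eqNy.
- exact/measurable_EFinP.
- by apply: filterS V_le0 => x.
(* With r >= 1 and N > 0, r <= r^N, so d r^N is at least |M|. *)
move=> M; pose r := Num.max r0 (Num.max 1 (`|M| / d)).
have rr0 : r0 <= r by rewrite le_max lexx.
have r1 : 1 <= r by rewrite !le_max lexx !orbT.
have rM : `|M| / d <= r by rewrite !le_max lexx !orbT.
have [x0 x0G] : exists x0, eball x0 (2 * r) `<=` G.
  by apply: Gbig; rewrite mulr_gt0// (lt_le_trans r00).
exists (eball x0 (2 * r)) => //.
have -> : (\int[leb N]_(x in eball x0 (2 * r)) (EFin \o V)^\- x =
    \int[leb N]_(x in eball x0 (2 * r)) (W x)%:E)%E.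
  apply: ae_eq_integral; first exact: measurable_eball.
  - by apply: measurable_funTS; apply: measurable_funeneg; exact/measurable_EFinP.
  - by apply: measurable_funTS; exact/measurable_EFinP.
  apply: filterS VW => y VWy _; rewrite funenegE/= VWy opprK max_l//.
  by rewrite lee_fin.
apply: le_trans (low r x0 rr0); rewrite lee_fin (le_trans (ler_norm M))//.
rewrite -ler_pdivrMl// mulrC (le_trans rM)//.
by rewrite -[X in X <= _]expr1; apply: ler_weXn2l.
Qed.
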